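(* For $A,B\in\mathbb{Z}$ let $f(x)=f_{A,B}(x):=x^4+Ax^3+Bx^2+Ax+1\in\mathbb{Z}[x]$, and set $W_1:=B+2-2A$, $W_2:=B+2+2A$, $W_3:=A^2-4B+8$ and $W:=W_1W_2W_3$. (1) Consider the polynomials $f(x)$ with $A\notin\{0,1,-1\}$ and $B=0$. (a) For such $A$ (and $B=0$), $f(x)$ is monogenic if and only if $2\mid A$ and the three integers $A-1$, $A+1$ and $(A/2)^2+2$ are all squarefree. (b) The set $\mathcal{F}$ of all monogenic polynomials $f(x)$ with $A\notin\{0,1,-1\}$ and $B=0$ is infinite. (c) $\mathrm{Gal}(f)\simeq D_4$ for each $f(x)\in\mathcal{F}$. (d) The set $\mathcal{F}^{+}:=\{f(x)\in\mathcal{F}: A\ge 2\}$ is a complete set of distinct monogenic quartic polynomials of this form; that is, any two different elements of $\mathcal{F}^{+}$ are distinct (not equivalent), and every element of $\mathcal{F}$ is equivalent to an element of $\mathcal{F}^{+}$. (2) Consider the polynomials $f(x)$ with $AB\neq 0$ and $W_3$ not a square. (I) For such $A,B$, $f(x)$ is monogenic if and only if all of the following hold: (a) $W_1$ is squarefree; (b) $W_2$ is squarefree; (c) if $2\mid A$ and $2\mid B$, then $W_3/4$ is squarefree and $(A\bmod 4,\,B\bmod 4)\in\{(0,0),(2,0)\}$; (d) if $2\mid A$ and $2\nmid B$, then $W_3/4$ is squarefree and $(A\bmod 4,\,B\bmod 4)\in\{(0,3),(2,1)\}$; (e) if $2\nmid A$ and $2\mid B$, then $W_3$ is squarefree and $(A\bmod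 4,\,B\bmod 4)\in\{(1,2),(3,2)\}$; (f) if $2\nmid AB$, then $W_3$ is squarefree and $(A\bmod 4,\,B\bmod 4)\in\{(1,1),(1,3),(3,1),(3,3)\}$. (II) Define the following sets of monogenic polynomials $f(x)$ (with $AB\neq 0$ and $W_3$ not a square): $\mathcal{F}_1:=\{f(x) \text{ monogenic}: 2\mid A \text{ and } 2\mid B\}$; $\mathcal{F}_2:=\{f(x) \text{ monogenic}: 2\mid A \text{ and } 2\nmid B\}$; $\mathcal{F}_3:=\{f(x) \text{ monogenic}: 2\nmid A \text{ and } 2\mid B\}$; $\mathcal{F}_4:=\{f(x) \text{ monogenic}: 2\nmid AB \text{ and } W \text{ is not a square}\}$; $\mathcal{F}_5:=\{f(x) \text{ monogenic}: 2\nmid AB \text{ and } W \text{ is a square}\}$. Then the sets $\mathcal{F}_1,\dots,\mathcal{F}_5$ partition the set of all monogenic polynomials $f(x)$ with $AB\neq 0$. Moreover, for each $i\in\{1,2,3,4\}$, $\mathrm{Gal}(f)\simeq D_4$ for every $f(x)\in\mathcal{F}_i$, and $\mathcal{F}_i$ contains infinitely many (pairwise) distinct monogenic polynomials. The set $\mathcal{F}_5$ contains precisely the six monogenic polynomials $$x^4+\varepsilon x^3+x^2+\varepsilon x+1,\qquad x^4+9\varepsilon x^3+19x^2+9\varepsilon x+1,\qquad x^4+11\varepsilon x^3+31x^2+11\varepsilon x+1,$$ where $\varepsilon\in\{1,-1\}$, and $\mathrm{Gal}(f)\simeq C_4$ for each $f(x)\in\mathcal{F}_5$. Furthermore, the three-element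 set consisting of these polynomials with $\varepsilon=1$ is a maximal subset of $\mathcal{F}_5$ consisting of (pairwise) distinct polynomials.
   Context: A polynomial $f(x)=x^4+Ax^3+Bx^2+Ax+1\in\mathbb{Z}[x]$ is called monogenic if it is irreducible over $\mathbb{Q}$ and $\{1,\theta,\theta^2,\theta^3\}$ is a $\mathbb{Z}$-basis for the ring of integers of the quartic field $\mathbb{Q}(\theta)$, where $f(\theta)=0$. Two irreducible quartic polynomials are called equivalent if they generate the same quartic field (i.e. $\mathbb{Q}(\theta_1)=\mathbb{Q}(\theta_2)$ for some roots $\theta_1$, $\theta_2$ of the respective polynomials, equivalently the fields they generate are isomorphic); otherwise they are called distinct. $\mathrm{Gal}(f)$ denotes the Galois group over $\mathbb{Q}$ of (the splitting field of) $f(x)$. $C_4$ is the cyclic group of order $4$ and $D_4$ is the dihedral group of order $8$. ''Square'' means the square of an integer. An integer (possibly negative) is squarefree if it is not divisible by $p^2$ for any prime $p$; thus $\pm1$ are squarefree and $0$ is not. For an integer $n$, $n\bmod 4$ denotes its remainder in $\{0,1,2,3\}$. *)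

(* Defs.v *)
From mathcomp Require Import all_boot all_order all_algebra all_fingroup all_solvable all_field.
From mathcomp Require Import boolp classical_sets functions cardinality.

Set Implicit Arguments.
Unset Strict Implicit.
Unset Printing Implicit Defensive.

Import GRing.Theory.

Local Open Scope ring_scope.

Definition quart (A B : int) : {poly int} :=
  'X^4 + A%:P * 'X^3 + B%:P * 'X^2 + A%:P * 'X + 1.

Definition W1 (A B : int) : int := B + 2 - 2 * A.
Definition W2 (A B : int) : int := B + 2 + 2 * A.
Definition W3 (A B : int) : int := A ^+ 2 - 4 * B + 8.
Definition W (A B : int) : int := W1 A B * W2 A B * W3 A B.

Definition is_square (n : int) : Prop := exists k : int, n = k ^+ 2.

Definition squarefree (n : int) : Prop :=
  forall p : nat, prime p -> ~~ ((p%:Z ^+ 2)%R %| n)%Z.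

Definition polyQ (L : nzRingType) (f : {poly int}) : {poly L} :=
  map_poly (intr : int -> L) f.

(* The ring of integers of the subfield Q(theta) of L. *)
Definition ring_of_integers (L : fieldExtType rat) (theta : L) : set L :=
  [set x : L | x \in <<1; theta>>%VS /\ integralOver (intr : int -> L) x].

Definition Zbasis (V : zmodType) (n : nat) (b : 'I_n -> V) (M : set V) : Prop :=
  [/\ forall i, M (b i),
      forall c : 'I_n -> int, \sum_(i < n) b i *~ c i = 0 -> forall i, c i = 0
    & forall x, M x -> exists c : 'I_n -> int, x = \sum_(i < n) b i *~ c i].

(* The choice of the root theta and of the ambient field L is immaterial: once
   f is irreducible such a pair exists, and all the fields Q(theta) are
   isomorphic. *)
Definition monogenic (f : {poly int}) : Prop :=
  irreducible_poly (polyQ rat f) /\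
  forall (L : fieldExtType rat) (theta : L), root (polyQ L f) theta ->
    Zbasis (fun i : 'I_4 => theta ^+ i) (ring_of_integers theta).

Definition equivalent (f g : {poly int}) : Prop :=
  exists (L : fieldExtType rat) (theta1 theta2 : L),
    [/\ root (polyQ L f) theta1, root (polyQ L g) theta2
      & <<1; theta1>>%VS = <<1; theta2>>%VS].

Definition pairwise_distinct (S : set {poly int}) : Prop :=
  forall f g, S f -> S g -> f <> g -> ~ equivalent f g.

(* A splitting field L of f over Q exists and is unique up to isomorphism, so
   the choice of L is immaterial. *)
Definition Gal_isog (f : {poly int}) (G : finGroupType) : Prop :=
  forall L : splittingFieldType rat,
    splittingFieldFor 1 (polyQ L f) {:L} -> 'Gal({:L} / 1) \isog [set: G]%g.

Definition calF : set {poly int} :=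
  [set f | exists A : int,
    [/\ A \notin [:: 0; 1; -1], f = quart A 0 & monogenic f]].

Definition calFplus : set {poly int} :=
  [set f | exists A : int,
    [/\ A \notin [:: 0; 1; -1], f = quart A 0, monogenic f & 2 <= A]].

Definition monogenic_with (P : int -> int -> Prop) : set {poly int} :=
  [set f | exists A B : int,
    [/\ A * B != 0, ~ is_square (W3 A B), P A B, f = quart A B & monogenic f]].

Definition calF1 : set {poly int} :=
  monogenic_with (fun A B => (2 %| A)%Z /\ (2 %| B)%Z).
Definition calF2 : set {poly int} :=
  monogenic_with (fun A B => (2 %| A)%Z /\ ~~ (2 %| B)%Z).
Definition calF3 : set {poly int} :=
  monogenic_with (fun A B => ~~ (2 %| A)%Z /\ (2 %| B)%Z).
Definition calF4 : set {poly int} :=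
  monogenic_with (fun A B => ~~ (2 %| A * B)%Z /\ ~ is_square (W A B)).
Definition calF5 : set {poly int} :=
  monogenic_with (fun A B => ~~ (2 %| A * B)%Z /\ is_square (W A B)).

(* Entry 0 of the list is calF1, ..., entry 4 is calF5. *)
Definition calFam (i : 'I_5) : set {poly int} :=
  nth set0 [:: calF1; calF2; calF3; calF4; calF5] i.

Definition cyclic_reps (e : int) : set {poly int} :=
  [set quart e 1; quart (9 * e) 19; quart (11 * e) 31]%classic.

(* Main.v *)
(* Let theta, 1/theta, phi, 1/phi be the roots of f, with u = theta + 1/theta and
   v = phi + 1/phi.  Then u + v = -A, u v = B - 2, (u - v)^2 = W3, and W1, W2 are
   the norms of u + 2 and u - 2, so that theta^2 - u theta + 1, of discriminant
   (u - 2)(u + 2), presents Q(theta) as a quadratic extension of Q(u).  The ring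
   Z[theta] = Z[u][theta] is maximal exactly when Z[u] is (a squarefree condition
   on W3) and W1, W2 are squarefree: if they are not, an integral element outside
   Z[theta] is written down; if they are, Z[u]/(u - 2) and Z[u]/(u + 2) are
   reduced, and this removes all denominators, theta - 1 being of Eisenstein type
   along u - 2.

   The Galois group is a transitive subgroup of the dihedral group preserving the
   blocks {theta, 1/theta}, {phi, 1/phi}; it is dihedral unless W or W1 W2 is a
   square.  When W is a square, the equations reduce to D p^2 = m^2 + 4 and
   A^2 = 16 + D (1 + 4 p) with D = W3 and m | A, which have finitely many
   solutions.  Monogenic polynomials with isomorphic fields have the same
   discriminant W1 W2 W3^2.  The infinite families come from substitutions for
   which W1, W2, W3 split into at most three linear factors in one parameter,
   simultaneously squarefree infinitely often by an elementary sieve; for B = 0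
   the factor (A/2)^2 + 2 is quadratic and its divisibility by squares of large
   primes is controlled by the sparseness of the solutions of m^2 - k p^2 = -2. *)


Require Import Defs.
From mathcomp Require Import all_boot all_order all_algebra all_fingroup all_solvable all_field.
From mathcomp Require Import boolp classical_sets functions cardinality.
From mathcomp Require Import zify ring lra.
Local Open Scope ring_scope.

Set Implicit Arguments.
Unset Strict Implicit.
Unset Printing Implicit Defensive.

Import Order.TTheory GRing.Theory Num.Theory.

(** * Squarefree integers *)

(** Integrality is tested in [algC], where a rational algebraic integer is an integer. No ideals
    appear: an element of Q(u) is carried along with its image under u -> v, and reduction modulo u
    - 2 or u + 2 becomes, after taking norms, a divisibility by W2 = (u - 2) (v - 2) or W1 = (u + 2)
    (v + 2); squarefreeness enters only as: D divides x^2 implies D divides x. An element of an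
    abstract Q(theta) reaches [algC] through its rational coordinates, because f is irreducible and
    a relation at one root holds at all of them. Irreducibility is therefore settled first: it rests
    on W3 not being a square and on A being nonzero, and A nonzero also keeps W1 W2 from being a
    square, so the Klein four-group never occurs. In the sieve a prime p may spoil up to four
    classes modulo p^2, which for p = 2 could be all of them. Parameters are therefore chosen so
    that 2 and 3 are harmless by congruences, and only p >= 5 is sieved. *)

Lemma squarefree_neq0 D : squarefree D -> D != 0.
Proof. by move/(_ 2 isT); apply: contra => /eqP ->; rewrite dvdz0. Qed.

Lemma squarefree_sqr_dvd D d :
  squarefree D -> (d ^+ 2 %| D)%Z -> `|d|%N = 1%N.
Proof.
move=> sqD dD; case: (eqVneq `|d|%N 1%N) => // d1; exfalso.
have [p pp pd] : exists2 p, prime p & (p %| `|d|)%N.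
  case: (ltngtP `|d|%N 1) d1 => // [d1|d1] _; last first.
    by exists (pdiv `|d|); [exact: pdiv_prime | exact: pdiv_dvd].
  (* What is left is d = 0, which 2 divides. *)
  exists 2 => //; move: d1; case: `|d|%N => //.
have /negP := sqD p pp; apply; apply: dvdz_trans dD.
by apply: dvdz_exp2r; rewrite dvdzE.
Qed.

(** Write D = d g and x = y g with g the gcd. Then d is coprime to y and divides g y^2, so d divides
    g and d^2 divides D; hence d is a unit. *)
Lemma squarefree_dvd_sqr D x : squarefree D -> (D %| x ^+ 2)%Z -> (D %| x)%Z.
Proof.
move=> sqD Dx; have D0 := squarefree_neq0 sqD.
have g0 : gcdz D x != 0 by rewrite gcdz_eq0 negb_and D0.
have /dvdzP[d Dd] := dvdz_gcdl D x; have /dvdzP[y xy] := dvdz_gcdr D x.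
have cop : coprimez d y.
  apply/coprimezP; have [a [b ab]] := Bezoutz D x; exists (a, b) => /=.
  by apply: (mulIf g0); rewrite mul1r mulrDl -!mulrA -Dd -xy.
have dg : (d %| gcdz D x)%Z.
  have : (d %| gcdz D x * y ^+ 2)%Z.
    rewrite -(dvdz_mul2r g0) -Dd.
    by have -> : gcdz D x * y ^+ 2 * gcdz D x = x ^+ 2 by rewrite {3}xy; ring.
  by rewrite Gauss_dvdzl // coprimezXr.
have : (d ^+ 2 %| D)%Z by rewrite Dd expr2 dvdz_mul.
move/(squarefree_sqr_dvd sqD) => d1.
have dy : (d %| y)%Z by rewrite dvdzE d1 dvd1n.
by have := dvdz_mul dy (dvdzz (gcdz D x)); rewrite -Dd -xy.
Qed.

Lemma squarefreeN D : squarefree (- D) <-> squarefree D.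
Proof. by split=> h p pp; have := h p pp; rewrite !dvdzE abszN. Qed.

Lemma squarefree_dvd D E : squarefree D -> (E %| D)%Z -> squarefree E.
Proof. by move=> h ED p pp; apply: contra (h p pp) => /dvdz_trans; apply. Qed.

Lemma not_squarefreeP D :
  ~ squarefree D -> exists2 p : nat, prime p & (p%:Z ^+ 2 %| D)%Z.
Proof.
move=> h; apply: contrapT => h2; apply: h => p pp; apply/negP => hp.
by apply: h2; exists p.
Qed.

Lemma squarefree_small (D : int) (n : nat) :
  D != 0 -> (`|D| < n.+1 ^ 2)%N ->
  (forall p : nat, prime p -> (p <= n)%N -> ~~ (p ^ 2 %| `|D|)%N) -> squarefree D.
Proof.
move=> D0 Dn h p pp; rewrite dvdzE abszX absz_nat.
case: (leqP p n) => [|np]; first exact: h.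
apply/negP => /dvdn_leq; rewrite lt0n absz_eq0 D0 => /(_ isT) pD.
have np2 : (n.+1 ^ 2 <= p ^ 2)%N by rewrite leq_exp2r.
by have := leq_trans Dn (leq_trans np2 pD); rewrite ltnn.
Qed.

(** * Integers of a quadratic extension of Q(u) *)

(** Maximality of Z[u] in Q(u): u is a root of X^2 + A X + B - 2, of discriminant W3. For A even W3
    = 4 D, and D must be squarefree and not 1 modulo 4; for A odd W3 is 1 modulo 4 by itself. *)
Definition max_quad_order (A B : int) : Prop :=
  if (2 %| A)%Z then squarefree (W3 A B %/ 4)%Z /\ ((W3 A B %/ 4)%Z %% 4)%Z != 1
  else squarefree (W3 A B).


Section QuadraticPairs.

Variables (A B : int) (u v : algC).
Hypothesis uDv : u + v = - A%:~R.
Hypothesis uMv : u * v = B%:~R - 2.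

(** An element of S[u] together with its conjugate: Z[u] for S = [Num.int], Q(u) for S = [Crat].
    Keeping both components makes traces and norms directly available. *)
Definition qpair (S : {pred algC}) (x y : algC) : Prop :=
  exists r0 r1, [/\ r0 \in S, r1 \in S, x = r0 + r1 * u & y = r0 + r1 * v].

Lemma sqr_u : u ^+ 2 = - A%:~R * u - (B%:~R - 2).
Proof. by rewrite -uDv -uMv; ring. Qed.

Lemma sqr_v : v ^+ 2 = - A%:~R * v - (B%:~R - 2).
Proof. by rewrite -uDv -uMv; ring. Qed.

Section Closure.
Variable S : subringClosed algC.

Lemma qpair_const c : c \in S -> qpair S c c.
Proof. by move=> cS; exists c, 0; rewrite !mul0r !addr0 rpred0. Qed.

Lemma qpair_gen : qpair S u v.
Proof. by exists 0, 1; rewrite !mul1r !add0r rpred0 rpred1. Qed.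

Lemma qpairD x y x' y' : qpair S x y -> qpair S x' y' -> qpair S (x + x') (y + y').
Proof.
move=> [a [b [aS bS -> ->]]] [c [d [cS dS -> ->]]].
by exists (a + c), (b + d); rewrite !rpredD //; split=> //; ring.
Qed.

Lemma qpairM x y x' y' : qpair S x y -> qpair S x' y' -> qpair S (x * x') (y * y').
Proof.
move=> [a [b [aS bS -> ->]]] [c [d [cS dS -> ->]]].
exists (a * c - b * d * (B%:~R - 2)), (a * d + b * c - b * d * A%:~R).
have zS (n : int) : n%:~R \in S by rewrite rpred_int.
split.
- by rewrite !(rpredB, rpredM) // (zS 2).
- by rewrite !(rpredB, rpredD, rpredM).
- have -> : (a + b * u) * (c + d * u) = a * c + (a * d + b * c) * u + b * d * u ^+ 2 by ring.
  by rewrite sqr_u; ring.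
- have -> : (a + b * v) * (c + d * v) = a * c + (a * d + b * c) * v + b * d * v ^+ 2 by ring.
  by rewrite sqr_v; ring.
Qed.

Lemma qpairN x y : qpair S x y -> qpair S (- x) (- y).
Proof.
move=> [a [b [aS bS -> ->]]].
by exists (- a), (- b); rewrite !rpredN //; split=> //; ring.
Qed.

Lemma qpairB x y x' y' : qpair S x y -> qpair S x' y' -> qpair S (x - x') (y - y').
Proof. by move=> h1 h2; apply: qpairD => //; apply: qpairN. Qed.

Lemma qpairX x y n : qpair S x y -> qpair S (x ^+ n) (y ^+ n).
Proof.
move=> h; elim: n => [|n IH]; first by apply: qpair_const; rewrite rpred1.
by rewrite !exprS; apply: qpairM.
Qed.

End Closure.

Lemma qpair_rat x y : qpair Num.int x y -> qpair Crat x y.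
Proof.
move=> [a [b [/intrP[m ->] /intrP[n ->] -> ->]]].
by exists m%:~R, n%:~R; rewrite !rpred_int.
Qed.

(** The integer [n ^+ 2 + A * n + (B - 2)] is the norm N of u - n, and Z[u]/(u - n) is Z/N, which is
    reduced when N is squarefree. So u - n divides e as soon as it divides e^2. *)
Lemma qpair_sqr_red (n : int) e e' w w' :
  squarefree (n ^+ 2 + A * n + (B - 2)) ->
  qpair Num.int e e' -> qpair Num.int w w' ->
  e ^+ 2 = (u - n%:~R) * w -> e' ^+ 2 = (v - n%:~R) * w' ->
  exists g g', [/\ qpair Num.int g g', e = (u - n%:~R) * g & e' = (v - n%:~R) * g'].
Proof.
set N := (X in squarefree X) => sqN [e0 [e1 [/intrP[m0 ->] /intrP[m1 ->] -> ->]]] Zw.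
have nN : (u - n%:~R) * (v - n%:~R) = N%:~R.
  rewrite /N; have -> : (u - n%:~R) * (v - n%:~R) = u * v - n%:~R * (u + v) + n%:~R ^+ 2 by ring.
  by rewrite uDv uMv !(rmorphD, rmorphM, rmorphB, rmorphXn) /=; ring.
(* The residue of e modulo u - n, obtained by putting u = n. *)
pose c := m0 + n * m1.
move=> Eu Ev.
have cD x : m0%:~R + m1%:~R * x = c%:~R + m1%:~R * (x - n%:~R) :> algC.
  by rewrite /c rmorphD rmorphM /=; ring.
have Zm (m : int) : qpair Num.int m%:~R m%:~R by apply: qpair_const; rewrite rpred_int.
have [w1 [w1' [[s0 [s1 [/intrP[t0 ->] /intrP[t1 ->] -> ->]]] cu cv]]] : exists w1 w1',
  [/\ qpair Num.int w1 w1', c%:~R ^+ 2 = (u - n%:~R) * w1 & c%:~R ^+ 2 = (v - n%:~R) * w1'].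
  exists (w - 2%:~R * (c%:~R * m1%:~R) - m1%:~R ^+ 2 * (u - n%:~R)),
         (w' - 2%:~R * (c%:~R * m1%:~R) - m1%:~R ^+ 2 * (v - n%:~R)); split.
  - apply: qpairB; first apply: qpairB => //.
      by rewrite -!rmorphM; apply: Zm.
    by apply: qpairM; [apply: qpairX; apply: Zm | apply: qpairB; [exact: qpair_gen | exact: Zm]].
  - by move: Eu; rewrite cD => Eu; rewrite !mulrBr -Eu; ring.
  - by move: Ev; rewrite cD => Ev; rewrite !mulrBr -Ev; ring.
(* The norm of c^2 = (u - n) w1 is c^4 = N * norm(w1). Two applications of squarefreeness then give
   N | c, and N is itself a multiple of u - n. *)
have Nc : (N %| (c ^+ 2) ^+ 2)%Z.
  apply/dvdzP; exists (t0 ^+ 2 - A * t0 * t1 + (B - 2) * t1 ^+ 2).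
  apply/eqP; rewrite -(eqr_int algC) rmorphXn rmorphXn /= {1}expr2 {1}cu cv.
  have -> : (u - n%:~R) * (t0%:~R + t1%:~R * u) * ((v - n%:~R) * (t0%:~R + t1%:~R * v)) =
    ((u - n%:~R) * (v - n%:~R)) * (t0%:~R ^+ 2 + t0%:~R * t1%:~R * (u + v) + t1%:~R ^+ 2 * (u * v)) by ring.
  rewrite nN uDv uMv !(rmorphD, rmorphM, rmorphB, rmorphXn) /=; apply/eqP; ring.
have /dvdzP[q cq] := squarefree_dvd_sqr sqN (squarefree_dvd_sqr sqN Nc).
have qq : c%:~R = q%:~R * ((u - n%:~R) * (v - n%:~R)) :> algC by rewrite cq rmorphM /= nN.
exists (m1%:~R + q%:~R * (v - n%:~R)), (m1%:~R + q%:~R * (u - n%:~R)); split.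
- have vE : v = - A%:~R - u by rewrite -uDv; ring.
  have uE : u = - A%:~R - v by rewrite -uDv; ring.
  exists (m1 - q * A - q * n)%:~R, (- q)%:~R; split; rewrite ?rpred_int //.
    by rewrite {1}vE !(rmorphD, rmorphM, rmorphB, rmorphN) /=; ring.
  by rewrite {1}uE !(rmorphD, rmorphM, rmorphB, rmorphN) /=; ring.
- by rewrite cD qq; ring.
- by rewrite cD qq; ring.
Qed.

Lemma sqr_uBv : (u - v) ^+ 2 = (W3 A B)%:~R.
Proof.
have -> : (u - v) ^+ 2 = (u + v) ^+ 2 - 4%:R * (u * v) by ring.
by rewrite uDv uMv /W3 !(rmorphD, rmorphM, rmorphB, rmorphXn, rmorphN) /=; ring.
Qed.

End QuadraticPairs.

Lemma Crat_sqr_squarefree (r : algC) (D m : int) :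
  squarefree D -> r \in Crat -> r ^+ 2 * D%:~R = m%:~R -> r \in Num.int.
Proof.
move=> sqD /CratP[q ->] E.
have d0 : denq q != 0 by [].
have : (denq q ^+ 2 %| D)%Z.
  have cop : coprimez (denq q ^+ 2) (numq q ^+ 2).
    by rewrite coprimezE !abszX coprimeXl // coprimeXr // coprime_sym coprime_num_den.
  rewrite -(Gauss_dvdzr D cop); apply/dvdzP; exists m.
  apply/eqP; rewrite -(eqr_int algC); apply/eqP; rewrite [LHS]rmorphM [RHS]rmorphM /= -E !rmorphXn /=.
  have nq : (numq q)%:~R = ratr q * (denq q)%:~R :> algC.
    by rewrite /ratr divfK ?intr_eq0.
  by rewrite nq; ring.
move/(squarefree_sqr_dvd sqD) => d1; apply/intrP; exists (numq q).
by rewrite /ratr; have -> : denq q = 1 by [have := denq_gt0 q; lia]; rewrite divr1.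
Qed.

(** For D equal to 2 or 3 modulo 4, (t + n sqrt D) / 2 has an integral norm only when t and n are
    even: the squares modulo 4 are 0 and 1. *)
Lemma norm_form_mod4 (D t n m : int) :
  squarefree D -> (D %% 4)%Z != 1 -> t ^+ 2 - D * n ^+ 2 = 4 * m ->
  (2 %| t)%Z /\ (2 %| n)%Z.
Proof.
move=> /(_ 2%N isT) D4 D1 E.
have {}D4 : ~~ (4 %| D)%Z by [].
pose i := (t %% 2)%Z; pose j := (n %% 2)%Z; pose k := (D %% 4)%Z.
have [t' Et] : exists t', t = 2 * t' + i by exists (t %/ 2)%Z; rewrite /i; lia.
have [n' En] : exists n', n = 2 * n' + j by exists (n %/ 2)%Z; rewrite /j; lia.
have [D' ED] : exists D', D = 4 * D' + k by exists (D %/ 4)%Z; rewrite /k; lia.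
have ij : (i = 0 \/ i = 1) /\ (j = 0 \/ j = 1) by rewrite /i /j; lia.
have k23 : k = 2 \/ k = 3 by move: D4 D1; rewrite /k; lia.
clearbody i j k.
have F : i ^+ 2 - k * j ^+ 2 =
   4 * (m - t' ^+ 2 - t' * i + D' * n ^+ 2 + k * (n' ^+ 2 + n' * j)).
  have -> : 4 * (m - t' ^+ 2 - t' * i + D' * n ^+ 2 + k * (n' ^+ 2 + n' * j)) =
    4 * m - 4 * (t' ^+ 2 + t' * i - D' * n ^+ 2 - k * (n' ^+ 2 + n' * j)) by ring.
  by rewrite -E Et En ED; ring.
have {F} : (4 %| i ^+ 2 - k * j ^+ 2)%Z by rewrite F dvdz_mulr.
rewrite Et En; case: ij => - [] -> [] ->; case: k23 => ->; rewrite ?expr0n ?expr1n /=; lia.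
Qed.

Section IntegralPairs.

Variables (A B : int) (u v : algC).
Hypothesis uDv : u + v = - A%:~R.
Hypothesis uMv : u * v = B%:~R - 2.
Hypothesis u_Aint : u \in Aint.
Hypothesis maxAB : max_quad_order A B.

(** Integral closedness of Z[u]. The number (x - y)^2 = r1^2 W3 is rational and integral, which
    bounds the denominator of r1: it is 1 for A odd and at most 2 for A even, where the norm x y
    excludes 2. Then r0 = x - r1 u is rational and integral. *)
Lemma qpair_Aint_int x y :
  qpair u v Crat x y -> x \in Aint -> y \in Aint -> qpair u v Num.int x y.
Proof.
move=> [r0 [r1 [r0Q r1Q Ex Ey]]] Ix Iy.
have Qz (n : int) : n%:~R \in Crat by rewrite rpred_int.
have ZI z : z \in Crat -> z \in Aint -> exists n : int, z = n%:~R.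
  by move=> h1 h2; apply/intrP; apply: Cint_rat_Aint.
have [m Em] : exists m : int, r1 ^+ 2 * (W3 A B)%:~R = m%:~R.
  apply: ZI; first by rewrite rpredM ?rpredX.
  by rewrite -(sqr_uBv uDv uMv) -exprMn; apply: rpredX; have -> : r1 * (u - v) = x - y by [rewrite Ex Ey; ring]; apply: rpredB.
have [n En] : exists n : int, x + y = n%:~R.
  apply: ZI; last exact: rpredD.
  have -> : x + y = 2%:~R * r0 + r1 * (u + v) by rewrite Ex Ey; ring.
  by rewrite uDv rpredD ?rpredM ?rpredN.
have En' : n%:~R = 2%:~R * r0 - r1 * A%:~R.
  by rewrite -En Ex Ey -[in RHS]mulrN -uDv; ring.
have r1Z : r1 \in Num.int.
  move: maxAB; rewrite /max_quad_order; case: ifP => [A2 [sqD D1]|_ sqD]; last first.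
    exact: Crat_sqr_squarefree Em.
  have [a Ea] : exists a, A = 2 * a by exists (A %/ 2)%Z; lia.
  have ED : W3 A B = 4 * (W3 A B %/ 4)%Z.
    by rewrite /W3 Ea; have -> : (2 * a) ^+ 2 - 4 * B + 8 = 4 * (a ^+ 2 - B + 2) by [ring]; lia.
  have DE : (W3 A B %/ 4)%Z = a ^+ 2 - B + 2.
    by rewrite /W3 Ea; have -> : (2 * a) ^+ 2 - 4 * B + 8 = 4 * (a ^+ 2 - B + 2) by [ring]; lia.
  have [n1 En1] : exists n1 : int, 2%:~R * r1 = n1%:~R.
    apply/intrP; apply: (Crat_sqr_squarefree sqD (m := m)); first by rewrite rpredM.
    by rewrite -Em [in RHS]ED rmorphM /=; ring.
  have [n0 En0] : exists n0 : int, 2%:~R * r0 = n0%:~R.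
    exists (n + a * n1); rewrite intrD intrM -En1 En' Ea; rewrite intrM; ring.
  have [k Ek] : exists k : int, x * y = k%:~R.
    apply: ZI; last exact: rpredM.
    have -> : x * y = r0 ^+ 2 + r0 * r1 * (u + v) + r1 ^+ 2 * (u * v) by rewrite Ex Ey; ring.
    by rewrite uDv uMv !(rpredB, rpredD, rpredM, rpredN, rpredX) // (Qz 2).
  (* With u = - a + sqrt D, twice x is (n0 - a n1) + n1 sqrt D, and the left side is four times the
     norm x y. *)
  have E4 : (n0 - a * n1) ^+ 2 - (W3 A B %/ 4)%Z * n1 ^+ 2 = 4 * k.
    apply/eqP; rewrite -(eqr_int algC) DE; apply/eqP.
    rewrite !expr2 !(intrB, intrD, intrM) -?En0 -?En1 -?Ek.
    have -> : x * y = r0 ^+ 2 + r0 * r1 * (u + v) + r1 ^+ 2 * (u * v) by rewrite Ex Ey; ring.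
    rewrite uDv uMv Ea intrM; ring.
  have [_ /dvdzP[q Eq]] := norm_form_mod4 sqD D1 E4.
  apply/intrP; exists q.
  have two0 : 2%:~R != 0 :> algC by rewrite intr_eq0.
  by apply: (mulfI two0); rewrite En1 Eq; rewrite intrM mulrC.
exists r0, r1; split => //.
apply: Cint_rat_Aint => //.
have -> : r0 = x - r1 * u by rewrite Ex; ring.
by rewrite rpredB // rpredM //; apply: Aint_Cint.
Qed.

End IntegralPairs.

Lemma Aint_sqr (x : algC) : x ^+ 2 \in Aint -> x \in Aint.
Proof.
have [q [Dq mq] _] := minCpolyP (x ^+ 2).
move=> Ix; have Zq : minCpoly (x ^+ 2) \is a polyOver Num.int by exact: Ix.
apply: (root_monic_Aint (p := minCpoly (x ^+ 2) \Po 'X^2)).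
- by have := root_minCpoly (x ^+ 2); rewrite !rootE horner_comp hornerXn.
- have mp : minCpoly (x ^+ 2) \is monic by rewrite Dq monic_map.
  by rewrite monicE lead_coef_comp ?size_polyXn // lead_coefXn expr1n mulr1.
- by apply: polyOver_comp => //; rewrite rpredX // polyOverX.
Qed.

(** * Integers of Q(theta) over Z[u] *)

Section RelativeIntegers.

Variables (A B : int) (th ph : algC).
Hypotheses (th0 : th != 0) (ph0 : ph != 0).
Hypotheses (thI : th \in Aint) (thVI : th^-1 \in Aint).
Hypotheses (phI : ph \in Aint) (phVI : ph^-1 \in Aint).
Let u := th + th^-1.
Let v := ph + ph^-1.
Hypothesis uDv : u + v = - A%:~R.
Hypothesis uMv : u * v = B%:~R - 2.
Hypotheses (sqW1 : squarefree (W1 A B)) (sqW2 : squarefree (W2 A B)).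
Hypothesis maxAB : max_quad_order A B.

(* With p = u - 2, z = th - 1 one has z^2 = p z + p: the polynomial of z over
   Q(u) is of Eisenstein type along p.  Hence p X and p (a + b) are integral,
   and reducing squares modulo p twice removes the denominators of a + b and b. *)
Lemma relative_basis_int a a' b b' :
  qpair u v Crat a a' -> qpair u v Crat b b' ->
  a + b * th \in Aint -> a + b * th^-1 \in Aint ->
  a' + b' * ph \in Aint -> a' + b' * ph^-1 \in Aint ->
  qpair u v Num.int a a' /\ qpair u v Num.int b b'.
Proof.
move=> Qa Qb I1 I2 I3 I4.
have uI : u \in Aint by rewrite rpredD.
have vI : v \in Aint by rewrite rpredD.
have toZ := qpair_Aint_int uDv uMv uI maxAB.
have MQ := qpairM uDv uMv (S := Crat).
have MZ x y x' y' : qpair u v Num.int x y -> qpair u v Num.int x' y' ->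
  qpair u v Num.int (x * x') (y * y') by apply: (qpairM uDv uMv).
have Qc (n : int) : qpair u v Crat n%:~R n%:~R by apply: qpair_const; rewrite rpred_int.
have Zc (n : int) : qpair u v Num.int n%:~R n%:~R by apply: qpair_const; rewrite rpred_int.
have Zu : qpair u v Num.int u v by apply: qpair_gen.
have AI (n : int) : n%:~R \in Aint by apply: Aint_int.
have thu : th ^+ 2 = u * th - 1 by rewrite /u; field.
have phv : ph ^+ 2 = v * ph - 1 by rewrite /v; field.
have thV : th^-1 = u - th by rewrite /u; ring.
have phV : ph^-1 = v - ph by rewrite /v; ring.
pose pi := u - 2%:~R; pose pi' := v - 2%:~R.
have Zpi : qpair u v Num.int pi pi' := qpairB Zu (Zc 2).
have Qpi := qpair_rat Zpi.
have piI : pi \in Aint by rewrite rpredB.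
have pi'I : pi' \in Aint by rewrite rpredB.
have N2 : pi * pi' = (W2 A B)%:~R.
  rewrite /pi /pi'; have -> : (u - 2%:~R) * (v - 2%:~R) = u * v - 2 * (u + v) + 4 by ring.
  by rewrite uDv uMv /W2 !(intrD, intrM); ring.
have N1 : (u + 2) * (v + 2) = (W1 A B)%:~R.
  have -> : (u + 2) * (v + 2) = u * v + 2 * (u + v) + 4 by ring.
  by rewrite uDv uMv /W1 !(intrD, intrM, intrB); ring.
have W10 : (W1 A B)%:~R != 0 :> algC by rewrite intr_eq0 squarefree_neq0.
have W20 : (W2 A B)%:~R != 0 :> algC by rewrite intr_eq0 squarefree_neq0.
have pi0 : pi != 0 by apply: contraNneq W20 => h; rewrite -N2 h mul0r.
have pi'0 : pi' != 0 by apply: contraNneq W20 => h; rewrite -N2 h mulr0.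
have E2 : (-2)%:~R = - 2 :> algC by rewrite mulrNz.
have redW1 := @qpair_sqr_red A B u v uDv uMv (-2).
rewrite E2 opprK in redW1.
have p10 : u + 2 != 0.
  by apply: contraNneq W10 => h; rewrite -N1 h mul0r.
have p1'0 : v + 2 != 0.
  by apply: contraNneq W10 => h; rewrite -N1 h mulr0.
have Zdel : qpair u v Num.int (pi * (u + 2)) (pi' * (v + 2)).
  by apply: MZ => //; apply: qpairD => //; apply: Zc 2.
have redW2 := @qpair_sqr_red A B u v uDv uMv 2.
rewrite (_ : (-2) ^+ 2 + A * -2 + (B - 2) = W1 A B) in redW1; last by rewrite /W1; ring.
rewrite (_ : 2 ^+ 2 + A * 2 + (B - 2) = W2 A B) in redW2; last by rewrite /W2; ring.
have delE : pi * (u + 2) = (th - th^-1) ^+ 2 by rewrite /pi /u; field.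
have delE' : pi' * (v + 2) = (ph - ph^-1) ^+ 2 by rewrite /pi' /v; field.
have Zw : qpair u v Num.int (pi * (u + 2) * b ^+ 2) (pi' * (v + 2) * b' ^+ 2).
  apply: toZ; first by apply: MQ; [exact: qpair_rat | exact: (qpairX uDv uMv)].
    have -> : pi * (u + 2) * b ^+ 2 = ((a + b * th) - (a + b * th^-1)) ^+ 2 by rewrite delE; ring.
    by rewrite rpredX // rpredB.
  have -> : pi' * (v + 2) * b' ^+ 2 = ((a' + b' * ph) - (a' + b' * ph^-1)) ^+ 2 by rewrite delE'; ring.
  by rewrite rpredX // rpredB.
have Iw : pi * (u + 2) * b ^+ 2 \in Aint.
  have -> : pi * (u + 2) * b ^+ 2 = ((a + b * th) - (a + b * th^-1)) ^+ 2 by rewrite delE; ring.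
  by rewrite rpredX // rpredB.
have Iw' : pi' * (v + 2) * b' ^+ 2 \in Aint.
  have -> : pi' * (v + 2) * b' ^+ 2 = ((a' + b' * ph) - (a' + b' * ph^-1)) ^+ 2 by rewrite delE'; ring.
  by rewrite rpredX // rpredB.
(* Put del = (u - 2) (u + 2) = (theta - 1/theta)^2. The difference of the two relative conjugates of
   X squares to del b^2, so del b^2 is integral, and so is del b, whose square is del times it. *)
have Ze : qpair u v Num.int (pi * (u + 2) * b) (pi' * (v + 2) * b').
  apply: toZ; first by apply: MQ => //; exact: qpair_rat.
    apply: Aint_sqr.
    have -> : (pi * (u + 2) * b) ^+ 2 = pi * (u + 2) * (pi * (u + 2) * b ^+ 2) by ring.
    by rewrite rpredM // rpredM // rpredD // (AI 2).
  apply: Aint_sqr.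
  have -> : (pi' * (v + 2) * b') ^+ 2 = pi' * (v + 2) * (pi' * (v + 2) * b' ^+ 2) by ring.
  by rewrite rpredM // rpredM // rpredD // (AI 2).
(* Since (del b)^2 = (u + 2) (p del b^2), the factor u + 2 can be divided out of del b, leaving f =
   p b in Z[u]. *)
have [f [f' [Zf fE fE']]] := redW1 _ _ _ _ sqW1 Ze (MZ _ _ _ _ Zpi Zw)
  ltac:(ring) ltac:(ring).
have {}fE : f = pi * b by apply: (mulfI p10); rewrite -fE; ring.
have {}fE' : f' = pi' * b' by apply: (mulfI p1'0); rewrite -fE'; ring.
have fI : f \in Aint.
  by have [n0 [n1 [/intrP[m0 ->] /intrP[m1 ->] -> _]]] := Zf; rewrite rpredD // rpredM.
have f'I : f' \in Aint.
  by have [n0 [n1 [/intrP[m0 ->] /intrP[m1 ->] _ ->]]] := Zf; rewrite rpredD // rpredM.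
have Zh : qpair u v Num.int (pi * (a + b)) (pi' * (a' + b')).
  apply: toZ; first by apply: MQ => //; apply: qpairD.
    have -> : pi * (a + b) = pi * (a + b * th) - f * (th - 1) by rewrite fE; ring.
    by rewrite !(rpredB, rpredM) // rpred1.
  have -> : pi' * (a' + b') = pi' * (a' + b' * ph) - f' * (ph - 1) by rewrite fE'; ring.
  by rewrite !(rpredB, rpredM) // rpred1.
pose N := (a + b * th) * (a + b * th^-1); pose N' := (a' + b' * ph) * (a' + b' * ph^-1).
have NE : N = (a + b) ^+ 2 + (a + b) * f - b * f.
  have -> : N = a ^+ 2 + a * b * u + b ^+ 2 by rewrite /N /u; field.
  by rewrite fE /pi; ring.
have NE' : N' = (a' + b') ^+ 2 + (a' + b') * f' - b' * f'.
  have -> : N' = a' ^+ 2 + a' * b' * v + b' ^+ 2 by rewrite /N' /v; field.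
  by rewrite fE' /pi'; ring.
have ZN : qpair u v Num.int N N'.
  apply: toZ; try by rewrite rpredM.
  rewrite NE NE'; have Qf := qpair_rat Zf.
  by apply: qpairB; first apply: qpairD; [apply: (qpairX uDv uMv) | apply: MQ | apply: MQ] => //; apply: qpairD.
(* For h = p (a + b), the relative norm N of X gives h^2 = p (p N - h f + f^2), so p divides h and a
   + b lies in Z[u]. *)
have [g [g' [Zg gE gE']]] := redW2 _ _ _ _ sqW2 Zh
   (qpairD (qpairB (MZ _ _ _ _ Zpi ZN) (MZ _ _ _ _ Zh Zf)) (MZ _ _ _ _ Zf Zf))
   ltac:(rewrite NE fE /pi; ring) ltac:(rewrite NE' fE' /pi'; ring).
have {}gE : g = a + b by apply: (mulfI pi0); rewrite -gE.
have {}gE' : g' = a' + b' by apply: (mulfI pi'0); rewrite -gE'.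
rewrite gE gE' in Zg.
(* Now that g = a + b lies in Z[u], the same norm reads f^2 = p (g^2 + g f - N), so p divides f = p
   b. *)
have [k [k' [Zk kE kE']]] := redW2 _ _ _ _ sqW2 Zf
   (qpairB (qpairD (MZ _ _ _ _ Zg Zg) (MZ _ _ _ _ Zg Zf)) ZN)
   ltac:(rewrite NE fE /pi; ring) ltac:(rewrite NE' fE' /pi'; ring).
have {}kE : k = b by apply: (mulfI pi0); rewrite -kE fE.
have {}kE' : k' = b' by apply: (mulfI pi'0); rewrite -kE' fE'.
rewrite kE kE' in Zk; split=> //.
by have := qpairB Zg Zk; rewrite !addrK.
Qed.

End RelativeIntegers.

(** * Factorization and irreducibility *)

Lemma polyQ_quart (F : comNzRingType) A B :
  polyQ F (quart A B) =
  'X^4 + A%:~R%:P * 'X^3 + B%:~R%:P * 'X^2 + A%:~R%:P * 'X + 1.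
Proof.
by rewrite /polyQ /quart !(rmorphXn, rmorphD, rmorphM) /= !map_polyC map_polyX rmorph1.
Qed.

Lemma horner_quart (F : comNzRingType) A B (x : F) :
  (polyQ F (quart A B)).[x] =
  x ^+ 4 + A%:~R * x ^+ 3 + B%:~R * x ^+ 2 + A%:~R * x + 1.
Proof. by rewrite polyQ_quart !hornerE. Qed.

Lemma map_polyQ (F G : nzRingType) (h : {rmorphism F -> G}) f :
  map_poly h (polyQ F f) = polyQ G f.
Proof.
rewrite /polyQ -map_poly_comp; apply: eq_map_poly => n /=.
by rewrite rmorph_int.
Qed.

Lemma quart_coefs A B : quart A B = \poly_(i < 5) [:: 1; A; B; A; 1]`_i.
Proof.
apply/polyP => i; rewrite /quart coef_poly !(coefD, coefXn, coefCM, coefX, coef1).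
by case: i => [|[|[|[|[|i]]]]] //=; rewrite ?(mulr1, mulr0, addr0, add0r).
Qed.

Lemma quart_inj A B A' B' : quart A B = quart A' B' -> A = A' /\ B = B'.
Proof.
rewrite !quart_coefs => /polyP h.
by have := h 1%N; have := h 2%N; rewrite !coef_poly /= => -> ->.
Qed.

Lemma size_quart A B : size (quart A B) = 5%N.
Proof. by rewrite quart_coefs size_poly_eq. Qed.

Lemma quart_monic A B : quart A B \is monic.
Proof. by rewrite monicE lead_coefE size_quart quart_coefs coef_poly. Qed.

Lemma polyQ_monic (F : nzRingType) f : f \is monic -> polyQ F f \is monic.
Proof. exact: monic_map. Qed.

Lemma size_polyQ (F : nzRingType) f : f \is monic -> size (polyQ F f) = size f.
Proof. by move=> mf; rewrite size_map_poly_id0 // (monicP mf) rmorph1 oner_neq0. Qed.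

Lemma size_quadratic (F : fieldType) (v : F) : size ('X^2 - v *: 'X + 1 : {poly F}) = 3%N.
Proof.
rewrite -addrA size_polyDl size_polyXn //.
apply: leq_ltn_trans (size_polyD _ _) _.
rewrite size_polyN gtn_max size_poly1 andbT.
by apply: leq_ltn_trans (size_scale_leq _ _) _; rewrite size_polyX.
Qed.

Section QuartRoots.

Variables (F : fieldType) (A B : int).

Lemma quart_root_neq0 (x : F) : root (polyQ F (quart A B)) x -> x != 0.
Proof.
apply: contraTneq => ->; rewrite rootE horner_quart.
by rewrite !expr0n /= !mulr0 !addr0 add0r oner_neq0.
Qed.

Lemma quart_rootE (x : F) : x != 0 ->
  (polyQ F (quart A B)).[x] =
  x ^+ 2 * ((x + x^-1) ^+ 2 + A%:~R * (x + x^-1) + (B%:~R - 2)).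
Proof. by move=> x0; rewrite horner_quart; field. Qed.

Lemma quart_factor (x v : F) :
  root (polyQ F (quart A B)) x -> x + x^-1 + v = - A%:~R ->
  (x + x^-1) * v = B%:~R - 2 /\
  polyQ F (quart A B) = ('X - x%:P) * ('X - x^-1%:P) * ('X^2 - v *: 'X + 1).
Proof.
move=> rx uv; have x0 := quart_root_neq0 rx.
have uMv : (x + x^-1) * v = B%:~R - 2.
  move: rx; rewrite rootE quart_rootE // mulf_eq0 expf_eq0 /= (negPf x0) /= => /eqP h.
  have -> : v = - A%:~R - (x + x^-1) by rewrite -uv; ring.
  by apply/eqP; rewrite -subr_eq0 -oppr_eq0 -[X in _ == X]h; apply/eqP; ring.
split=> //; rewrite polyQ_quart.
have -> : A%:~R = - (x + x^-1 + v) by rewrite uv opprK.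
have -> : B%:~R = (x + x^-1) * v + 2 by rewrite uMv subrK.
have xX : x%:P * x^-1%:P = 1 :> {poly F} by rewrite -polyCM divff.
rewrite -mul_polyC !(rmorphN, rmorphD, rmorphM) /=.
have -> : ('X - x%:P) * ('X - x^-1%:P) = 'X ^+ 2 - (x%:P + x^-1%:P) * 'X + 1 :> {poly F}.
  by rewrite -xX; ring.
by ring.
Qed.

Lemma quart_prod (x y : F) : x != 0 -> y != 0 ->
  x + x^-1 + (y + y^-1) = - A%:~R -> (x + x^-1) * (y + y^-1) = B%:~R - 2 ->
  polyQ F (quart A B) = \prod_(z <- [:: x; x^-1; y; y^-1]) ('X - z%:P).
Proof.
move=> x0 y0 uv uMv; rewrite polyQ_quart.
have -> : A%:~R = - (x + x^-1 + (y + y^-1)) by rewrite uv opprK.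
have -> : B%:~R = (x + x^-1) * (y + y^-1) + 2 by rewrite uMv subrK.
have xX : x%:P * x^-1%:P = 1 :> {poly F} by rewrite -polyCM divff.
have yX : y%:P * y^-1%:P = 1 :> {poly F} by rewrite -polyCM divff.
rewrite !big_cons big_nil mulr1 mulrA !(rmorphN, rmorphD, rmorphM) /=.
have -> : ('X - x%:P) * ('X - x^-1%:P) = 'X ^+ 2 - (x%:P + x^-1%:P) * 'X + 1 :> {poly F}.
  by rewrite -xX; ring.
have -> : ('X - y%:P) * ('X - y^-1%:P) = 'X ^+ 2 - (y%:P + y^-1%:P) * 'X + 1 :> {poly F}.
  by rewrite -yX; ring.
by ring.
Qed.

Lemma quart_split (rs : seq F) (x : F) :
  polyQ F (quart A B) %= \prod_(z <- rs) ('X - z%:P) ->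
  root (polyQ F (quart A B)) x ->
  exists y, [/\ y != 0, x + x^-1 + (y + y^-1) = - A%:~R
              & (x + x^-1) * (y + y^-1) = B%:~R - 2].
Proof.
move=> frs rx; pose v := - A%:~R - (x + x^-1).
have uv : x + x^-1 + v = - A%:~R by rewrite /v; ring.
have [uMv fE] := quart_factor rx uv.
pose q : {poly F} := 'X^2 - v *: 'X + 1.
have sq : size q = 3%N := size_quadratic v.
have : q %| \prod_(z <- rs) ('X - z%:P).
  by rewrite -(eqp_dvdr _ frs) fE dvdp_mull.
case/dvdp_prod_XsubC => m; case: (mask m rs) => [|y s qE].
  by rewrite big_nil => /eqp_size; rewrite sq size_poly1.
have : root q y by rewrite (eqp_root qE) root_prod_XsubC mem_head.
rewrite rootE /q !hornerE => /eqP h.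
have y0 : y != 0.
  by apply/eqP => y00; move/eqP: h; rewrite y00 expr0n mulr0 subr0 add0r oner_eq0.
have yE : y + y^-1 = v.
  apply: (mulfI y0); apply/eqP; rewrite -subr_eq0 -[X in _ == X]h; apply/eqP.
  by rewrite mulrDr divff //; ring.
by exists y; rewrite yE.
Qed.

End QuartRoots.

Lemma quart_algC_roots A B : exists x y : algC,
  [/\ x != 0, y != 0, x + x^-1 + (y + y^-1) = - A%:~R
    & (x + x^-1) * (y + y^-1) = B%:~R - 2].
Proof.
have mf := polyQ_monic algC (quart_monic A B).
have [rs fE] := closed_field_poly_normal (polyQ algC (quart A B)).
rewrite (monicP mf) scale1r in fE.
have [x rx] : exists x, root (polyQ algC (quart A B)) x.
  by apply/closed_rootP; rewrite (size_polyQ _ (quart_monic _ _)) size_quart.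
have [|y [y0 h1 h2]] := quart_split (rs := rs) _ rx; first by rewrite -fE eqpxx.
by exists x, y; split=> //; apply: quart_root_neq0 rx.
Qed.

Lemma quart_root_Aint A B (x : algC) : root (polyQ algC (quart A B)) x -> x \in Aint.
Proof.
move=> rx; apply: (root_monic_Aint rx); first exact: polyQ_monic (quart_monic A B).
by apply/polyOverP => i; rewrite coef_map rpred_int.
Qed.

Lemma Crat_sqr_int (r : algC) (n : int) :
  r \in Crat -> r ^+ 2 = n%:~R -> is_square n.
Proof.
move=> rQ rn; have : r \in Num.int.
  by apply: Cint_rat_Aint => //; apply: Aint_sqr; rewrite rn Aint_int.
case/intrP => k rk; exists k; apply/eqP; rewrite -(eqr_int algC) rmorphXn /= -rk.
by rewrite -rn.
Qed.

(** A rational factor is the product over a subset of the roots x, 1/x, y, 1/y, whose sum and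
    product are then rational. A rational root, or rational x + 1/x, would make W3 a square; three
    roots leave a rational fourth one. For a mixed pair the product is a rational integral unit,
    hence 1 or -1: it gives u = v and W3 = 0, or u = - v and A = 0. *)
Lemma irreducible_quart A B :
  A != 0 -> ~ is_square (W3 A B) -> irreducible_poly (polyQ rat (quart A B)).
Proof.
move=> A0 nsq.
have [x [y [x0 y0 uDv uMv]]] := quart_algC_roots A B.
have fE := quart_prod x0 y0 uDv uMv.
have W3E := sqr_uBv uDv uMv.
have rI z : z \in [:: x; x^-1; y; y^-1] -> z \in Aint.
  by move=> zs; apply: (quart_root_Aint (A := A) (B := B)); rewrite fE root_prod_XsubC.
have [xI xVI yI yVI] : [/\ x \in Aint, x^-1 \in Aint, y \in Aint & y^-1 \in Aint].
  by split; apply: rI; rewrite !inE eqxx ?orbT.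
have nu : x + x^-1 \notin Crat.
  apply/negP => uQ; apply: nsq; apply: (@Crat_sqr_int (x + x^-1 - (y + y^-1))) => //.
  have -> : y + y^-1 = - A%:~R - (x + x^-1) by rewrite -uDv; ring.
  by rewrite rpredB // rpredB // rpredN rpred_int.
have nv : y + y^-1 \notin Crat.
  apply: contra nu => vQ.
  have -> : x + x^-1 = - A%:~R - (y + y^-1) by rewrite -uDv; ring.
  by rewrite rpredB // rpredN rpred_int.
have nx : x \notin Crat by apply: contra nu => xQ; rewrite rpredD // rpredV.
have nxV : x^-1 \notin Crat by rewrite rpredV.
have ny : y \notin Crat by apply: contra nv => xQ; rewrite rpredD // rpredV.
have nyV : y^-1 \notin Crat by rewrite rpredV.
have pair (a b : algC) : a != 0 -> b != 0 -> a + a^-1 = x + x^-1 -> b + b^-1 = y + y^-1 ->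
    a * b \in Aint -> (a * b)^-1 \in Aint -> a + b \in Crat -> a * b \in Crat -> False.
  move=> a0 b0 ua vb Iab IabV sQ qQ.
  have /intrP[m mE] : a * b \in Num.int by apply: Cint_rat_Aint.
  have /intrP[n nE] : (a * b)^-1 \in Num.int by apply: Cint_rat_Aint; rewrite // rpredV.
  have mn : m * n = 1.
    by apply/eqP; rewrite -(eqr_int algC) rmorphM /= -mE -nE divff ?mulf_neq0.
  have [m1|m1] : m = 1 \/ m = -1.
    by have /eqP := congr1 absz mn; rewrite abszM muln_eq1 => /andP[/eqP m1 _]; move: m1; clear; lia.
    have bE : b = a^-1 by apply: (mulfI a0); rewrite mE m1 divff.
    apply: nsq; exists 0; apply/eqP; rewrite -(eqr_int algC) -W3E -ua -vb bE invrK.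
    by rewrite [a^-1 + a]addrC subrr expr0n.
  have bE : b = - a^-1 by apply: (mulfI a0); rewrite mE m1 mulrN divff.
  move: uDv; rewrite -ua -vb bE invrN invrK => h.
  have : A%:~R = 0 :> algC by rewrite -[A%:~R]opprK -h; ring.
  by move/eqP; rewrite intr_eq0 (negPf A0).
have pairs : forall a b, a \in [:: x; x^-1] -> b \in [:: y; y^-1] ->
    a + b \in Crat -> a * b \in Crat -> False.
  move=> a b aI bI; apply: pair.
  - by move: aI; rewrite !inE => /pred2P[] ->; rewrite ?invr_eq0.
  - by move: bI; rewrite !inE => /pred2P[] ->; rewrite ?invr_eq0.
  - by move: aI; rewrite !inE => /pred2P[] ->; rewrite // invrK addrC.
  - by move: bI; rewrite !inE => /pred2P[] ->; rewrite // invrK addrC.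
  - by move: aI bI; rewrite !inE => /pred2P[] -> /pred2P[] ->; apply: rpredM.
  - by move: aI bI; rewrite !inE => /pred2P[] -> /pred2P[] ->; rewrite invfM ?invrK; apply: rpredM.
split=> [|p sp pf]; first by rewrite (size_polyQ _ (quart_monic _ _)) size_quart.
have pfC : map_poly (ratr : rat -> algC) p %| \prod_(z <- [:: x; x^-1; y; y^-1]) ('X - z%:P).
  by rewrite -fE -(map_polyQ (ratr : {rmorphism rat -> algC})) dvdp_map.
have [m pm] := dvdp_prod_XsubC pfC.
set s := mask m _ in pm.
have p0 : p != 0 by apply: contraTneq pf => ->; rewrite dvd0p monic_neq0 // polyQ_monic // quart_monic.
have pE : map_poly (ratr : rat -> algC) p = ratr (lead_coef p) *: \prod_(z <- s) ('X - z%:P).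
  move/eqpP: pm => [[c d] /= /andP[c0 d0] cd].
  have mP : \prod_(z <- s) ('X - z%:P) \is monic by apply: monic_prod_XsubC.
  have : c * ratr (lead_coef p) = d.
    by have := congr1 (fun q => lead_coef q) cd; rewrite !lead_coefZ lead_coef_map (monicP mP) mulr1.
  move=> dE; apply: (scalerI c0); rewrite cd scalerA dE //.
have Qs : \prod_(z <- s) ('X - z%:P) \is a polyOver Crat.
  have l0 : ratr (lead_coef p) != 0 :> algC by rewrite fmorph_eq0 lead_coef_eq0.
  have -> : \prod_(z <- s) ('X - z%:P) = (ratr (lead_coef p))^-1 *: map_poly (ratr : rat -> algC) p.
    by rewrite pE scalerA mulVf // scale1r.
  apply/polyOverP => i; rewrite coefZ coef_map rpredM //= ?rpredV; exact: Crat_rat.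
have ss : size p = (size s).+1 by rewrite -(size_map_poly (ratr : {rmorphism rat -> algC}) p) pE size_scale ?fmorph_eq0 ?lead_coef_eq0 // size_prod_XsubC.
suff s4 : size s = 4%N.
  by rewrite -dvdp_size_eqp // ss s4 (size_polyQ _ (quart_monic _ _)) size_quart.
have sumQ : (0 < size s)%N -> \sum_(z <- s) z \in Crat.
  by move=> s0; rewrite -rpredN -coefPn_prod_XsubC -?lt0n //; apply: (polyOverP Qs).
have prdQ : \prod_(z <- s) z \in Crat.
  have := polyOverP Qs 0%N; rewrite coef0_prod_XsubC.
  by rewrite -signr_odd; case: odd; rewrite ?mulN1r ?rpredN ?mul1r.
have s0 : (0 < size s)%N by move: sp; rewrite ss; case: size.
move/(_ s0): sumQ; clear pE Qs pm pfC; move: prdQ ss s0; rewrite {}/s.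
have tr a b c d : a + b + (c + d) = - A%:~R :> algC -> d \notin Crat ->
    a + (b + c) \in Crat -> False.
  move=> h /negP dQ h2; apply: dQ.
  have -> : d = - A%:~R - (a + (b + c)) by rewrite -h; ring.
  by rewrite rpredB // rpredN rpred_int.
have mem1 (a b : algC) : a \in [:: a; b] by rewrite mem_head.
have mem2 (a b : algC) : b \in [:: a; b] by rewrite !inE eqxx orbT.
have uDv1 : x + x^-1 + (y^-1 + y) = - A%:~R by rewrite -uDv; ring.
have uDv2 : x + y + (y^-1 + x^-1) = - A%:~R by rewrite -uDv; ring.
have uDv3 : x^-1 + y + (y^-1 + x) = - A%:~R by rewrite -uDv; ring.
(* Each mask names the roots of one candidate factor. The alternatives below treat single roots and
   the pairs {x, 1/x}, {y, 1/y}, then the mixed pairs, then three roots through the missing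
   fourth. *)
case: m => [|[] [|[] [|[] [|[] m]]]] //=; rewrite ?mask0 //= => pQ _ _ sQ; exfalso;
  move: pQ sQ; rewrite unlock /= ?mulr1 ?addr0 => pQ sQ;
  first [ by move: sQ; apply/negP
        | exact: (pairs _ _ _ _ sQ pQ)
        | exact: (tr _ _ _ _ uDv nyV sQ)
        | exact: (tr _ _ _ _ uDv1 ny sQ)
        | exact: (tr _ _ _ _ uDv2 nxV sQ)
        | exact: (tr _ _ _ _ uDv3 nx sQ) ].
Qed.

(** * Monogenicity *)

Lemma W3_neq0 A B : ~ is_square (W3 A B) -> W3 A B != 0.
Proof. by move=> nsq; apply/eqP => h; apply: nsq; exists 0; rewrite h expr0n. Qed.

(** Reduction by theta^2 = u theta - 1 turns the element into a(u) + b(u) theta with a = (c0 - c2) -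
    c3 u and b = (c1 + c3 (1 - B)) + (c2 - A c3) u. This change of coefficients is unimodular, so a
    and b in Z[u] force integral c0, ..., c3; W3 nonzero separates u from v and makes the
    coefficients unique. *)
Lemma quart_Aint_coefs A B (x y c0 c1 c2 c3 : algC) :
  x != 0 -> y != 0 -> x + x^-1 + (y + y^-1) = - A%:~R ->
  (x + x^-1) * (y + y^-1) = B%:~R - 2 ->
  W3 A B != 0 -> squarefree (W1 A B) -> squarefree (W2 A B) -> max_quad_order A B ->
  [/\ c0 \in Crat, c1 \in Crat, c2 \in Crat & c3 \in Crat] ->
  (forall z, root (polyQ algC (quart A B)) z ->
     c0 + c1 * z + c2 * z ^+ 2 + c3 * z ^+ 3 \in Aint) ->
  [/\ c0 \in Num.int, c1 \in Num.int, c2 \in Num.int & c3 \in Num.int].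
Proof.
move=> x0 y0 uDv uMv W30 sq1 sq2 mx [Q0 Q1 Q2 Q3] I.
have fE := quart_prod x0 y0 uDv uMv.
have rt z : z \in [:: x; x^-1; y; y^-1] -> root (polyQ algC (quart A B)) z.
  by move=> zs; rewrite fE root_prod_XsubC.
have [rx rxV ry ryV] : [/\ root (polyQ algC (quart A B)) x, root (polyQ algC (quart A B)) x^-1,
   root (polyQ algC (quart A B)) y & root (polyQ algC (quart A B)) y^-1].
  by split; apply: rt; rewrite !inE eqxx ?orbT.
have su := sqr_u uDv uMv; have sv := sqr_v uDv uMv.
have uv0 : x + x^-1 - (y + y^-1) != 0.
  by rewrite -sqrf_eq0 (sqr_uBv uDv uMv) intr_eq0.
move: uDv uMv su sv uv0.
set u := x + x^-1; set v := y + y^-1 => uDv uMv su sv uv0.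
pose a w := (c0 - c2) - c3 * w : algC.
pose b w := (c1 + c3 * (1 - B%:~R)) + (c2 - A%:~R * c3) * w : algC.
have key z w : z != 0 -> w = z + z^-1 -> w ^+ 2 = - A%:~R * w - (B%:~R - 2) ->
    c0 + c1 * z + c2 * z ^+ 2 + c3 * z ^+ 3 = a w + b w * z.
  move=> z0 wE w2.
  have z2 : z ^+ 2 = w * z - 1 by rewrite wE; field.
  have z3 : z ^+ 3 = w ^+ 2 * z - z - w by rewrite exprS z2 mulrBr mulrCA -expr2 z2; ring.
  by rewrite z3 z2 w2 /a /b; ring.
have [||||||Za Zb] := @relative_basis_int A B x y x0 y0 (quart_root_Aint rx) (quart_root_Aint rxV)
  (quart_root_Aint ry) (quart_root_Aint ryV) uDv uMv sq1 sq2 mx (a u) (a v) (b u) (b v).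
- by exists (c0 - c2), (- c3); rewrite rpredB ?rpredN //; split=> //; rewrite /a -?/u -?/v; ring.
- exists (c1 + c3 * (1 - B%:~R)), (c2 - A%:~R * c3); split=> //.
    by rewrite rpredD // rpredM // rpredB ?rpred1 ?rpred_int.
  by rewrite rpredB // rpredM // rpred_int.
- by rewrite -key //; apply: I.
- by rewrite -key ?invr_eq0 ?invrK //; [apply: I | rewrite addrC].
- by rewrite -key //; apply: I.
- by rewrite -key ?invr_eq0 ?invrK //; [apply: I | rewrite addrC].
have uniq_coefs r0 r1 s0 s1 : r0 + r1 * u = s0 + s1 * u -> r0 + r1 * v = s0 + s1 * v ->
    r0 = s0 /\ r1 = s1.
  move=> h1 h2; have e1 : r1 = s1.
    apply: (mulIf uv0).
    have -> : r1 * (u - v) = (r0 + r1 * u) - (r0 + r1 * v) by ring.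
    by rewrite h1 h2; ring.
  by split=> //; move: h1; rewrite e1 => /addIr.
have {Za} [Zc02 Zc3] : c0 - c2 \in Num.int /\ c3 \in Num.int.
  have [n0 [n1 [Z0 Z1 hu hv]]] := Za.
  have [||-> /(congr1 -%R)] := @uniq_coefs (c0 - c2) (- c3) n0 n1.
  - by rewrite -hu /a; ring.
  - by rewrite -hv /a; ring.
  by rewrite opprK => ->; rewrite rpredN.
have {Zb} [Zc1 Zc2] : c1 + c3 * (1 - B%:~R) \in Num.int /\ c2 - A%:~R * c3 \in Num.int.
  have [n0 [n1 [Z0 Z1 hu hv]]] := Zb.
  by have [||-> ->] := @uniq_coefs (c1 + c3 * (1 - B%:~R)) (c2 - A%:~R * c3) n0 n1.
have Z2 : c2 \in Num.int.
  by rewrite -[c2](subrK (A%:~R * c3)) rpredD // rpredM // rpred_int.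
split=> //; first by rewrite -[c0](subrK c2) rpredD.
by rewrite -[c1](addrK (c3 * (1 - B%:~R))) rpredB // rpredM // rpredB ?rpred1 ?rpred_int.
Qed.

Section FieldExtension.

Variable L : fieldExtType rat.

Lemma map_in_alg_polyQ f : map_poly (in_alg L) (polyQ rat f) = polyQ L f.
Proof. exact: (map_polyQ (in_alg L)). Qed.

Lemma irreducible_dvd_root (f : {poly int}) (q : {poly rat}) (th : L) :
  irreducible_poly (polyQ rat f) -> root (polyQ L f) th ->
  root (map_poly (in_alg L) q) th -> polyQ rat f %| q.
Proof.
move=> irr rf rq; case: (boolP (polyQ rat f %| q)) => // nd.
move: nd; rewrite -(irreducible_poly_coprime q irr) -(coprimep_map (in_alg L)) map_in_alg_polyQ.
by move/coprimep_root => /(_ th rf); rewrite -rootE rq.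
Qed.

(** The bridge from an abstract extension to [algC]: q vanishes at one root of the irreducible f,
    hence is a multiple of f. *)
Lemma irreducible_root_transfer (f : {poly int}) (q : {poly rat}) (th : L) (x : algC) :
  irreducible_poly (polyQ rat f) -> root (polyQ L f) th ->
  root (map_poly (in_alg L) q) th -> root (polyQ algC f) x ->
  root (map_poly ratr q) x.
Proof.
move=> irr rf rq rx; have := irreducible_dvd_root irr rf rq.
rewrite -(dvdp_map (ratr : {rmorphism rat -> algC})) (map_polyQ (ratr : {rmorphism rat -> algC})) => h.
exact: (root_dvdp h).
Qed.

Lemma horner_map_quartic (g : {poly rat}) (F : comNzRingType) (h : {rmorphism rat -> F}) (z : F) :
  (size g <= 4)%N ->
  (map_poly h g).[z] = h g`_0 + h g`_1 * z + h g`_2 * z ^+ 2 + h g`_3 * z ^+ 3.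
Proof.
move=> sg; rewrite (@horner_coef_wide _ 4); last by rewrite size_map_poly.
by rewrite !big_ord_recr big_ord0 /= !coef_map /= add0r expr0 mulr1 expr1.
Qed.

Lemma integral_quadratic (x m y : L) : integralOver (intr : int -> L) m ->
  integralOver (intr : int -> L) y -> x ^+ 2 = m * x + y ->
  integralOver (intr : int -> L) x.
Proof.
move=> Im Iy xy; apply: (@integral_root_monic _ _ intr x ('X^2 - (m%:P * 'X + y%:P))).
- rewrite monicE lead_coefDl ?lead_coefXn // size_polyN size_polyXn size_MXaddC.
  by case: ifP => // _; rewrite ltnS size_polyC; case: (m == 0).
- by rewrite rootE !hornerE xy subrr.
apply/integral_poly => i; rewrite coefB coefXn coefD coefCM coefX coefC.
apply: integral_sub; first exact: integral_nat.
apply: integral_add; first by apply: integral_mul => //; exact: integral_nat.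
by case: ifP => // _; apply: integral0.
Qed.

Lemma integral_of_int (n : int) : integralOver (intr : int -> L) n%:~R.
Proof. exact: integral_id. Qed.

Lemma Zbasis_dvd (th x : L) (N : int) (d : 'I_4 -> int) :
  Zbasis (fun i : 'I_4 => th ^+ i) (ring_of_integers th) ->
  x \in <<1; th>>%VS -> integralOver (intr : int -> L) x ->
  x *~ N = \sum_(i < 4) th ^+ i *~ d i -> forall i, (N %| d i)%Z.
Proof.
move=> [_ indep gen] xK Ix xN i.
have [c xc] := gen x (conj xK Ix).
apply/dvdzP; exists (c i); apply/eqP; rewrite eq_sym -subr_eq0; apply/eqP.
apply: (indep (fun j => c j * N - d j)) => {i}.
under eq_bigr => j _ do rewrite mulrzBr.
rewrite sumrB -xN xc mulrz_suml; apply/eqP; rewrite subr_eq0; apply/eqP.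
by apply: eq_bigr => j _; rewrite mulrzA.
Qed.

End FieldExtension.

Lemma integral_expr (L : fieldExtType rat) (x : L) n :
  integralOver (intr : int -> L) x -> integralOver (intr : int -> L) (x ^+ n).
Proof.
move=> Ix; elim: n => [|n IH]; first by rewrite expr0; apply: integral1.
by rewrite exprS; apply: integral_mul.
Qed.

Lemma quart_powers_free (L : fieldExtType rat) (th : L) A B (c : 'I_4 -> int) :
  irreducible_poly (polyQ rat (quart A B)) -> root (polyQ L (quart A B)) th ->
  \sum_(i < 4) th ^+ i *~ c i = 0 -> forall i, c i = 0.
Proof.
move=> irr rth c0; pose g : {poly rat} := \poly_(i < 4) (c (inord i))%:~R.
have sg : (size g <= 4)%N by apply: size_poly.
have rg : root (map_poly (in_alg L) g) th.
  rewrite rootE (@horner_coef_wide _ 4%N) ?size_map_poly //; apply/eqP.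
  rewrite -[RHS]c0; apply: eq_bigr => i _.
  by rewrite coef_map coef_poly ltn_ord inord_val -[X in X * _]/(in_alg L (c i)%:~R) rmorph_int mulrzl.
have := irreducible_dvd_root irr rth rg => /dvdp_leq.
case: (eqVneq g 0) => [g0 _ i|_ /(_ isT)]; last first.
  by rewrite (size_polyQ _ (quart_monic _ _)) size_quart => /leq_trans /(_ sg).
have := congr1 (fun q : {poly rat} => q`_i) g0.
by rewrite coef0 coef_poly ltn_ord inord_val => /eqP; rewrite intr_eq0 => /eqP.
Qed.

Lemma mem_adjoin_horner (L : fieldExtType rat) (th x : L) (f : {poly int}) :
  f \is monic -> (1 < size f)%N -> root (polyQ L f) th -> x \in <<1; th>>%VS ->
  exists2 g : {poly rat}, (size g < size f)%N & x = (map_poly (in_alg L) g).[th].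
Proof.
move=> mf sf rth /Fadjoin_polyP[p /polyOver1P[q ->] ->].
exists (q %% polyQ rat f).
  by rewrite -(size_polyQ rat mf) ltn_modp -size_poly_gt0 size_polyQ // ltnW.
rewrite {1}(divp_eq q (polyQ rat f)) rmorphD rmorphM /= map_in_alg_polyQ.
by rewrite hornerD hornerM (rootP rth) mulr0 add0r.
Qed.

Lemma monogenic_sufficient A B : A != 0 -> ~ is_square (W3 A B) ->
  squarefree (W1 A B) -> squarefree (W2 A B) -> max_quad_order A B ->
  monogenic (quart A B).
Proof.
move=> A0 nsq sq1 sq2 mx; have irr := irreducible_quart A0 nsq.
split=> // L th rth.
have Ith : integralOver (intr : int -> L) th by exists (quart A B) => //; exact: quart_monic.
split=> [i|c c0|x [xK Ix]].
- by split; [rewrite rpredX // memv_adjoin | apply: integral_expr].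
- exact: (quart_powers_free irr rth c0).
have [|g sg xg] := mem_adjoin_horner (quart_monic A B) _ rth xK; first by rewrite size_quart.
rewrite size_quart ltnS in sg.
have [P mP rP] := Ix.
have [y [z [y0 z0 uDv uMv]]] := quart_algC_roots A B.
have QC (q : rat) : (ratr q : algC) \in Crat by apply: Crat_rat.
(* All complex conjugates of x = g(theta) are integral: the monic integral P killing x gives P(g)
   zero at theta, hence at every root w. *)
have I w : root (polyQ algC (quart A B)) w ->
    ratr g`_0 + ratr g`_1 * w + ratr g`_2 * w ^+ 2 + ratr g`_3 * w ^+ 3 \in Aint.
  move=> rw.
  have rc : root (map_poly (in_alg L) (polyQ rat P \Po g)) th.
    by rewrite map_comp_poly map_in_alg_polyQ rootE horner_comp -xg.
  have := irreducible_root_transfer irr rth rc rw.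
  rewrite map_comp_poly (map_polyQ (ratr : {rmorphism rat -> algC})) rootE horner_comp.
  rewrite (horner_map_quartic (ratr : {rmorphism rat -> algC}) _ sg) => rt.
  apply: (root_monic_Aint rt); first exact: polyQ_monic.
  by apply/polyOverP => i; rewrite coef_map rpred_int.
have [] := quart_Aint_coefs y0 z0 uDv uMv (W3_neq0 nsq) sq1 sq2 mx _ I; first by split.
have Zq (q : rat) : (ratr q : algC) \in Num.int -> exists n : int, q = n%:~R.
  by case/intrP => n qn; exists n; apply: (fmorph_inj (ratr : {rmorphism rat -> algC})); rewrite /= qn ratr_int.
move=> /Zq[n0 g0] /Zq[n1 g1] /Zq[n2 g2] /Zq[n3 g3].
exists (fun i : 'I_4 => [:: n0; n1; n2; n3]`_i).
rewrite xg (horner_map_quartic (in_alg L)) // g0 g1 g2 g3 !rmorph_int !big_ord_recr big_ord0 /=.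
by rewrite add0r expr0 expr1 !mulrzl.
Qed.

(** * Integral elements outside Z[theta] *)

Section Necessity.

Variables (A B : int).
Hypothesis mono : monogenic (quart A B).

Lemma monogenic_root : exists (L : fieldExtType rat) (th : L),
  [/\ <<1; th>>%VS = fullv, root (polyQ L (quart A B)) th
    & Zbasis (fun i : 'I_4 => th ^+ i) (ring_of_integers th)].
Proof.
have [irr h] := mono; have [L _ [th rth thL]] := irredp_FAdjoin irr.
rewrite map_in_alg_polyQ in rth.
by exists L, th; split=> //; apply: h.
Qed.

(* The pattern of all the obstructions: if t in Z[theta] is a root of
   X^2 - N m X - N^2 s with s in Z[theta], then t / N is integral, so N divides
   the coordinates of t. *)
Lemma monogenic_quadratic_dvd (N m : int) (d s : seq int) : N != 0 ->
  (forall (L : fieldExtType rat) (th : L), root (polyQ L (quart A B)) th ->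
     (\sum_(i < 4) th ^+ i *~ d`_i) ^+ 2 =
     N%:~R * m%:~R * (\sum_(i < 4) th ^+ i *~ d`_i)
     + N%:~R ^+ 2 * \sum_(i < 4) th ^+ i *~ s`_i) ->
  (N %| d`_3)%Z.
Proof.
move=> N0 h; have [L [th [thL rth Zb]]] := monogenic_root.
have Ith : integralOver (intr : int -> L) th by exists (quart A B) => //; exact: quart_monic.
have NL : N%:~R != 0 :> L.
  by rewrite -(rmorph_int (in_alg L)) fmorph_eq0 intr_eq0.
have Is (t : seq int) : integralOver (intr : int -> L) (\sum_(i < 4) th ^+ i *~ t`_i).
  rewrite !big_ord_recr big_ord0 /= add0r.
  have It n k : integralOver (intr : int -> L) (th ^+ n *~ k).
    by rewrite -mulrzl; apply: integral_mul; [apply: integral_of_int | apply: integral_expr].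
  by do !apply: integral_add.
pose x := (\sum_(i < 4) th ^+ i *~ d`_i) / N%:~R.
have Ix : integralOver (intr : int -> L) x.
  apply: (integral_quadratic (integral_of_int L m) (Is s)).
  by rewrite /x expr_div_n h //; field.
apply: (Zbasis_dvd (d := fun i : 'I_4 => d`_i) Zb _ Ix _ (ord_max : 'I_4)).
  by rewrite thL memvf.
by rewrite -mulrzr /x divfK.
Qed.

End Necessity.

Section Obstructions.
Variables (A B : int).
Hypothesis mono : monogenic (quart A B).

Lemma quart_root_eq0 (L : fieldExtType rat) (th : L) : root (polyQ L (quart A B)) th ->
  th ^+ 4 = - (A%:~R * th ^+ 3 + B%:~R * th ^+ 2 + A%:~R * th + 1).
Proof. by rewrite rootE horner_quart => /eqP h; apply/eqP; rewrite -subr_eq0 opprK !addrA; apply/eqP. Qed.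

Lemma sum_powersE (L : comNzRingType) (th : L) (d : seq int) :
  \sum_(i < 4) th ^+ i *~ d`_i =
  (d`_0)%:~R + (d`_1)%:~R * th + (d`_2)%:~R * th ^+ 2 + (d`_3)%:~R * th ^+ 3.
Proof. by rewrite !big_ord_recr big_ord0 /= add0r expr0 expr1 !mulrzl. Qed.

(* Expanding f at z = theta + 1 gives f = W1 (1 - 2 z) + z^2 (c2 + c3 z + z^2),
   so the obstruction is t = z (c2 + c3 z + z^2). *)
Lemma monogenic_squarefree_W1 : squarefree (W1 A B).
Proof.
apply: contrapT => /not_squarefreeP[p pp /dvdzP[q qE]].
pose c2 := 6 - 3 * A + B; pose c3 := A - 4.
have : (p%:Z %| [:: 1 + c3 + c2; 3 + 2 * c3 + c2; 3 + c3; 1]`_3)%Z.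
  (* At the root z t = W1 (2 z - 1), so t^2 = p^2 s with s = q (2 z - 1) (c2 + c3 z + z^2), whose
     coordinates in powers of theta = z - 1 are listed. *)
  apply: (monogenic_quadratic_dvd mono (m := 0)
    (s := [:: q * (1 + c3 + c2); q * (4 + 3 * c3 + 2 * c2); q * (2 * c3 + 5); q * 2])).
    by case: p pp {qE} => [|p].
  move=> L th rth; have h4 := quart_root_eq0 rth.
  have BE : B = q * p%:Z ^+ 2 - 2 + 2 * A by rewrite -qE /W1; ring.
  rewrite !sum_powersE /= mulr0 mul0r add0r /c2 /c3.
  have {}BE : B%:~R = q%:~R * p%:~R ^+ 2 - 2 + 2 * A%:~R :> L.
    by rewrite BE !(rmorphXn, intrM, intrB, intrD, mulrNz).
  rewrite !(intrD, intrM, intrB, mulrNz) !BE.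
  rewrite BE in h4.
  move: h4; set P := p%:~R; set Q := q%:~R; set a := A%:~R => h4.
  apply/eqP; rewrite -subr_eq0; apply/eqP.
  (* The two sides differ by (c2 + c3 z + z^2) f(theta), which vanishes. *)
  transitivity (((Q * P ^+ 2 + 4 - a) + (a - 4) * (th + 1) + (th + 1) ^+ 2) *
    (th ^+ 4 + (a * th ^+ 3 + (Q * P ^+ 2 - 2 + 2 * a) * th ^+ 2 + a * th + 1))); last first.
    by rewrite h4; ring.
  ring.
by rewrite /= dvdz1 absz_nat => /eqP p1; rewrite p1 in pp.
Qed.

(* Likewise with z = theta - 1. *)
Lemma monogenic_squarefree_W2 : squarefree (W2 A B).
Proof.
apply: contrapT => /not_squarefreeP[p pp /dvdzP[q qE]].
pose c2 := 6 + 3 * A + B; pose c3 := A + 4.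
have : (p%:Z %| [:: -1 + c3 - c2; 3 - 2 * c3 + c2; -3 + c3; 1]`_3)%Z.
  apply: (monogenic_quadratic_dvd mono (m := 0)
    (s := [:: q * (1 - c3 + c2); q * (- 4 + 3 * c3 - 2 * c2); q * (5 - 2 * c3); q * -2])).
    by case: p pp {qE} => [|p].
  move=> L th rth; have h4 := quart_root_eq0 rth.
  have BE : B = q * p%:Z ^+ 2 - 2 - 2 * A by rewrite -qE /W2; ring.
  rewrite !sum_powersE /= mulr0 mul0r add0r /c2 /c3.
  have {}BE : B%:~R = q%:~R * p%:~R ^+ 2 - 2 - 2 * A%:~R :> L.
    by rewrite BE !(rmorphXn, intrM, intrB, intrD, mulrNz).
  rewrite !(intrD, intrM, intrB, mulrNz) !BE.
  rewrite BE in h4.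
  move: h4; set P := p%:~R; set Q := q%:~R; set a := A%:~R => h4.
  apply/eqP; rewrite -subr_eq0; apply/eqP.
  transitivity (((Q * P ^+ 2 + 4 + a) + (a + 4) * (th - 1) + (th - 1) ^+ 2) *
    (th ^+ 4 + (a * th ^+ 3 + (Q * P ^+ 2 - 2 - 2 * a) * th ^+ 2 + a * th + 1))); last first.
    by rewrite h4; ring.
  ring.
by rewrite /= dvdz1 absz_nat => /eqP p1; rewrite p1 in pp.
Qed.

(* Here u = theta + 1 / theta = - theta^3 - A theta^2 + (1 - B) theta - A, and
   (2 u + A)^2 = W3. *)
Lemma monogenic_max_quad_order : max_quad_order A B.
Proof.
rewrite /max_quad_order; case: ifP => A2.
  have [a Ea] : exists a, A = 2 * a by exists (A %/ 2)%Z; lia.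
  have -> : (W3 A B %/ 4)%Z = a ^+ 2 - B + 2.
    by rewrite /W3 Ea; have -> : (2 * a) ^+ 2 - 4 * B + 8 = (a ^+ 2 - B + 2) * 4 by [ring]; rewrite mulzK.
  split.
    apply: contrapT => /not_squarefreeP[p pp /dvdzP[q qE]].
    (* The coordinates of u + a, whose square is D = q p^2. *)
    have : (p%:Z %| [:: - a; 1 - B; - A; -1]`_3)%Z.
      apply: (monogenic_quadratic_dvd mono (m := 0) (s := [:: q; 0; 0; 0])).
        by case: p pp {qE} => [|p].
      move=> L th rth; have h4 := quart_root_eq0 rth.
      have BE : B = a ^+ 2 + 2 - q * p%:Z ^+ 2 by rewrite -qE; ring.
      rewrite !sum_powersE /= mulr0 mul0r add0r.
      have {}BE : B%:~R = a%:~R ^+ 2 + 2 - q%:~R * p%:~R ^+ 2 :> L.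
        by rewrite BE !(rmorphXn, intrM, intrB, intrD, mulrNz).
      rewrite Ea !(intrD, intrM, intrB, mulrNz) !BE.
      rewrite BE Ea !intrM in h4.
      move: h4; set P := p%:~R; set Q := q%:~R; set b := a%:~R => h4.
      apply/eqP; rewrite -subr_eq0; apply/eqP.
      transitivity ((th ^+ 2 + 2 * b * th + b ^+ 2 - Q * P ^+ 2) *
       (th ^+ 4 + (2 * b * th ^+ 3 + (b ^+ 2 + 2 - Q * P ^+ 2) * th ^+ 2 + 2 * b * th + 1))); last first.
        by rewrite h4; ring.
      ring.
    by rewrite /= dvdzE absz_nat abszN => /=; rewrite dvdn1 => /eqP p1; rewrite p1 in pp.
  apply/eqP => D1; have [k kE] : exists k, a ^+ 2 - B + 2 = 4 * k + 1.
    by exists ((a ^+ 2 - B + 2) %/ 4)%Z; rewrite {1}(divz_eq (a ^+ 2 - B + 2) 4) D1 mulrC.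
  (* Here t = 1 + (u + a) satisfies t^2 = 2 t + 4 k, so (1 + sqrt D) / 2 is integral. *)
  suff : (2 %| [:: 1 - a; 1 - B; - A; -1]`_3)%Z by [].
  apply: (monogenic_quadratic_dvd mono (m := 1) (s := [:: k; 0; 0; 0])) => //.
  move=> L th rth; have h4 := quart_root_eq0 rth.
  have BE : B = a ^+ 2 + 2 - (4 * k + 1) by rewrite -kE; ring.
  rewrite !sum_powersE /=.
  have {}BE : B%:~R = a%:~R ^+ 2 + 2 - (4 * k%:~R + 1) :> L.
    by rewrite BE !(rmorphXn, intrM, intrB, intrD, mulrNz).
  rewrite Ea !(intrD, intrM, intrB, mulrNz) !BE.
  rewrite BE Ea !intrM in h4.
  move: h4; set K := k%:~R; set b := a%:~R => h4.
  apply/eqP; rewrite -subr_eq0; apply/eqP.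
  transitivity ((th ^+ 2 + 2 * b * th + b ^+ 2 - 1 - 4 * K) *
   (th ^+ 4 + (2 * b * th ^+ 3 + (b ^+ 2 + 2 - (4 * K + 1)) * th ^+ 2 + 2 * b * th + 1))); last first.
    by rewrite h4; ring.
  ring.
apply: contrapT => /not_squarefreeP[p pp /dvdzP[q qE]].
(* The coordinates of 2 u + A. The last one is -2, so that p = 2 has to be excluded separately: W3
   is odd. *)
have : (p%:Z %| [:: - A; 2 * (1 - B); - 2 * A; -2]`_3)%Z.
  apply: (monogenic_quadratic_dvd mono (m := 0) (s := [:: q; 0; 0; 0])).
    by case: p pp {qE} => [|p].
  move=> L th rth; have h4 := quart_root_eq0 rth.
  rewrite !sum_powersE /= mulr0 mul0r add0r.
  have qL : q%:~R * p%:~R ^+ 2 = A%:~R ^+ 2 - 4 * B%:~R + 8 :> L.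
    have := congr1 (intr : int -> L) qE; rewrite /W3 !(intrD, intrM, intrB, mulrNz, rmorphXn) => ->.
    by ring.
  rewrite !mul0r !addr0 [_ * q%:~R]mulrC qL.
  rewrite !(intrD, intrM, intrB, mulrNz).
  move: h4; set a := A%:~R; set b := B%:~R => h4.
  apply/eqP; rewrite -subr_eq0; apply/eqP.
  transitivity (4 * (th ^+ 2 + a * th + b - 2) *
   (th ^+ 4 + (a * th ^+ 3 + b * th ^+ 2 + a * th + 1))); last first.
    by rewrite h4; ring.
  ring.
rewrite /= dvdzE absz_nat abszN /= => p2.
have {}p2 : p = 2%N by apply/eqP; rewrite -dvdn_prime2.
have [k Ek] : exists k, A = 2 * k + 1 by exists (A %/ 2)%Z; move: A2; clear; lia.
have : (4 %| W3 A B)%Z by rewrite qE p2 dvdz_mull.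
have -> : W3 A B = 4 * (k ^+ 2 + k - B + 2) + 1 by rewrite /W3 Ek; ring.
by rewrite dvdzE; move=> h; move: h; clear; move: (k ^+ 2 + k - B + 2) => z; lia.
Qed.

End Obstructions.

Theorem monogenicP A B : A != 0 -> ~ is_square (W3 A B) ->
  monogenic (quart A B) <->
  [/\ squarefree (W1 A B), squarefree (W2 A B) & max_quad_order A B].
Proof.
move=> A0 nsq; split=> [mono|[h1 h2 h3]]; last exact: monogenic_sufficient.
split; [exact: monogenic_squarefree_W1 | exact: monogenic_squarefree_W2 |].
exact: monogenic_max_quad_order.
Qed.

(** * Discriminants *)

Definition quart_disc (A B : int) : int := W1 A B * W2 A B * W3 A B ^+ 2.

Lemma quart_vieta (F : comNzRingType) A B (a b c d : F) :
  polyQ F (quart A B) = \prod_(z <- [:: a; b; c; d]) ('X - z%:P) ->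
  [/\ a + b + c + d = - A%:~R,
      a * b + a * c + a * d + b * c + b * d + c * d = B%:~R,
      a * b * c + a * b * d + a * c * d + b * c * d = - A%:~R
    & a * b * c * d = 1].
Proof.
have -> : \prod_(z <- [:: a; b; c; d]) ('X - z%:P) =
  'X^4 + (- (a + b + c + d))%:P * 'X^3
  + (a * b + a * c + a * d + b * c + b * d + c * d)%:P * 'X^2
  + (- (a * b * c + a * b * d + a * c * d + b * c * d))%:P * 'X + (a * b * c * d)%:P.
  by rewrite unlock /= mulr1 !(polyCN, polyCD, polyCM); ring.
rewrite polyQ_quart => /polyP h.
have := (h 0%N, h 1%N, h 2%N, h 3%N).
rewrite !(coefD, coefXn, coefCM, coefX, coef1, coefC) /=.
rewrite !(mulr0, mulr1, addr0, add0r) => -[[[h0 h1] h2] h3].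
by split; [rewrite h3 opprK | rewrite h2 | rewrite h1 opprK | rewrite -h0].
Qed.

Lemma quart_vandermonde (A B : int) (a : 'rV[algC]_4) :
  polyQ algC (quart A B) = \prod_(z <- [:: a 0 0; a 0 1; a 0 2%:R; a 0 3%:R]) ('X - z%:P) ->
  (\det (Vandermonde 4 a)) ^+ 2 = (quart_disc A B)%:~R.
Proof.
move=> /quart_vieta; rewrite det_Vandermonde.
have -> : \prod_(i < 4) \prod_(j < 4 | (i < j)%N) (a 0 j - a 0 i) =
  (a 0 1 - a 0 0) * (a 0 2%:R - a 0 0) * (a 0 3%:R - a 0 0) *
  ((a 0 2%:R - a 0 1) * (a 0 3%:R - a 0 1)) * (a 0 3%:R - a 0 2%:R).
  under eq_bigr => i _ do rewrite big_mkcond !big_ord_recl big_ord0 /=.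
  rewrite !big_ord_recl big_ord0 /=.
  rewrite !mul1r !mulr1.
  have e1 : lift ord0 ord0 = 1 :> 'I_4 by apply: val_inj.
  have e2 : lift ord0 (lift ord0 ord0) = 2%:R :> 'I_4 by apply: val_inj.
  have e3 : lift ord0 (lift ord0 (lift ord0 ord0)) = 3%:R :> 'I_4 by apply: val_inj.
  by rewrite e1 e2 e3 !mulrA.
move: (a 0 0) (a 0 1) (a 0 2%:R) (a 0 3%:R) => x y z t [h1 h2 h3 h4].
pose b := - (x + y + z + t); pose c := x * y + x * z + x * t + y * z + y * t + z * t.
pose d := - (x * y * z + x * y * t + x * z * t + y * z * t); pose e := x * y * z * t.
(* The discriminant of the general quartic X^4 + b X^3 + c X^2 + d X + e. *)
have -> : ((y - x) * (z - x) * (t - x) * ((z - y) * (t - y)) * (t - z)) ^+ 2 =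
  256 * e ^+ 3 - 192 * b * d * e ^+ 2 - 128 * c ^+ 2 * e ^+ 2 + 144 * c * d ^+ 2 * e
  - 27 * d ^+ 4 + 144 * b ^+ 2 * c * e ^+ 2 - 6 * b ^+ 2 * d ^+ 2 * e
  - 80 * b * c ^+ 2 * d * e + 18 * b * c * d ^+ 3 + 16 * c ^+ 4 * e
  - 4 * c ^+ 3 * d ^+ 2 - 27 * b ^+ 4 * e ^+ 2 + 18 * b ^+ 3 * c * d * e
  - 4 * b ^+ 3 * d ^+ 3 - 4 * b ^+ 2 * c ^+ 3 * e + b ^+ 2 * c ^+ 2 * d ^+ 2.
  by rewrite /b /c /d /e; ring.
rewrite /b /c /d /e h1 h2 h3 h4 /quart_disc /W1 /W2 /W3.
rewrite !(rmorphXn, intrM, intrB, intrD, mulrNz) /=.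
by ring.
Qed.

Lemma quart_disc_neq0 A B : monogenic (quart A B) -> quart_disc A B != 0.
Proof.
move=> mono; rewrite /quart_disc (mulf_neq0 (mulf_neq0 _ _)) ?expf_neq0 //.
- exact/squarefree_neq0/(monogenic_squarefree_W1 mono).
- exact/squarefree_neq0/(monogenic_squarefree_W2 mono).
have := monogenic_max_quad_order mono; rewrite /max_quad_order; case: ifP => _ h.
  by apply: contraTneq (squarefree_neq0 h.1) => ->; rewrite div0z eqxx.
exact: squarefree_neq0.
Qed.

Lemma Zbasis_change (L : fieldExtType rat) (t1 t2 : L) (n : nat) :
  Zbasis (fun i : 'I_n => t1 ^+ i) (ring_of_integers t1) ->
  (forall i : 'I_n, ring_of_integers t1 (t2 ^+ i)) ->
  exists P : 'M[int]_n, forall i : 'I_n, t2 ^+ i = \sum_(j < n) t1 ^+ j *~ P i j.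
Proof.
move=> [_ _ gen] h.
have [c hc] : exists c : 'I_n -> 'I_n -> int, forall i : 'I_n, t2 ^+ i = \sum_(j < n) t1 ^+ j *~ c i j.
  by apply: (fin_all_exists (P := fun (i : 'I_n) c => t2 ^+ i = \sum_(j < n) t1 ^+ j *~ c j)) => i; apply: gen.
by exists (\matrix_(i, j) c i j) => i; rewrite hc; apply: eq_bigr => j _; rewrite mxE.
Qed.

(** Two power bases of the same ring of integers differ by an integral matrix P of determinant 1 or
    -1. Writing t2 as the polynomial [h 1] in t1 and evaluating it at the complex roots a_k of the
    first quartic gives roots b_k of the second whose powers are also transformed by P. Hence the
    two Vandermonde determinants have the same square. *)
Lemma equivalent_disc (A B A' B' : int) :
  monogenic (quart A B) -> monogenic (quart A' B') ->
  equivalent (quart A B) (quart A' B') -> quart_disc A B = quart_disc A' B'.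
Proof.
move=> m1 m2 [L [t1 [t2 [r1 r2 t12]]]].
have Z1 := m1.2 L t1 r1; have Z2 := m2.2 L t2 r2.
have O12 z : ring_of_integers t1 z <-> ring_of_integers t2 z by rewrite /ring_of_integers /= t12.
have [P hP] : exists P : 'M[int]_4, forall i : 'I_4, t2 ^+ i = \sum_(j < 4) t1 ^+ j *~ P i j.
  by apply: Zbasis_change => // i; apply/O12; have [h _ _] := Z2; exact: h.
have [Q hQ] : exists Q : 'M[int]_4, forall i : 'I_4, t1 ^+ i = \sum_(j < 4) t2 ^+ j *~ Q i j.
  by apply: Zbasis_change => // i; apply/O12; have [h _ _] := Z1; exact: h.
have QP : Q *m P = 1%:M.
  apply/matrixP => i k; apply/eqP; rewrite -subr_eq0; apply/eqP.
  have [_ indep _] := Z1.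
  apply: (indep (fun k => (Q *m P) i k - 1%:M i k)).
  under eq_bigr => j _ do rewrite mulrzBr.
  rewrite sumrB; apply/eqP; rewrite subr_eq0; apply/eqP; symmetry.
  rewrite (bigD1 i) //= mxE eqxx mulr1z big1 ?addr0; last first.
    by move=> j ji; rewrite mxE eq_sym (negPf ji) mulr0z.
  transitivity (\sum_(j < 4) \sum_(k < 4) t1 ^+ k *~ P j k *~ Q i j).
    by rewrite [LHS]hQ; apply: eq_bigr => j _; rewrite hP mulrz_suml.
  rewrite exchange_big /=; apply: eq_bigr => j _.
  rewrite mxE mulrz_sumr; apply: eq_bigr => l _.
  by rewrite -mulrzA mulrC.
have dP : (\det P) ^+ 2 = 1.
  have /(congr1 absz) : \det Q * \det P = 1 by rewrite -det_mulmx QP det1.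
  by rewrite abszM => /eqP; rewrite muln_eq1 => /andP[_ /eqP]; move: (\det P); clear => d d1; have [->|->] : d = 1 \/ d = -1 by lia.
have [x [y [x0 y0 uDv uMv]]] := quart_algC_roots A B.
have fE := quart_prod x0 y0 uDv uMv.
pose a : 'rV[algC]_4 := \row_(k < 4) [:: x; x^-1; y; y^-1]`_k.
have ra k : root (polyQ algC (quart A B)) (a 0 k).
  by rewrite fE root_prod_XsubC mxE mem_nth.
have Va : (\det (Vandermonde 4 a)) ^+ 2 = (quart_disc A B)%:~R.
  by apply: quart_vandermonde; rewrite fE !mxE.
pose h i : {poly rat} := \poly_(j < 4) (P i (inord j))%:~R.
have hE (R : comNzRingType) (f : {rmorphism rat -> R}) i (z : R) :
    (map_poly f (h i)).[z] = \sum_(j < 4) z ^+ j *~ P i j.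
  rewrite (@horner_coef_wide _ 4%N) ?size_map_poly ?size_poly //.
  apply: eq_bigr => j _.
  by rewrite coef_map coef_poly ltn_ord inord_val -[X in X * _]/(f (P i j)%:~R) rmorph_int mulrzl.
pose b : 'rV[algC]_4 := \row_k (map_poly ratr (h 1)).[a 0 k].
have bE (i k : 'I_4) : b 0 k ^+ i = \sum_(j < 4) a 0 k ^+ j *~ P i j.
  have rt : root (map_poly (in_alg L) (h 1 ^+ i - h i)) t1.
    by rewrite rootE rmorphB rmorphXn /= !hornerE ?horner_exp !hE -!hP expr1 subrr.
  have := irreducible_root_transfer m1.1 r1 rt (ra k).
  rewrite rootE rmorphB rmorphXn /= !hornerE ?horner_exp subr_eq0 => /eqP e.
  by rewrite mxE e (hE _ (ratr : {rmorphism rat -> algC})).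
have rb k : root (polyQ algC (quart A' B')) (b 0 k).
  have rt : root (map_poly (in_alg L) (polyQ rat (quart A' B') \Po h 1)) t1.
    by rewrite map_comp_poly map_in_alg_polyQ rootE horner_comp hE -hP expr1; exact: r2.
  have := irreducible_root_transfer m1.1 r1 rt (ra k).
  by rewrite map_comp_poly (map_polyQ (ratr : {rmorphism rat -> algC})) [b 0 k]mxE !rootE horner_comp.
have VbE : Vandermonde 4 b = map_mx (intr : int -> algC) P *m Vandermonde 4 a.
  apply/matrixP => i k; rewrite [LHS]mxE bE [RHS]mxE; apply: eq_bigr => j _.
  by rewrite [map_mx _ _ _ _]mxE [Vandermonde _ _ _ _]mxE mulrzl.
have Vb : (\det (Vandermonde 4 b)) ^+ 2 = (quart_disc A B)%:~R.
  by rewrite VbE det_mulmx exprMn det_map_mx /= -rmorphXn dP mul1r.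
have dV0 : \det (Vandermonde 4 b) != 0.
  by rewrite -sqrf_eq0 Vb intr_eq0 quart_disc_neq0.
(* The b_k might repeat; the nonzero Vandermonde determinant shows that they are all four roots. *)
have ub : injective (fun k => b 0 k).
  move=> i j bij; apply/eqP; apply: contraTT dV0 => ij; rewrite negbK; apply/eqP.
  rewrite -det_tr; apply: (determinant_alternate ij) => k.
  by rewrite !mxE in bij *; rewrite bij.
have fE' : polyQ algC (quart A' B') = \prod_(z <- [:: b 0 0; b 0 1; b 0 2%:R; b 0 3%:R]) ('X - z%:P).
  rewrite -[RHS]scale1r -(monicP (polyQ_monic algC (quart_monic A' B'))).
  apply: all_roots_prod_XsubC.
  - by rewrite (size_polyQ _ (quart_monic _ _)) size_quart.
  - by rewrite /= !rb.
  by rewrite uniq_rootsE (map_inj_uniq ub [:: 0; 1; 2%:R; 3%:R]).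
have := quart_vandermonde fE'; rewrite Vb => /eqP; rewrite eqr_int => /eqP.
by [].
Qed.

(** * Galois groups *)

Lemma addV_inj (F : fieldType) (z w : F) : z != 0 -> w != 0 ->
  z + z^-1 = w + w^-1 -> z = w \/ z = w^-1.
Proof.
move=> z0 w0 h; have : (z - w) * (z - w^-1) = 0.
  have -> : (z - w) * (z - w^-1) = z * ((z + z^-1) - (w + w^-1)) by field; rewrite ?z0 ?w0.
  by rewrite h subrr mulr0.
by move/eqP; rewrite mulf_eq0 !subr_eq0 => /orP[] /eqP; [left | right].
Qed.

Lemma card_uniq_mem (T : finType) (A : {pred T}) (s : seq T) :
  uniq s -> A =i s -> #|A| = size s.
Proof. by move=> us As; rewrite (eq_card As) (card_uniqP us). Qed.

Section QuartGalois.

Variables (L : splittingFieldType rat) (A B : int) (th ph : L).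
Hypothesis irr : irreducible_poly (polyQ rat (quart A B)).
Hypothesis split_f : splittingFieldFor 1 (polyQ L (quart A B)) {:L}.
Hypotheses (rth : root (polyQ L (quart A B)) th) (ph0 : ph != 0).
Hypothesis uDv : th + th^-1 + (ph + ph^-1) = - A%:~R.
Hypothesis uMv : (th + th^-1) * (ph + ph^-1) = B%:~R - 2.
Hypotheses (w1_neq0 : W1 A B != 0) (w2_neq0 : W2 A B != 0) (w3_neq0 : W3 A B != 0).

Let f := polyQ L (quart A B).
Let G := 'Gal({:L} / 1)%g.
Let th0 : th != 0 := quart_root_neq0 rth.
Let fE : f = \prod_(z <- [:: th; th^-1; ph; ph^-1]) ('X - z%:P) := quart_prod th0 ph0 uDv uMv.

Lemma intr_neq0_rat (n : int) : n != 0 -> n%:~R != 0 :> L.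
Proof. by move=> n0; rewrite -(rmorph_int (in_alg L)) fmorph_eq0 intr_eq0. Qed.

Lemma sqr_uBv_root : (th + th^-1 - (ph + ph^-1)) ^+ 2 = (W3 A B)%:~R.
Proof.
have -> : (th + th^-1 - (ph + ph^-1)) ^+ 2 =
   (th + th^-1 + (ph + ph^-1)) ^+ 2 - 4%:R * ((th + th^-1) * (ph + ph^-1)) by ring.
by rewrite uDv uMv /W3 !(rmorphXn, intrD, intrM, intrB, mulrNz) /=; ring.
Qed.

Lemma sqr_disc_roots : ((th - th^-1) * (ph - ph^-1)) ^+ 2 = (W1 A B * W2 A B)%:~R.
Proof.
have -> : ((th - th^-1) * (ph - ph^-1)) ^+ 2 =
  ((th + th^-1) * (ph + ph^-1) + 2 * (th + th^-1 + (ph + ph^-1)) + 4) *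
  ((th + th^-1) * (ph + ph^-1) - 2 * (th + th^-1 + (ph + ph^-1)) + 4).
  by field; rewrite ?th0 ?ph0.
by rewrite uDv uMv /W1 /W2 !(intrD, intrM, intrB, mulrNz) /=; ring.
Qed.

Lemma uBv_neq0 : th + th^-1 - (ph + ph^-1) != 0.
Proof. by rewrite -sqrf_eq0 sqr_uBv_root intr_neq0_rat. Qed.

Lemma disc_roots_neq0 : (th - th^-1) * (ph - ph^-1) != 0.
Proof. by rewrite -sqrf_eq0 sqr_disc_roots intr_neq0_rat // mulf_neq0. Qed.

Lemma roots_neq : [/\ th != th^-1, ph != ph^-1, th != ph & th != ph^-1]
  /\ (th^-1 != ph /\ th^-1 != ph^-1).
Proof.
have := disc_roots_neq0; rewrite mulf_eq0 negb_or !subr_eq0 => /andP[h1 h2].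
have h := uBv_neq0; rewrite subr_eq0 in h.
split; split => //; apply: contra h => /eqP.
- by move=> ->.
- by move=> ->; rewrite invrK addrC.
- by move=> h; rewrite -h invrK addrC.
- by move/invr_inj => ->.
Qed.

Lemma mem_roots z : root f z = (z \in [:: th; th^-1; ph; ph^-1]).
Proof. by rewrite fE root_prod_XsubC. Qed.

Lemma quart_galois : galois 1 {:L}.
Proof.
apply/splitting_galoisField; exists f; split => //.
  by apply/polyOver1P; exists (polyQ rat (quart A B)); rewrite map_in_alg_polyQ.
rewrite fE separable_prod_XsubC.
have [[h1 h2 h3 h4] [h5 h6]] := roots_neq.
by rewrite /= !inE !negb_or h1 h2 h3 h4 h5 h6.
Qed.

Lemma gal_root (g : gal_of {:L}) z : root f z -> root f (g z).
Proof.
by move=> rz; rewrite /f -(map_polyQ (g : {rmorphism L -> L})) rmorph_root.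
Qed.

Lemma gal_fixed (g : gal_of {:L}) z : z \in <<1; th>>%VS -> g th = th -> g z = z.
Proof.
move=> /Fadjoin_polyP[p /polyOver1P[q ->] ->] gth.
rewrite -horner_map /= gth -map_poly_comp; congr (_.[_]); apply: eq_map_poly => c /=; rewrite linearZ rmorph1; exact: erefl.
Qed.

Lemma gal_eq (g h : gal_of {:L}) : g th = h th -> g ph = h ph -> g = h.
Proof.
move=> eth eph; apply/eqP; rewrite eq_mulgV1.
set k := (g * h^-1)%g.
have kE a : g a = h a -> k a = a.
  by move=> e; rewrite /k galM ?memvf // e -galM ?memvf // mulgV gal_id.
pose K := [aspace of fixedField [set k]].
have KP a : k a = a -> a \in K.
  by move=> ka; apply/(fixedFieldP (memvf a)) => x /set1P ->.
have [rs frs LE] := split_f.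
have : ({:L} <= K)%VS.
  rewrite -LE; apply/Fadjoin_seqP; split; first exact: sub1v.
  move=> z zrs; have : root f z by rewrite (eqp_root frs) root_prod_XsubC.
  have kth : th \in K by apply: KP; apply: kE.
  have kph : ph \in K by apply: KP; apply: kE.
  by rewrite mem_roots !inE => /or4P[] /eqP ->; rewrite ?rpredV.
move=> /subvP LK; apply/gal_eqP => a _.
by have /mem_fixedFieldP[_ /(_ k)] := LK a (memvf a); rewrite gal_id => -> //; apply: set11.
Qed.

Lemma gal_in_G (g : gal_of {:L}) : g \in G.
Proof.
rewrite /G gal_kHom ?sub1v //; apply/kAHomP => a /vlineP[c ->].
by rewrite linearZ /= rmorph1.
Qed.

Lemma gal_trans z : root f z -> exists g : gal_of {:L}, g th = z.
Proof.
move=> rz; have /galois_factors := quart_galois.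
move=> /(_ (sub1v _) th (memvf _)) [r [_ _ mE]].
have : root (minPoly 1 th) z.
  have /polyOver1P[q qE] := minPolyOver 1 th.
  have rq : root (map_poly (in_alg L) q) th by rewrite -qE root_minPoly.
  have := irreducible_dvd_root irr rth rq.
  rewrite -(dvdp_map (in_alg L)) map_in_alg_polyQ -qE => /root_dvdp; exact.
by rewrite mE root_prod_XsubC => /mapP[g _ ->]; exists g.
Qed.

Lemma gal_int (g : gal_of {:L}) (n : int) : g n%:~R = n%:~R.
Proof. by rewrite rmorph_int. Qed.

Lemma gal_addV (g : gal_of {:L}) z : g (z + z^-1) = g z + (g z)^-1.
Proof. by rewrite rmorphD /= fmorphV. Qed.

Lemma gal_v (g : gal_of {:L}) : g (ph + ph^-1) = - A%:~R - g (th + th^-1).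
Proof.
have -> : ph + ph^-1 = - A%:~R - (th + th^-1) by rewrite -uDv; ring.
by rewrite rmorphB rmorphN /= gal_int.
Qed.

(** The block structure: g(v) = - A - g(u) is known once g(th) is, and z + 1/z determines z up to
    inversion. *)
Lemma gal_cases1 (g : gal_of {:L}) :
  g th = th \/ g th = th^-1 -> g ph = ph \/ g ph = ph^-1.
Proof.
move=> h; apply: addV_inj; rewrite ?fmorph_eq0 // -gal_addV gal_v gal_addV -uDv.
by case: h => ->; rewrite ?invrK; ring.
Qed.

Lemma gal_cases2 (g : gal_of {:L}) :
  g th = ph \/ g th = ph^-1 -> g ph = th \/ g ph = th^-1.
Proof.
move=> h; apply: addV_inj; rewrite ?fmorph_eq0 // -gal_addV gal_v gal_addV -uDv.
by case: h => ->; rewrite ?invrK; ring.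
Qed.

Lemma gal_root_cases (g : gal_of {:L}) :
  [\/ g th = th, g th = th^-1, g th = ph | g th = ph^-1].
Proof.
by have := gal_root g rth; rewrite mem_roots !inE => /or4P[] /eqP h; [apply: Or41 | apply: Or42 | apply: Or43 | apply: Or44].
Qed.

Lemma fixed_square (a : L) (n : int) :
  (forall g : gal_of {:L}, g a = a) -> a ^+ 2 = n%:~R -> is_square n.
Proof.
move=> fa an; have /galois_fixedField fE1 := quart_galois.
have : a \in fixedField G by apply/(fixedFieldP (memvf a)) => g _.
rewrite fE1 => /vlineP[q aq].
apply: (@Crat_sqr_int (ratr q)); first exact: Crat_rat.
have : q ^+ 2 = n%:~R.
  apply: (fmorph_inj (in_alg L)); rewrite rmorphXn rmorph_int -an aq; exact: erefl.
by move=> qn; rewrite -rmorphXn qn /= ratr_int.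
Qed.

(** Since v = - A - u lies in Q(th), [ph] is a root of X^2 - v X + 1 over Q(th). Outside Q(th) this
    is its minimal polynomial, which makes 1/ph a conjugate. *)
Lemma gal_stabilizer : ph \notin <<1; th>>%VS ->
  exists t : gal_of {:L}, t th = th /\ t ph = ph^-1.
Proof.
move=> nph; pose K1 := [aspace of <<1; th>>%VS].
have gK : galois K1 {:L} by apply: galoisS quart_galois; rewrite sub1v subvf.
have /(galois_factors (subvf K1)) /(_ ph (memvf _)) [r [rG _ mE]] := gK.
pose v := ph + ph^-1.
have thK : th \in K1 by apply: memv_adjoin.
have vK : v \in K1.
  have -> : v = - A%:~R - (th + th^-1) by rewrite /v -uDv; ring.
  by rewrite rpredB ?rpredN ?rpred_int // rpredD // rpredV.
pose q : {poly L} := 'X^2 - v *: 'X + 1.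
have qK : q \is a polyOver K1.
  by rewrite rpredD ?rpred1 // rpredB ?rpredX ?polyOverX // polyOverZ ?polyOverX.
have rq z : z = ph \/ z = ph^-1 -> root q z.
  by move=> zE; rewrite rootE /q !hornerE /v; apply/eqP; case: zE => ->; field; rewrite ?ph0.
have mq := minPoly_dvdp qK (rq ph (or_introl erefl)).
have q0 : q != 0 by rewrite -size_poly_eq0 size_quadratic.
have sm : size (minPoly K1 ph) = 3%N.
  apply/eqP; rewrite eqn_leq -{1}(size_quadratic v) (dvdp_leq q0 mq) size_minPoly.
  by rewrite ltnS ltn_neqAle eq_sym adjoin_deg_eq1 nph.
have me : minPoly K1 ph %= q by rewrite -(dvdp_size_eqp mq) sm size_quadratic.
have : root (minPoly K1 ph) ph^-1 by rewrite (eqp_root me) rq //; right.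
rewrite mE root_prod_XsubC => /mapP[t tr tE]; exists t; split=> //.
by apply: (fixed_gal (subvf K1)) => //; apply: (fintype.subsetP rG).
Qed.

(** An automorphism is determined by its values at [th] and [ph], and the blocks allow eight pairs
    of values. The swap s of th and ph and the stabilizer element t realize them all, and two
    distinct involutions generate a dihedral group. *)
Lemma gal_dihedral : ph \notin <<1; th>>%VS -> (G \isog [set: 'D_8])%g.
Proof.
move=> /gal_stabilizer[t [tth tph]].
have [s [sth sph]] : exists s : gal_of {:L}, s th = ph /\ s ph = th.
  have [g gth] : exists g : gal_of {:L}, g th = ph.
    by apply: gal_trans; rewrite mem_roots !inE eqxx !orbT.
  case: (gal_cases2 (or_introl gth)) => gph; first by exists g.
  (* Here g(ph) = 1/th; applying t first inverts ph and repairs this. *)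
  exists (t * g)%g; rewrite !galM ?memvf // tth tph; split=> //.
  by rewrite fmorphV /= gph invrK.
have V (g : gal_of {:L}) z : g z^-1 = (g z)^-1 by rewrite fmorphV.
have [[n1 n2 n3 n4] [n5 n6]] := roots_neq.
pose ws := [:: 1; t; s * t * s; s * t * s * t; s; t * s; s * t; t * s * t]%g : seq (gal_of {:L}).
pose vs := [:: (th, ph); (th, ph^-1); (th^-1, ph); (th^-1, ph^-1);
               (ph, th); (ph, th^-1); (ph^-1, th); (ph^-1, th^-1)].
have vE : [seq (g th, g ph) | g : gal_of {:L} <- ws] = vs.
  by rewrite /= !galM ?memvf // !gal_id ?(tth, tph, sth, sph, V, invrK).
have uvs : uniq vs.
  rewrite /= !inE !xpair_eqE !eqxx !(eq_sym ph) !(eq_sym ph^-1) ![th^-1 == th]eq_sym.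
  by rewrite !(negPf n1, negPf n3, negPf n4, negPf n5, negPf n6) ?(eq_sym ph^-1) !(negPf n2).
have uws : uniq ws by apply: (map_uniq (f := fun g : gal_of {:L} => (g th, g ph))); rewrite vE.
have Gws : G =i ws.
  move=> g; rewrite gal_in_G; symmetry.
  have : (g th, g ph) \in vs.
    have c1 := @gal_cases1 g; have c2 := @gal_cases2 g.
    case: (gal_root_cases g) => h; rewrite h.
    - by case: c1 => [|->|->]; [left | |]; rewrite ?inE ?eqxx ?orbT.
    - by case: c1 => [|->|->]; [right | |]; rewrite ?inE ?eqxx ?orbT.
    - by case: c2 => [|->|->]; [left | |]; rewrite ?inE ?eqxx ?orbT.
    - by case: c2 => [|->|->]; [right | |]; rewrite ?inE ?eqxx ?orbT.
  rewrite -vE => /mapP[h hws [eth eph]].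
  by rewrite (gal_eq eth eph).
have cG : #|G| = 8%N.
  have sw : size ws = 8%N by [].
  by rewrite -sw; apply: card_uniq_mem.
have GE : G = <<[set s; t]>>%g.
  apply/eqP; rewrite finset.eqEsubset; apply/andP; split; last first.
    by apply/fintype.subsetP => g _; apply: gal_in_G.
  have sM : s \in <<[set s; t]>>%g by rewrite mem_gen // !inE eqxx.
  have tM : t \in <<[set s; t]>>%g by rewrite mem_gen // !inE eqxx orbT.
  apply/fintype.subsetP => g; rewrite Gws !inE.
  by do 7?[case/orP]; move/eqP => ->; rewrite ?group1 ?groupM.
have s2 : #[s]%g = 2%N.
  apply: nt_prime_order => //.
    by apply: gal_eq; rewrite expgS expg1 galM ?memvf // gal_id ?sth ?sph ?sth.
  by apply: contra_neq n3 => s1; rewrite -sth s1 gal_id.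
have t2 : #[t]%g = 2%N.
  apply: nt_prime_order => //.
    by apply: gal_eq; rewrite expgS expg1 galM ?memvf // gal_id ?tth // tph V tph invrK.
  by apply: contra_neq n2 => s1; rewrite -tph s1 gal_id.
have st : s != t by apply: contra_neq n3 => e; rewrite -sth e tth.
have := involutions_gen_dihedral s2 t2 st; rewrite -GE cG.
by [].
Qed.

(** The element d is a square root of W, and the stabilizer element t, which inverts only [ph],
    sends d to - d. *)
Lemma gal_not_square : ph \notin <<1; th>>%VS -> ~ is_square (W A B).
Proof.
move=> /gal_stabilizer[t [tth tph]] [k Wk].
pose d := (th - th^-1) * (ph - ph^-1) * (th + th^-1 - (ph + ph^-1)).
have d0 : d != 0 by rewrite mulf_neq0 ?disc_roots_neq0 ?uBv_neq0.
have d2 : d ^+ 2 = k%:~R ^+ 2.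
  by rewrite /d exprMn sqr_disc_roots sqr_uBv_root -intrM -[_ * _]/(W A B) Wk rmorphXn.
have td : t d = d.
  by move/eqP: d2; rewrite eqf_sqr => /orP[] /eqP ->; rewrite ?rmorphN /= rmorph_int.
have td' : t d = - d.
  rewrite /d !(rmorphM, rmorphB, rmorphD) /= !fmorphV /= tth tph invrK; ring.
have : d *+ 2 = 0 by rewrite mulr2n -{1}td td' addNr.
by move/eqP; rewrite -mulr_natr mulf_eq0 (negPf d0) /=; apply/negP; exact: (@intr_neq0_rat 2 isT).
Qed.

Section CyclicCase.

Hypothesis ph_in : ph \in <<1; th>>%VS.
Hypothesis nsq12 : ~ is_square (W1 A B * W2 A B).

Lemma gal_eq1 (g h : gal_of {:L}) : g th = h th -> g = h.
Proof.
move=> e; have k1 : (g * h^-1)%g th = th.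
  by rewrite galM ?memvf // e -galM ?memvf // mulgV gal_id.
apply: gal_eq => //.
by rewrite -[in RHS](gal_fixed ph_in k1) -galM ?memvf // mulgKV.
Qed.

(** With [ph] in Q(th) an automorphism is determined by its value at [th]. If g exchanges th and ph,
    take t with t(th) = 1/th. Fixing ph would give t = 1; inverting ph would give a Klein group 1,
    t, g, g t, all of whose elements fix the square root of W1 W2 below. *)
Lemma gal_generator : exists g : gal_of {:L}, g th = ph /\ g ph = th^-1.
Proof.
have V (g : gal_of {:L}) z : g z^-1 = (g z)^-1 by rewrite fmorphV.
have [g gth] : exists g : gal_of {:L}, g th = ph.
  by apply: gal_trans; rewrite mem_roots !inE eqxx !orbT.
case: (gal_cases2 (or_introl gth)) => gph; last by exists g.
have [t tth] : exists t : gal_of {:L}, t th = th^-1.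
  by apply: gal_trans; rewrite mem_roots !inE eqxx !orbT.
have [[n1 n2 n3 n4] [n5 n6]] := roots_neq.
case: (gal_cases1 (or_intror tth)) => tph.
  have e : (g * t)%g = g by apply: gal_eq1; rewrite galM ?memvf // gth tph.
  have t1 : t = 1%g by apply: (mulgI g); rewrite e mulg1.
  by move: n1; rewrite -tth t1 gal_id eqxx.
case: nsq12; apply: (@fixed_square ((th - th^-1) * (ph - ph^-1))); last exact: sqr_disc_roots.
have tfix : t ((th - th^-1) * (ph - ph^-1)) = (th - th^-1) * (ph - ph^-1).
  by rewrite !(rmorphM, rmorphB) /= !V tth tph !invrK; ring.
have gfix : g ((th - th^-1) * (ph - ph^-1)) = (th - th^-1) * (ph - ph^-1).
  by rewrite !(rmorphM, rmorphB) /= !V gth gph; ring.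
move=> h; case: (gal_root_cases h) => hth.
- by rewrite (@gal_eq1 h 1%g) ?gal_id.
- by rewrite (@gal_eq1 h t) // tth.
- by rewrite (@gal_eq1 h g) // gth.
- rewrite (@gal_eq1 h (g * t)%g); first by rewrite galM ?memvf // gfix.
  by rewrite galM ?memvf // gth tph.
Qed.

Lemma gal_cyclic : (G \isog [set: 'Z_4])%g.
Proof.
have [g [gth gph]] := gal_generator.
have V (h : gal_of {:L}) z : h z^-1 = (h z)^-1 by rewrite fmorphV.
have [[n1 n2 n3 n4] [n5 n6]] := roots_neq.
have g2 : (g ^+ 2)%g th = th^-1 by rewrite expgS expg1 galM ?memvf // gth gph.
have g3 : (g ^+ 3)%g th = ph^-1 by rewrite expgSr galM ?memvf // g2 V gth.
have g4 : (g ^+ 4 = 1)%g.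
  by apply: gal_eq1; rewrite expgSr galM ?memvf // g3 V gph invrK gal_id.
have og : #[g]%g = 4%N.
  have : (#[g]%g %| 4)%N by rewrite order_dvdn g4.
  have : ~~ (#[g]%g %| 2)%N.
    by rewrite order_dvdn; apply: contra n1 => /eqP h; rewrite -g2 h gal_id.
  by move=> h1 h2; have := dvdn_leq (isT : (0 < 4)%N) h2; move: h1 h2; case: #[g]%g => [|[|[|[|[|n]]]]].
have GE : G = <[g]>%g.
  apply/eqP; rewrite finset.eqEsubset; apply/andP; split; last first.
    by apply/fintype.subsetP => h _; apply: gal_in_G.
  apply/fintype.subsetP => h _; case: (gal_root_cases h) => hth.
  - by rewrite (@gal_eq1 h 1%g) ?group1 ?gal_id.
  - by rewrite (@gal_eq1 h (g ^+ 2)%g) ?mem_cycle // g2.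
  - by rewrite (@gal_eq1 h g) ?cycle_id // gth.
  - by rewrite (@gal_eq1 h (g ^+ 3)%g) ?mem_cycle // g3.
rewrite GE isog_cyclic_card ?cycle_cyclic // cardsT card_ord -orderE og andbT.
by apply/cyclicP; exists Zp1; apply: Zp_cycle.
Qed.

(** The generator sends ph - 1/ph to - (th - 1/th) and u - v to - (u - v); the two signs cancel in
    d, a square root of W. *)
Lemma gal_cyclic_square : is_square (W A B).
Proof.
have [g [gth gph]] := gal_generator.
have V (h : gal_of {:L}) z : h z^-1 = (h z)^-1 by rewrite fmorphV.
pose d := (th - th^-1) * (ph - ph^-1) * (th + th^-1 - (ph + ph^-1)).
have gd : g d = d.
  by rewrite /d !(rmorphM, rmorphB, rmorphD) /= !V gth gph invrK; ring.
apply: (@fixed_square d); last by rewrite /d exprMn sqr_disc_roots sqr_uBv_root -intrM.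
have gnd n : (g ^+ n)%g d = d.
  by elim: n => [|n IH]; rewrite ?expg0 ?gal_id // expgSr galM ?memvf // IH.
move=> h; case: (gal_root_cases h) => hth.
- by rewrite (@gal_eq1 h 1%g) ?gal_id.
- rewrite (@gal_eq1 h (g ^+ 2)%g) ?gnd //.
  by rewrite expgS expg1 galM ?memvf // gth gph.
- by rewrite (@gal_eq1 h g) // gth.
- rewrite (@gal_eq1 h (g ^+ 3)%g) ?gnd //.
  by rewrite !expgS expg0 mulg1 !galM ?memvf // gth gph V gth.
Qed.

End CyclicCase.

End QuartGalois.

(** * Simultaneous squarefree values *)

Section Counting.
Local Open Scope nat_scope.

Definition cnt (N : nat) (P : pred nat) : nat := #|[set t : 'I_N | P t]|.

Lemma leq_cnt N (P Q : pred nat) : (forall t, t < N -> P t -> Q t) -> cnt N P <= cnt N Q.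
Proof. by move=> PQ; apply/subset_leq_card/fintype.subsetP => t; rewrite !inE; apply: PQ. Qed.

Lemma cnt_false N : cnt N (fun=> false) = 0.
Proof. by apply/eqP; rewrite cards_eq0; apply/eqP/setP => t; rewrite !inE. Qed.

Lemma cntU N (P Q : pred nat) : cnt N (fun t => P t || Q t) <= cnt N P + cnt N Q.
Proof.
apply: leq_trans (leq_card_setU _ _).
by apply/subset_leq_card/fintype.subsetP => t; rewrite !inE.
Qed.

Lemma cnt_has N (bad : nat -> pred nat) s :
  cnt N (fun t => has (bad^~ t) s) <= \sum_(j <- s) cnt N (bad j).
Proof.
elim: s => [|j s IH].
  by rewrite big_nil cnt_false.
by rewrite big_cons; apply: leq_trans (cntU _ _ _) _; rewrite leq_add2l.
Qed.

Lemma cntC N (P : pred nat) : cnt N P + cnt N (fun t => ~~ P t) = N.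
Proof.
rewrite -[RHS](card_ord N) -(cardsC [set t : 'I_N | P t]) /cnt; congr addn.
by apply: eq_card => t; rewrite !inE.
Qed.

Lemma cnt_inj N n (P : pred nat) (f : nat -> nat) :
  (forall t, t < N -> P t -> f t <= n) ->
  (forall t1 t2, t1 < N -> t2 < N -> P t1 -> P t2 -> f t1 = f t2 -> t1 = t2) ->
  cnt N P <= n.+1.
Proof.
move=> fn finj; pose g (t : 'I_N) : 'I_n.+1 := inord (f t).
have ginj : {in [set t : 'I_N | P t] &, injective g}.
  move=> t1 t2; rewrite !inE => P1 P2 /(congr1 (@nat_of_ord _)).
  rewrite /g !inordK ?ltnS ?fn // => e; apply: val_inj; exact: finj e.
rewrite /cnt -(card_in_imset ginj); apply: leq_trans (max_card _) _.
by rewrite card_ord.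
Qed.

Lemma cnt_class N q (P : pred nat) :
  (forall t1 t2, P t1 -> P t2 -> t1 = t2 %[mod q]) -> cnt N P <= N %/ q + 1.
Proof.
move=> h; rewrite addn1; apply: (@cnt_inj _ _ _ (fun t => t %/ q)).
  by move=> t tN _; rewrite leq_div2r // ltnW.
move=> t1 t2 _ _ P1 P2 e; rewrite (divn_eq t1 q) (divn_eq t2 q) e.
by rewrite (h t1 t2 P1 P2).
Qed.

Lemma cnt_large N T (P : pred nat) : T.+1 < cnt N P -> exists2 t, T <= t & P t.
Proof.
move=> hT; apply: contrapT => hn.
have : cnt N P <= T.+1.
  apply: (@cnt_inj _ _ _ id) => // t _ Pt.
  by rewrite leqNgt; apply/negP => tT; apply: hn; exists t => //; apply: ltnW.
by rewrite leqNgt hT.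
Qed.

(** Telescoping: 1/(2j+1)^2 < (1/j - 1/(j+1))/4, and the right sides for 2 <= j <= K + 1 add up to
    K/(8(K+2)). The limit 1/8 is what makes four bad classes for each p affordable. *)
Lemma sum_div_odd_squares N K :
  8 * (K + 2) * \sum_(j <- iota 2 K) N %/ (2 * j + 1) ^ 2 <= N * K.
Proof.
elim: K => [|K IH]; first by rewrite big_nil muln0.
rewrite -[K.+1]addn1 iotaD big_cat /= big_seq1.
move: IH; set T := \sum_(j <- _) _ => IH.
set x := N %/ _; have hx : x * (2 * (2 + K) + 1) ^ 2 <= N by apply: leq_divM.
rewrite -(@leq_pmul2l (K + 2)); last by rewrite addn2.
clearbody x T; nia.
Qed.

(* Divisibility by p^2 for the primes p = 2 j + 1 with 2 <= j <= M excludes at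
   most 4 sum_j (N / (2 j + 1)^2 + 1) <= 4 (N / 8 + M) = 12 M integers below
   N = 16 M. *)
Lemma sieve (bad : nat -> pred nat) (M : nat) :
  (forall j N, 2 <= j -> cnt N (bad j) <= 4 * (N %/ (2 * j + 1) ^ 2 + 1)) ->
  4 * M <= cnt (16 * M) (fun t => ~~ has (bad^~ t) (iota 2 M.-1)).
Proof.
move=> h; have := cntC (16 * M) (fun t => has (bad^~ t) (iota 2 M.-1)).
have := cnt_has (16 * M) bad (iota 2 M.-1).
have : \sum_(j <- iota 2 M.-1) cnt (16 * M) (bad j) <=
    4 * (\sum_(j <- iota 2 M.-1) (16 * M) %/ (2 * j + 1) ^ 2) + 4 * M.-1.
  rewrite big_distrr /=.
  apply: (@leq_trans (\sum_(j <- iota 2 M.-1) (4 * ((16 * M) %/ (2 * j + 1) ^ 2) + 4))).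
    rewrite big_seq [X in _ <= X]big_seq; apply: leq_sum => j.
    by rewrite mem_iota => /andP[j2 _]; apply: leq_trans (h _ _ j2) _; rewrite mulnDr.
  by rewrite big_split /= big_const_seq count_predT size_iota iter_addn_0.
have := sum_div_odd_squares (16 * M) M.-1.
set T := \sum_(j <- _) _ %/ _; set S := \sum_(j <- _) _.
set c := cnt _ _; set d := cnt _ _.
clearbody T S c d; clear h; case: M => [|M] //=.
rewrite addn2; nia.
Qed.

End Counting.

Section SquarefreeValues.
Local Open Scope nat_scope.

Lemma squarefree_nat n : ~~ (2 %| n) -> ~~ (3 %| n) ->
  (forall p, prime p -> 5 <= p -> ~~ (p ^ 2 %| n)) -> squarefree n%:Z.
Proof.
move=> n2 n3 h p pp; rewrite dvdzE abszX !absz_nat.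
case: (leqP 5 p) => [|p5]; first exact: h.
have := pp; move: p5; do 5?[case: p pp => [|p] pp //]; move=> _ _.
- by apply: contra n2; apply: dvdn_trans.
- by apply: contra n3; apply: dvdn_trans.
Qed.

(** The values a t + b are prime to 6, and no p >= 5 divides a, so p^2 spoils a single class of t.
    The bound 144 is the least common multiple of the coefficients 6, 18 and 48 that occur. *)
Definition sieve_form (a b : nat) : bool := [&& 6 %| a, a %| 144 & coprime 6 b].

Lemma prime_dvd144 p : prime p -> 5 <= p -> ~~ (p %| 144).
Proof.
move=> pp p5; rewrite (_ : 144 = 2 ^ 4 * 3 ^ 2) // Euclid_dvdM // !Euclid_dvdX //= !andbT.
by rewrite !dvdn_prime2 //; case: eqVneq p5 => [->|_]; case: eqVneq => // ->.
Qed.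

Lemma sieve_form_coprime a b p : sieve_form a b -> prime p -> 5 <= p -> coprime p a.
Proof.
move=> /and3P[_ a144 _] pp p5; rewrite prime_coprime //.
by apply: contra (prime_dvd144 pp p5) => /dvdn_trans; apply.
Qed.

Lemma sieve_form_prime_to6 a b t : sieve_form a b ->
  ~~ (2 %| a * t + b) /\ ~~ (3 %| a * t + b).
Proof.
move=> /and3P[a6 _ cb].
have c2 : ~~ (2 %| b) by rewrite -prime_coprime //; apply: coprime_dvdl cb.
have c3 : ~~ (3 %| b) by rewrite -prime_coprime //; apply: coprime_dvdl cb.
by rewrite !dvdn_addr // dvdn_mulr // (dvdn_trans _ a6).
Qed.

Lemma eqn_mod_sym_ind q (P : nat -> Prop) :
  (forall t1 t2, t1 <= t2 -> P t1 -> P t2 -> q %| t2 - t1) ->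
  forall t1 t2, P t1 -> P t2 -> t1 = t2 %[mod q].
Proof.
move=> h t1 t2 P1 P2; case: (leqP t1 t2) => [le|/ltnW le].
  by apply/esym/eqP; rewrite eqn_mod_dvd // h.
by apply/eqP; rewrite eqn_mod_dvd // h.
Qed.

Lemma linear_class (a b p : nat) : coprime p a ->
  forall t1 t2, p ^ 2 %| a * t1 + b -> p ^ 2 %| a * t2 + b -> t1 = t2 %[mod p ^ 2].
Proof.
move=> cop; apply: (@eqn_mod_sym_ind _ (fun t => p ^ 2 %| a * t + b)) => t1 t2 le d1 d2.
have : p ^ 2 %| (a * t2 + b) - (a * t1 + b) by rewrite dvdn_sub.
by rewrite subnDr -mulnBr Gauss_dvdr // coprime_pexpl.
Qed.

Lemma cnt_linear a b p N : coprime p a ->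
  cnt N (fun t => p ^ 2 %| a * t + b) <= N %/ p ^ 2 + 1.
Proof. by move=> cop; apply: cnt_class => t1 t2; apply: linear_class. Qed.

Lemma odd_index p : prime p -> 5 <= p -> exists2 j, 2 <= j & p = 2 * j + 1.
Proof.
move=> pp p5; have op : odd p by have [p2|//] := even_prime pp; rewrite p2 in p5.
by exists p./2; have := odd_double_half p; rewrite op; lia.
Qed.

(** The sieve disposes of the primes up to 2 M + 1; for a larger p the values at t < 16 M are at
    most 4 M^2 < p^2. *)
Lemma linear_squarefree3 a1 b1 a2 b2 a3 b3 T :
  sieve_form a1 b1 -> sieve_form a2 b2 -> sieve_form a3 b3 ->
  exists2 t, T <= t & [/\ squarefree (a1 * t + b1)%N%:Z, squarefree (a2 * t + b2)%N%:Z
                        & squarefree (a3 * t + b3)%N%:Z].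
Proof.
move=> s1 s2 s3.
pose bad j t := let p := 2 * j + 1 in prime p &&
  [|| p ^ 2 %| a1 * t + b1, p ^ 2 %| a2 * t + b2 | p ^ 2 %| a3 * t + b3].
(* The first two summands give a t + b <= 4 M^2 for t < 16 M; T + 2 leaves more than T + 1
   survivors, so one of them is at least T. *)
pose M := 4 * (a1 + a2 + a3) + (b1 + b2 + b3) + T + 2.
have hbad j N : 2 <= j -> cnt N (bad j) <= 4 * (N %/ (2 * j + 1) ^ 2 + 1).
  move=> j2; rewrite /bad; case: (boolP (prime (2 * j + 1))) => pp /=; last first.
    by rewrite cnt_false.
  have p5 : 5 <= 2 * j + 1 by lia.
  have c1 := cnt_linear b1 N (sieve_form_coprime s1 pp p5).
  have c2 := cnt_linear b2 N (sieve_form_coprime s2 pp p5).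
  have c3 := cnt_linear b3 N (sieve_form_coprime s3 pp p5).
  apply: leq_trans (cntU _ _ _) _.
  apply: leq_trans (leq_add c1 (cntU _ _ _)) _.
  apply: leq_trans (leq_add (leqnn _) (leq_add c2 c3)) _.
  by move: (N %/ _) => q; lia.
have hM := sieve M hbad.
pose good t := ~~ has (bad^~ t) (iota 2 M.-1).
have [t Tt /andP[tM gt]] : exists2 t, T <= t & (t < 16 * M) && good t.
  apply: (@cnt_large (16 * M)); apply: leq_trans (leq_trans hM _); last first.
    by apply: leq_cnt => t -> .
  by rewrite /M; lia.
exists t => //.
have gd p : prime p -> 5 <= p ->
    [/\ ~~ (p ^ 2 %| a1 * t + b1), ~~ (p ^ 2 %| a2 * t + b2) & ~~ (p ^ 2 %| a3 * t + b3)].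
  move=> pp p5; have [j j2 pE] := odd_index pp p5.
  case: (leqP j M) => [jM|Mj].
    have : ~~ bad j t.
      by apply: contra gt => bj; apply/hasP; exists j => //; rewrite mem_iota j2; lia.
    by rewrite /bad -pE pp /= !negb_or => /and3P[].
  have big a b : a <= a1 + a2 + a3 -> 0 < b <= b1 + b2 + b3 -> ~~ (p ^ 2 %| a * t + b).
    move=> ha /andP[b0 hb]; apply/negP => /dvdn_leq; rewrite addn_gt0 b0 orbT => /(_ isT).
    rewrite leqNgt => /negP; apply.
    have MM : 2 * M < p by rewrite pE; lia.
    have le : a * t + b <= M * (4 * M).
      have at16 : a * t <= (a1 + a2 + a3) * (16 * M) by apply: leq_mul => //; apply: ltnW.
      apply: leq_trans (leq_add at16 hb) _.
      have M2 : 2 <= M by rewrite /M; lia.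
      have Mge : 4 * (a1 + a2 + a3) + (b1 + b2 + b3) <= M by rewrite /M; lia.
      have := leq_mul Mge (leqnn (4 * M)); move: M2; clear.
      by move: (a1 + a2 + a3) (b1 + b2 + b3) M => S R m; nia.
    by apply: leq_ltn_trans le _; nia.
  have b0 a b : sieve_form a b -> 0 < b.
    by move=> /and3P[_ _]; case: b.
  have := b0 _ _ s1; have := b0 _ _ s2; have := b0 _ _ s3 => b30 b20 b10.
  by split; apply: big; lia.
have [o1 o1'] := sieve_form_prime_to6 t s1.
have [o2 o2'] := sieve_form_prime_to6 t s2.
have [o3 o3'] := sieve_form_prime_to6 t s3.
by split; apply: squarefree_nat => // p pp p5; have [] := gd p pp p5.
Qed.

End SquarefreeValues.

(* With X = k p q - m n and Y = n p - m q one has X^2 - k Y^2 = 4 and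
   2 n = m X + k p Y: the solutions of m^2 - k p^2 = -2 grow geometrically. *)
Lemma pell_growth (k m n p q : nat) : (0 < m)%N -> (m < n)%N ->
  (m ^ 2 + 2 = k * p ^ 2)%N -> (n ^ 2 + 2 = k * q ^ 2)%N -> (2 * m <= n)%N.
Proof.
move=> m0 mn hm hn.
have k2 : (2 <= k)%N.
  case: k hm {hn} => [|[|k]] //; first by rewrite mul0n addn2.
  rewrite mul1n => hm; have : (m < p)%N by rewrite -(@ltn_exp2r _ _ 2) // -hm; lia.
  by move: hm m0; clear; nia.
pose X : int := k%:Z * p%:Z * q%:Z - m%:Z * n%:Z; pose Y : int := n%:Z * p%:Z - m%:Z * q%:Z.
have hmZ : m%:Z ^+ 2 + 2 = k%:Z * p%:Z ^+ 2.
  by have := congr1 Posz hm; rewrite -!mulnn PoszD !PoszM !expr2.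
have hnZ : n%:Z ^+ 2 + 2 = k%:Z * q%:Z ^+ 2.
  by have := congr1 Posz hn; rewrite -!mulnn PoszD !PoszM !expr2.
have XY : X ^+ 2 = k%:Z * Y ^+ 2 + 4.
  have -> : X ^+ 2 = (k%:Z * p%:Z ^+ 2) * (k%:Z * q%:Z ^+ 2)
      - 2 * k%:Z * p%:Z * q%:Z * m%:Z * n%:Z + m%:Z ^+ 2 * n%:Z ^+ 2 by rewrite /X; ring.
  have -> : k%:Z * Y ^+ 2 = (k%:Z * p%:Z ^+ 2) * n%:Z ^+ 2 - 2 * k%:Z * p%:Z * q%:Z * m%:Z * n%:Z
     + (k%:Z * q%:Z ^+ 2) * m%:Z ^+ 2 by rewrite /Y; ring.
  by rewrite -hmZ -hnZ; ring.
have nE : 2 * n%:Z = m%:Z * X + k%:Z * p%:Z * Y.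
  have -> : m%:Z * X + k%:Z * p%:Z * Y = n%:Z * (k%:Z * p%:Z ^+ 2) - m%:Z ^+ 2 * n%:Z.
    by rewrite /X /Y; ring.
  by rewrite -hmZ; ring.
have mnZ : m%:Z + 1 <= n%:Z by move: mn; clear; lia.
have m0Z : 1 <= m%:Z by move: m0; clear; lia.
have k2Z : 2 <= k%:Z by move: k2; clear; lia.
have p0 : 0 <= p%:Z by []. have q0 : 0 <= q%:Z by [].
move: mnZ m0Z k2Z p0 q0 hmZ hnZ XY nE.
rewrite {}/X {}/Y; move: hm hn mn m0 k2 => _ _ _ _ _.
have -> : (2 * m <= n)%N = (2 * m%:Z <= n%:Z) by rewrite -lez_nat PoszM.
move: (m%:Z) (n%:Z) (k%:Z) (p%:Z) (q%:Z) => {m n k p q} m n k p q.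
set X := k * p * q - _; set Y := n * p - _ => mn m1 k2 p0 q0 hm hn XY nE.
have m0 : 0 <= m by move: m1; clear; lia.
have n0 : 0 <= n by move: m1 mn; clear; lia.
have k0 : 0 < k by move: k2; clear; lia.
have k0' : 0 <= k := ltW k0.
have Y1 : 1 <= Y.
  have h : (m * q) ^+ 2 < (n * p) ^+ 2.
    rewrite -(@ltr_pM2l _ k) //.
    have -> : k * (m * q) ^+ 2 = m ^+ 2 * (k * q ^+ 2) by ring.
    have -> : k * (n * p) ^+ 2 = n ^+ 2 * (k * p ^+ 2) by ring.
    rewrite -hm -hn; have : m ^+ 2 < n ^+ 2 by rewrite ltr_pXn2r // ?nnegrE //; move: mn; clear; lia.
    rewrite [n ^+ 2 * _]mulrDr [m ^+ 2 * _]mulrDr [m ^+ 2 * n ^+ 2]mulrC.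
    by move: (n ^+ 2 * m ^+ 2) (m ^+ 2) (n ^+ 2) => a b c; clear; lia.
  have : m * q < n * p.
    by rewrite -(@ltr_pXn2r _ 2) // nnegrE mulr_ge0.
  by rewrite /Y; move: (m * q) (n * p); clear; lia.
have X0 : 0 < X.
  have h : (m * n) ^+ 2 < (k * p * q) ^+ 2.
    have -> : (k * p * q) ^+ 2 = (k * p ^+ 2) * (k * q ^+ 2) by ring.
    have -> : (m * n) ^+ 2 = m ^+ 2 * n ^+ 2 by ring.
    rewrite -hm -hn; have := sqr_ge0 m; have := sqr_ge0 n.
    by move: (m ^+ 2) (n ^+ 2) => a b; clear; nia.
  have : m * n < k * p * q.
    by rewrite -(@ltr_pXn2r _ 2) // nnegrE !mulr_ge0.
  by rewrite /X subr_gt0.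
have X3 : 3 <= X by move: X0 XY Y1 k2; clearbody X Y; clear; nia.
have kp : m <= k * p.
  rewrite -(@ler_pXn2r _ 2) // ?nnegrE ?mulr_ge0 //.
  have -> : (k * p) ^+ 2 = k * (k * p ^+ 2) by ring.
  rewrite -hm; have := sqr_ge0 m.
  by move: (m ^+ 2) k2 => a; clear; nia.
have : m * 3 <= m * X by rewrite ler_wpM2l.
have : k * p * 1 <= k * p * Y by rewrite ler_wpM2l // mulr_ge0.
by move: nE kp; rewrite mulr1; move: (m * X) (k * p * Y) (k * p); clear; lia.
Qed.

(** * Squarefree values with a quadratic factor *)

Section QuadraticSieve.
Local Open Scope nat_scope.

(** There are at most two square roots of -2 modulo p^2: p^2 divides (x - y) (x + y), and a p
    dividing both factors would divide x, hence 2. *)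
Lemma sqr_add2_class p x y : prime p -> 3 <= p ->
  p ^ 2 %| x ^ 2 + 2 -> p ^ 2 %| y ^ 2 + 2 -> y <= x ->
  (p ^ 2 %| x - y) || (p ^ 2 %| x + y).
Proof.
move=> pp p3 hx hy yx.
have h : p ^ 2 %| (x - y) * (x + y).
  by rewrite -subn_sqr -(subnDr 2) dvdn_sub.
case: (boolP (p %| x - y)) => d; last first.
  by rewrite -[X in _ || X](@Gauss_dvdr _ (x - y)) ?h ?orbT // coprime_pexpl // prime_coprime.
rewrite -(@Gauss_dvdl _ _ (x + y)) ?h // coprime_pexpl // prime_coprime //.
apply/negP => d'; have p2x : p %| 2 * x.
  by have := dvdn_add d d'; rewrite (_ : x - y + (x + y) = 2 * x) //; move: yx; clear; lia.
have px : p %| x.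
  move: p2x; rewrite Euclid_dvdM // => /orP[|//].
  by move/dvdn_leq => /(_ isT); rewrite leqNgt p3.
have : p %| 2.
  rewrite -(@dvdn_addr (x ^ 2)); first by apply: dvdn_trans hx; apply: dvdn_exp.
  by rewrite dvdn_exp.
by move/dvdn_leq => /(_ isT); rewrite leqNgt p3.
Qed.

Lemma cnt_sqr_add2 p N : prime p -> 5 <= p ->
  cnt N (fun t => p ^ 2 %| (3 * t + 3) ^ 2 + 2) <= 2 * (N %/ p ^ 2 + 1).
Proof.
move=> pp p5; set q := p ^ 2; set P := fun t => _.
have c3 : coprime q 3.
  rewrite coprime_pexpl // prime_coprime // dvdn_prime2 //.
  by apply: contraTneq p5 => ->.
have p3 : 3 <= p by apply: leq_trans p5.
have red t1 t2 : q %| (3 * t2 + 3) - (3 * t1 + 3) -> q %| t2 - t1.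
  by rewrite subnDr -mulnBr Gauss_dvdr.
have [[t0 P0]|nP] := pselect (exists t0, P t0); last first.
  apply: leq_trans (leq0n _); rewrite -(cnt_false N).
  by apply: leq_cnt => t _ Pt; case: nP; exists t.
(* [E] collects the class of t0, [O] the opposite root, where 3 t + 3 is congruent to - (3 t0 +
   3). *)
pose E t := P t && (t == t0 %[mod q]); pose O t := P t && (t != t0 %[mod q]).
have PEO : cnt N P <= cnt N (fun t => E t || O t).
  by apply: leq_cnt => t _ Pt; rewrite /E /O Pt orbN.
apply: leq_trans PEO _; apply: leq_trans (cntU _ _ _) _.
rewrite mul2n -addnn; apply: leq_add.
  by apply: cnt_class => t1 t2 /andP[_ /eqP ->] /andP[_ /eqP ->].
have sumO t : O t -> q %| (3 * t + 3) + (3 * t0 + 3).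
  move=> /andP[Pt ne].
  case: (leqP t0 t) => [le|/ltnW le].
    have le3 : 3 * t0 + 3 <= 3 * t + 3 by rewrite leq_add2r leq_mul2l.
    have /orP[d|d] := sqr_add2_class pp p3 Pt P0 le3; last exact: d.
    by case/negP: ne; rewrite eqn_mod_dvd // red.
  have le3 : 3 * t + 3 <= 3 * t0 + 3 by rewrite leq_add2r leq_mul2l.
  have /orP[d|d] := sqr_add2_class pp p3 P0 Pt le3; last by rewrite addnC.
  by case/negP: ne; rewrite eq_sym eqn_mod_dvd // red.
apply: cnt_class; apply: eqn_mod_sym_ind => t1 t2 le /sumO d1 /sumO d2.
by apply: red; rewrite -(subnDr (3 * t0 + 3)) dvdn_sub.
Qed.

(** From one solution to a larger one 3 t + 3 at least doubles, so the binary logarithm of t + 1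
    separates solutions. *)
Lemma cnt_pell k n N : N <= 2 ^ n ->
  cnt N (fun t => `[< exists p, (3 * t + 3) ^ 2 + 2 = k * p ^ 2 >]) <= n.+1.
Proof.
move=> Nn; apply: (@cnt_inj _ _ _ (fun t => trunc_log 2 t.+1)).
  move=> t tN _; have -> : n = trunc_log 2 (2 ^ n) by rewrite trunc_expnK.
  by apply: leq_trunc_log; apply: leq_trans Nn.
suff key t1 t2 : t1 < t2 -> `[< exists p, (3 * t1 + 3) ^ 2 + 2 = k * p ^ 2 >] ->
    `[< exists p, (3 * t2 + 3) ^ 2 + 2 = k * p ^ 2 >] -> trunc_log 2 t1.+1 < trunc_log 2 t2.+1.
  move=> t1 t2 _ _ h1 h2 e; case: (ltngtP t1 t2) => // lt.
    by have := key _ _ lt h1 h2; rewrite e ltnn.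
  by have := key _ _ lt h2 h1; rewrite e ltnn.
move=> lt /asboolP[p hp] /asboolP[q hq].
have h : 2 * (3 * t1 + 3) <= 3 * t2 + 3 by apply: pell_growth hp hq; lia.
apply: trunc_log_max => //; rewrite expnS.
have := trunc_logP (isT : 1 < 2) (ltn0Sn t1); lia.
Qed.

(** With A = 6 t + 6 these are A - 1, A + 1 and (A/2)^2 + 2. A square p^2 of a prime p > 2 M can
    still divide the quadratic value, but then t solves one of 577 equations (3 t + 3)^2 + 2 = k
    p^2, each with logarithmically few solutions. *)
Lemma quadratic_squarefree T : exists2 t, T <= t &
  [/\ squarefree (6 * t + 5)%N%:Z, squarefree (6 * t + 7)%N%:Z
    & squarefree ((3 * t + 3) ^ 2 + 2)%N%:Z].
Proof.
have s1 : sieve_form 6 5 by []. have s2 : sieve_form 6 7 by [].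
pose bad j t := let p := 2 * j + 1 in prime p &&
  [|| p ^ 2 %| 6 * t + 5, p ^ 2 %| 6 * t + 7 | p ^ 2 %| (3 * t + 3) ^ 2 + 2].
(* This makes 16 M = 2^(20 + T), as [cnt_pell] wants; the 577 (21 + T) exceptions then leave more
   than T + 1 of the 4 M survivors. *)
pose M := 2 ^ (16 + T).
(* Four classes modulo p^2: one for each linear factor, two for the quadratic one. *)
have hbad j N : 2 <= j -> cnt N (bad j) <= 4 * (N %/ (2 * j + 1) ^ 2 + 1).
  move=> j2; rewrite /bad; case: (boolP (prime (2 * j + 1))) => pp /=; last first.
    by rewrite cnt_false.
  have p5 : 5 <= 2 * j + 1 by lia.
  have c1 := cnt_linear 5 N (sieve_form_coprime s1 pp p5).
  have c2 := cnt_linear 7 N (sieve_form_coprime s2 pp p5).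
  have c3 := cnt_sqr_add2 N pp p5.
  apply: leq_trans (cntU _ _ _) _.
  apply: leq_trans (leq_add c1 (cntU _ _ _)) _.
  apply: leq_trans (leq_add (leqnn _) (leq_add c2 c3)) _.
  by move: (N %/ _) => q; lia.
have hM := sieve M hbad.
pose pell k t := `[< exists p, (3 * t + 3) ^ 2 + 2 = k * p ^ 2 >].
have hP : cnt (16 * M) (fun t => has (pell^~ t) (iota 0 577)) <= 577 * (21 + T).
  apply: leq_trans (cnt_has _ _ _) _.
  apply: (@leq_trans (\sum_(k <- iota 0 577) (21 + T))).
    apply: leq_sum => k _; apply: (@cnt_pell k (20 + T)).
    by rewrite /M (_ : 16 = 2 ^ 4) // -expnD.
  by rewrite big_const_seq count_predT size_iota iter_addn_0 mulnC.
pose good t := ~~ has (bad^~ t) (iota 2 M.-1).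
have TM : T.+1 + 577 * (21 + T) < 4 * M.
  have : T < 2 ^ T by apply: ltn_expl.
  rewrite /M expnD; move: (2 ^ T) => z; rewrite (_ : 2 ^ 16 = 256 * 256) //; lia.
have [t Tt /andP[/andP[tM gt] npt]] : exists2 t, T <= t & (t < 16 * M) && good t && ~~ has (pell^~ t) (iota 0 577).
  apply: (@cnt_large (16 * M)).
  have : cnt (16 * M) good <= cnt (16 * M) (fun t =>
      (t < 16 * M) && good t && ~~ has (pell^~ t) (iota 0 577) || has (pell^~ t) (iota 0 577)).
    by apply: leq_cnt => t -> -> /=; rewrite orNb.
  move/leq_trans/(_ (cntU _ _ _)).
  by move: hM hP TM; rewrite -/good; move: (cnt _ _) (cnt _ _) (cnt _ _) => a b c; lia.
exists t => //.
have M0 : 1000 <= M by rewrite /M expnD; apply: (@leq_trans (2 ^ 16 * 1)) => //; rewrite leq_mul2l // expn_gt0.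
have gd p : prime p -> 5 <= p ->
    [/\ ~~ (p ^ 2 %| 6 * t + 5), ~~ (p ^ 2 %| 6 * t + 7) & ~~ (p ^ 2 %| (3 * t + 3) ^ 2 + 2)].
  move=> pp p5; have [j j2 pE] := odd_index pp p5.
  case: (leqP j M) => [jM|Mj].
    have : ~~ bad j t.
      by apply: contra gt => bj; apply/hasP; exists j => //; rewrite mem_iota j2; lia.
    by rewrite /bad -pE pp /= !negb_or => /and3P[].
  have MM : 2 * M < p by rewrite pE; lia.
  have pM : 4 * M ^ 2 < p ^ 2 by move: MM; clear; nia.
  split.
  - apply/negP => /dvdn_leq; rewrite addn_gt0 orbT => /(_ isT).
    by move: pM tM M0; move: (p ^ 2); clear; nia.
  - apply/negP => /dvdn_leq; rewrite addn_gt0 orbT => /(_ isT).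
    by move: pM tM M0; move: (p ^ 2); clear; nia.
  (* From k p^2 <= (48 M)^2 + 2 and p^2 > 4 M^2 follows k <= 576 = 48^2/4. *)
  apply/negP => /dvdnP[k kE]; case/negP: npt; apply/hasP; exists k.
    rewrite mem_iota /= add0n ltnNge; apply/negP => k577.
    have : (3 * t + 3) ^ 2 + 2 <= 2304 * M ^ 2 + 2 by move: tM; clear; nia.
    rewrite kE; have : 577 * p ^ 2 <= k * p ^ 2 by rewrite leq_mul2r k577 orbT.
    by move: pM M0; move: (k * p ^ 2) (p ^ 2); clear; nia.
  by apply/asboolP; exists p; rewrite kE.
have [o1 o1'] := sieve_form_prime_to6 t s1.
have [o2 o2'] := sieve_form_prime_to6 t s2.
split.
- by apply: squarefree_nat => // p pp p5; have [] := gd p pp p5.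
- by apply: squarefree_nat => // p pp p5; have [] := gd p pp p5.
move=> p pp; rewrite dvdzE abszX !absz_nat.
case: (leqP 5 p) => [p5|]; first by have [] := gd p pp p5.
move=> p4; have [->|->] : p = 2 \/ p = 3.
- by move: p pp p4; do 5?[case=> //]; [left | right].
(* A square plus 2 is 2 or 3 modulo 4, and (3 t + 3)^2 + 2 is 2 modulo 9. *)
- apply/negP => /dvdnP[k]; have := odd_double_half (3 * t + 3); rewrite -mul2n.
  move: (_./2) => i <-; case: (odd _); rewrite ?add0n ?add1n -mulnn /=; clear; nia.
apply/negP => /dvdnP[k]; rewrite -mulnSr expnMn; clear; lia.
Qed.

End QuadraticSieve.

(** * Congruences and the cyclic case *)

Lemma int_parity (k : int) : (exists i, k = 2 * i) \/ (exists i, k = 2 * i + 1).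
Proof.
have : (k %% 2)%Z = 0 \/ (k %% 2)%Z = 1 by lia.
by case=> h; [left | right]; exists (k %/ 2)%Z; lia.
Qed.

Lemma sqr_mod4 (k : int) : exists m, k ^+ 2 = 4 * m \/ k ^+ 2 = 4 * m + 1.
Proof.
have [[i ->]|[i ->]] := int_parity k.
  by exists (i ^+ 2); left; ring.
by exists (i ^+ 2 + i); right; ring.
Qed.

Lemma not_square_mod4 (n : int) : (n %% 4)%Z = 2 \/ (n %% 4)%Z = 3 -> ~ is_square n.
Proof.
move=> h [k kE]; have [m] := sqr_mod4 k; rewrite -kE => hm.
by move: hm h; clear; lia.
Qed.

Lemma odd_sqr_mod8 (k : int) : ~~ (2 %| k)%Z -> exists m, k ^+ 2 = 8 * m + 1.
Proof.
move=> k2; have [i ->] : exists i, k = 2 * i + 1 by exists (k %/ 2)%Z; lia.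
have [j jE] : exists j, i * (i + 1) = 2 * j.
  have [[j ->]|[j ->]] := int_parity i.
    by exists (j * (2 * j + 1)); ring.
  by exists ((2 * j + 1) * (j + 1)); ring.
exists j; have -> : (2 * i + 1) ^+ 2 = 4 * (i * (i + 1)) + 1 by ring.
by rewrite jE; ring.
Qed.

Lemma W3_even (a B : int) : W3 (2 * a) B = 4 * (a ^+ 2 - B + 2).
Proof. by rewrite /W3; ring. Qed.

Lemma W3_div4 (a B : int) : (W3 (2 * a) B %/ 4)%Z = a ^+ 2 - B + 2.
Proof. by rewrite W3_even mulKz. Qed.

Lemma squarefree_mod4 n : squarefree n -> (n %% 4)%Z != 0.
Proof. by move/(_ 2%N isT) => h; apply: contra h => /eqP/dvdz_mod0P. Qed.

Lemma even_sqr_mod4 (a : int) :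
  ((2 * a) %% 4)%Z = 0 /\ (exists m, a ^+ 2 = 4 * m) \/
  ((2 * a) %% 4)%Z = 2 /\ (exists m, a ^+ 2 = 4 * m + 1).
Proof.
have [[j ->]|[j ->]] := int_parity a.
  by left; split; [lia | exists (j ^+ 2); ring].
by right; split; [lia | exists (j ^+ 2 + j); ring].
Qed.

Definition residue_conditions (A B : int) : Prop :=
  ((2 %| A)%Z -> (2 %| B)%Z ->
     squarefree (W3 A B %/ 4)%Z /\
     ((A %% 4)%Z, (B %% 4)%Z) \in [:: (0, 0); (2, 0)]) /\
  ((2 %| A)%Z -> ~~ (2 %| B)%Z ->
     squarefree (W3 A B %/ 4)%Z /\
     ((A %% 4)%Z, (B %% 4)%Z) \in [:: (0, 3); (2, 1)]) /\
  (~~ (2 %| A)%Z -> (2 %| B)%Z ->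
     squarefree (W3 A B) /\
     ((A %% 4)%Z, (B %% 4)%Z) \in [:: (1, 2); (3, 2)]) /\
  (~~ (2 %| A * B)%Z ->
     squarefree (W3 A B) /\
     ((A %% 4)%Z, (B %% 4)%Z) \in
       [:: (1, 1); (1, 3); (3, 1); (3, 3)]).

Lemma odd_mul (A B : int) : ~~ (2 %| A * B)%Z = ~~ (2 %| A)%Z && ~~ (2 %| B)%Z.
Proof. by rewrite -negb_or !dvdzE abszM Euclid_dvdM. Qed.

(** The listed residues say that W1 is nonzero modulo 4 and, for A = 2 a, that D = a^2 - B + 2 is 2
    or 3 modulo 4, with a^2 equal to 0 or 1 modulo 4 according to A modulo 4. *)
Lemma residue_conditionsP A B : squarefree (W1 A B) ->
  max_quad_order A B <-> residue_conditions A B.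
Proof.
move=> /squarefree_mod4; rewrite /W1 => h1; split.
  rewrite /max_quad_order => mx.
  split; [move=> A2 B2|split; [move=> A2 B2|split; [move=> A2 B2|rewrite odd_mul => /andP[A2 B2]]]].
  - move: mx; rewrite A2 => -[sq D1]; split=> //; move/squarefree_mod4: sq D1 B2 h1.
    have [a ->] : exists a, A = 2 * a by exists (A %/ 2)%Z; move: A2; clear; lia.
    rewrite W3_div4; have := even_sqr_mod4 a.
    by move: (a ^+ 2) => s; rewrite !inE !xpair_eqE; clear; case=> -[h [m ->]]; lia.
  - move: mx; rewrite A2 => -[sq D1]; split=> //; move/squarefree_mod4: sq D1 B2 h1.
    have [a ->] : exists a, A = 2 * a by exists (A %/ 2)%Z; move: A2; clear; lia.
    rewrite W3_div4; have := even_sqr_mod4 a.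
    by move: (a ^+ 2) => s; rewrite !inE !xpair_eqE; clear; case=> -[h [m ->]]; lia.
  - move: mx; rewrite (negPf A2) => sq; split=> //.
    by move: h1 A2 B2; rewrite !inE !xpair_eqE; clear; lia.
  - move: mx; rewrite (negPf A2) => sq; split=> //.
    by move: A2 B2; rewrite !inE !xpair_eqE; clear; lia.
move=> [hc [hd [he hf]]]; rewrite /max_quad_order; case: ifP => A2; last first.
  case: (boolP (2 %| B)%Z) => B2; first by have [] := he (negbT A2) B2.
  by have [] := hf _; rewrite // odd_mul A2.
have [sq res] : squarefree (W3 A B %/ 4)%Z /\ ((A %% 4)%Z, (B %% 4)%Z) \in [:: (0, 0); (2, 0); (0, 3); (2, 1)].
  case: (boolP (2 %| B)%Z) => B2; [have [sq] := hc A2 B2|have [sq] := hd A2 B2];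
  by rewrite !inE => h; split=> //; case/orP: h => ->; rewrite ?orbT.
split=> //; move: res; have [a ->] : exists a, A = 2 * a by exists (A %/ 2)%Z; move: A2; clear; lia.
rewrite W3_div4; have := even_sqr_mod4 a.
by move: (a ^+ 2) => s; rewrite !inE !xpair_eqE; clear; case=> -[h [m ->]]; lia.
Qed.

(** Two squarefree integers with a square product are equal, and W1 = W2 means A = 0. *)
Lemma W12_not_square A B : A != 0 -> squarefree (W1 A B) -> squarefree (W2 A B) ->
  ~ is_square (W1 A B * W2 A B).
Proof.
move=> A0 sq1 sq2 [m mE].
have /dvdzP[k kE] : (W1 A B %| m)%Z by apply: squarefree_dvd_sqr => //; rewrite -mE dvdz_mulr.
have W2E : W2 A B = W1 A B * k ^+ 2.
  by apply: (mulfI (squarefree_neq0 sq1)); rewrite mE kE; ring.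
have k1 : `|k|%N = 1%N by apply: (squarefree_sqr_dvd sq2); rewrite W2E dvdz_mull.
have k2 : k ^+ 2 = 1 by have [->|->] : k = 1 \/ k = -1 by move: k1; clear; lia.
by move: W2E A0; rewrite k2 mulr1 /W1 /W2; clear; lia.
Qed.

Lemma W12E A B : W1 A B * W2 A B = (B + 2) ^+ 2 - 4 * A ^+ 2.
Proof. by rewrite /W1 /W2; ring. Qed.

Lemma not_square_mul_sqr (d n : int) : d != 0 -> ~ is_square n -> ~ is_square (d ^+ 2 * n).
Proof.
move=> d0 nsq [k kE]; apply: nsq.
have /dvdzP[q qE] : (d %| k)%Z by rewrite -(@dvdz_pexp2r _ _ 2) // -kE dvdz_mulr.
by exists q; apply: (mulfI (expf_neq0 2 d0)); rewrite kE qE; ring.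
Qed.

(** After removal of a factor 4 or 16, what remains of W is 3 modulo 4 for A odd and congruent to D
    = W3/4, hence 2 or 3 modulo 4, for A even. *)
Lemma W_not_square A B : squarefree (W1 A B) -> max_quad_order A B ->
  (2 %| A)%Z \/ (2 %| B)%Z -> ~ is_square (W A B).
Proof.
move=> sq1 mx AB; have := squarefree_mod4 sq1; rewrite /W W12E.
case: (boolP (2 %| A)%Z) AB => A2 AB h1; last first.
  case: AB => // B2.
  have [m mE] := odd_sqr_mod8 A2.
  have [b bE] : exists b, B = 4 * b + 2.
    by exists (B %/ 4)%Z; move: h1 A2 B2; rewrite /W1; clear; lia.
  have -> : ((B + 2) ^+ 2 - 4 * A ^+ 2) * W3 A B =
      2 ^+ 2 * (((2 * b + 2) ^+ 2 - A ^+ 2) * (A ^+ 2 - 4 * B + 8)) by rewrite /W3 bE; ring.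
  apply: not_square_mul_sqr => //; apply: not_square_mod4; right.
  have -> : ((2 * b + 2) ^+ 2 - A ^+ 2) * (A ^+ 2 - 4 * B + 8) =
      4 * ((b + 1) ^+ 2 * (A ^+ 2 - 4 * B + 8) - 2 * m * (A ^+ 2 - 4 * B + 8) - (2 * m - B + 2) - 1) + 3.
    have -> : (2 * b + 2) ^+ 2 = 4 * (b + 1) ^+ 2 by ring.
    rewrite mE; ring.
  by move: (_ - _ - 1) => z; clear; lia.
move: mx; rewrite /max_quad_order A2 => -[/squarefree_mod4 D4 D1].
move: D4 D1 h1; have [a ->] : exists a, A = 2 * a by exists (A %/ 2)%Z; move: A2; clear; lia.
rewrite W3_div4 W3_even.
set D := _ - _ + _ => D4 D1 h1.
case: (boolP (2 %| B)%Z) => B2.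
  have [b bE] : exists b, B = 4 * b by exists (B %/ 4)%Z; move: h1 B2; rewrite /W1; clear; lia.
  have -> : ((B + 2) ^+ 2 - 4 * (2 * a) ^+ 2) * (4 * D) =
     4 ^+ 2 * (((2 * b + 1) ^+ 2 - 4 * a ^+ 2) * D) by rewrite bE; ring.
  apply: not_square_mul_sqr => //; apply: not_square_mod4.
  have -> : ((2 * b + 1) ^+ 2 - 4 * a ^+ 2) * D = 4 * ((b ^+ 2 + b - a ^+ 2) * D) + D by ring.
  by move: D4 D1; clear; move: (_ * D) => z; lia.
have [m mE] := odd_sqr_mod8 B2.
have -> : ((B + 2) ^+ 2 - 4 * (2 * a) ^+ 2) * (4 * D) =
     2 ^+ 2 * ((B ^+ 2 + 4 * B + 4 - 16 * a ^+ 2) * D) by ring.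
apply: not_square_mul_sqr => //; apply: not_square_mod4.
have -> : (B ^+ 2 + 4 * B + 4 - 16 * a ^+ 2) * D = 4 * ((2 * m + B + 1 - 4 * a ^+ 2) * D) + D.
  by rewrite mE; ring.
by move: D4 D1; clear; move: (_ * D) => z; lia.
Qed.

(** If W3 = k^2, then u = (- A + k)/2 is rational and f is a product of two quadratics. Thus the
    five sets miss no monogenic f with A B nonzero. *)
Lemma irreducible_W3_not_square A B :
  irreducible_poly (polyQ rat (quart A B)) -> ~ is_square (W3 A B).
Proof.
move=> [_ irr] [k kE].
pose r : rat := (- A%:~R + k%:~R) / 2; pose s : rat := (- A%:~R - k%:~R) / 2.
have rs : r + s = - A%:~R by rewrite /r /s; field.
have rsM : r * s = B%:~R - 2.
  have : (k%:~R : rat) ^+ 2 = (W3 A B)%:~R by rewrite kE rmorphXn.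
  rewrite /W3 !(rmorphXn, intrD, intrM, mulrNz) /= => k2.
  have -> : r * s = (A%:~R ^+ 2 - k%:~R ^+ 2) / 4 by rewrite /r /s; field.
  by rewrite k2; field.
have fE : polyQ rat (quart A B) = ('X^2 - r *: 'X + 1) * ('X^2 - s *: 'X + 1).
  rewrite polyQ_quart; have -> : A%:~R = - (r + s) by rewrite rs opprK.
  have -> : B%:~R = r * s + 2 by rewrite rsM subrK.
  rewrite -!mul_polyC !(polyCN, polyCD, polyCM).
  by rewrite !polyC1; ring.
have q1 : size ('X^2 - r *: 'X + 1) != 1%N by rewrite size_quadratic.
have := irr _ q1; rewrite {1}fE dvdp_mulr // => /(_ isT) /eqp_size.
by rewrite size_quadratic (size_polyQ _ (quart_monic _ _)) size_quart.
Qed.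

Lemma squarefree_sqr_dvd_mul (x y m : int) :
  squarefree y -> (m ^+ 2 %| x * y)%Z -> m != 0 -> (m %| x)%Z.
Proof.
move=> sqy mxy m0; pose d := gcdz m x.
have d0 : d != 0 by rewrite gcdz_eq0 negb_and m0.
have /dvdzP[m' mE] : (d %| m)%Z := dvdz_gcdl m x.
have /dvdzP[x' xE] : (d %| x)%Z := dvdz_gcdr m x.
have cop : coprimez m' x'.
  apply/coprimezP; have [a [b ab]] := Bezoutz m x; exists (a, b) => /=.
  by apply: (mulIf d0); rewrite mul1r mulrDl -!mulrA -mE -xE.
have m'y : (m' ^+ 2 %| y)%Z.
  rewrite -(@Gauss_dvdzr _ x'); last by rewrite coprimez_pexpl.
  have : (m' ^+ 2 * d * d %| x' * y * d)%Z.
    by have -> : m' ^+ 2 * d * d = m ^+ 2 by [rewrite mE; ring]; have -> : x' * y * d = x * y by [rewrite xE; ring].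
  by rewrite dvdz_mul2r //; apply: dvdz_trans; apply: dvdz_mulr.
have m'1 := squarefree_sqr_dvd sqy m'y.
by rewrite xE mE dvdz_mul // dvdzE m'1 dvd1n.
Qed.

(* D p^2 = m^2 + 4 and A^2 = 16 + D (1 + 4 p) with A = m t; for |p| > 5 the
   second equation contradicts A^2 >= m^2. *)
Lemma cyclic_bound (D p m t : int) :
  D * p ^+ 2 = m ^+ 2 + 4 -> (m * t) ^+ 2 = 16 + D * (1 + 4 * p) ->
  (D %% 8)%Z = 5 -> ~~ (2 %| p)%Z -> ~~ (2 %| t)%Z ->
  [\/ (m * t) ^+ 2 = 1 /\ D = 5, (m * t) ^+ 2 = 81 /\ D = 13
    | (m * t) ^+ 2 = 121 /\ D = 5].
Proof.
move=> h1 h2 D8 p2 t2.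
have D5 : 5 <= D.
  have : 0 < D by have : 0 < D * p ^+ 2 by [rewrite h1; nia]; nia.
  by move: D8; clear; lia.
have t1 : 1 <= t ^+ 2 by move: t2; clear; nia.
have key : t ^+ 2 * (D * p ^+ 2 - 4) = 16 + D * (1 + 4 * p) by rewrite -h2 h1; ring.
have m2 : 0 <= m ^+ 2 by rewrite sqr_ge0.
have le : D * p ^+ 2 - 4 <= 16 + D * (1 + 4 * p).
  by rewrite -key h1 addrK ler_peMl.
have pb : -7 < p < 7.
  have le' : D * (p ^+ 2 - 4 * p - 1) <= 20.
    have -> : D * (p ^+ 2 - 4 * p - 1) = D * p ^+ 2 - D * (1 + 4 * p) by ring.
    by move: le; clear; lia.
  have big : 7 <= p \/ p <= -7 -> 20 <= p ^+ 2 - 4 * p - 1.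
    by clear; case=> h; nia.
  have nb : ~ (20 <= p ^+ 2 - 4 * p - 1).
    by move: D5 le'; clear; move: (_ - 1) => z D5 le' h; nia.
  have : ~ (7 <= p \/ p <= -7) by move/big.
  by clear; lia.
have T : [\/ t ^+ 2 = 1, t ^+ 2 = 9, t ^+ 2 = 25 | 49 <= t ^+ 2].
  have : t = 1 \/ t = -1 \/ t = 3 \/ t = -3 \/ t = 5 \/ t = -5 \/ 7 <= t \/ t <= -7.
    by move: t2; clear; lia.
  case=> [->|[->|[->|[->|[->|[->|[t7|t7]]]]]]];
    try by [apply: Or41 | apply: Or42 | apply: Or43].
    by apply: Or44; move: t7; clear; nia.
  by apply: Or44; move: t7; clear; nia.
have s0 : 0 <= (m * t) ^+ 2 by rewrite sqr_ge0.
move: ((m * t) ^+ 2) (t ^+ 2) s0 h2 key T => s tt s0 h2 key T.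
have : p = -5 \/ p = -3 \/ p = -1 \/ p = 1 \/ p = 3 \/ p = 5.
  by move: pb p2; clear; lia.
(* For p = -5, -3 the square A^2 would be negative and p = 3 leaves no t; p = -1, 1, 5 give A^2 = 1,
   81, 121. *)
case=> [pE|[pE|[pE|[pE|[pE|pE]]]]]; rewrite {}pE {p2 pb} in h1 h2 le key.
- by move: h2 s0 D5; clear; lia.
- by move: h2 s0 D5; clear; lia.
- by apply: Or31; move: h2 s0 D5 D8; clear; lia.
- case: T => [tE|tE|tE|tE].
  + by move: key D5; rewrite tE; clear; lia.
  + by apply: Or32; move: key h2 D5; rewrite tE; clear; lia.
  + by move: key D5; rewrite tE; clear; lia.
  + by move: key tE D5; clear; nia.
- case: T => [tE|tE|tE|tE].
  + by move: key D5; rewrite tE; clear; lia.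
  + by move: key D5; rewrite tE; clear; lia.
  + by move: key D5; rewrite tE; clear; lia.
  + by move: key tE D5; clear; nia.
- by apply: Or33; move: h2 le D5 D8; clear; lia.
Qed.

Lemma coprimez4 (n : int) : ~~ (2 %| n)%Z -> coprimez 4 n.
Proof.
move=> n2; rewrite (_ : 4 = 2 ^+ 2) // coprimez_pexpl //.
by rewrite coprimezE (prime_coprime _ (isT : prime 2)).
Qed.

(** As D = W3 is squarefree, W a square gives W1 W2 = m^2 D. Eliminating B shows D | A^2 - 16; the
    quotient r satisfies D (r - 1)^2 = 16 (m^2 + 4), and r - 1 = 4 p yields the two equations of
    [cyclic_bound]. Finally m^2 | W1 W2 with squarefree factors forces m to divide both, hence 4 A,
    hence A, because m is odd. *)
Lemma cyclic_finite A B : A != 0 -> ~~ (2 %| A)%Z -> ~~ (2 %| B)%Z ->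
  squarefree (W1 A B) -> squarefree (W2 A B) -> squarefree (W3 A B) ->
  is_square (W A B) ->
  [\/ (A = 1 \/ A = -1) /\ B = 1, (A = 9 \/ A = -9) /\ B = 19
    | (A = 11 \/ A = -11) /\ B = 31].
Proof.
move=> A0 A2 B2 sq1 sq2 sq3 [k kE].
set D := W3 A B in sq3; have D0 := squarefree_neq0 sq3.
have DE : D = A ^+ 2 - 4 * B + 8 by [].
have D8 : (D %% 8)%Z = 5.
  have [a aE] := odd_sqr_mod8 A2.
  by rewrite DE aE; move: B2; clear; lia.
have /dvdzP[m mE] : (D %| k)%Z.
  by apply: squarefree_dvd_sqr => //; rewrite -kE /W dvdz_mull.
have W12 : W1 A B * W2 A B = m ^+ 2 * D.
  by apply: (mulIf D0); rewrite -[LHS]/(W A B) kE mE; ring.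
(* Substitute 4 (B + 2) = A^2 + 16 - D into 16 W1 W2 and use (A^2 + 16)^2 - 64 A^2 = (A^2 -
   16)^2. *)
have E16 : (A ^+ 2 - 16) ^+ 2 = D * (2 * (A ^+ 2 + 16) - D + 16 * m ^+ 2).
  have -> : 16 * m ^+ 2 = 16 * m ^+ 2 * 1 by rewrite mulr1.
  have e : D * (2 * (A ^+ 2 + 16) - D + 16 * m ^+ 2 * 1) =
    D * (2 * (A ^+ 2 + 16) - D) + 16 * (m ^+ 2 * D) by ring.
  by rewrite e -W12 /W1 /W2 DE; ring.
have /dvdzP[r rE] : (D %| A ^+ 2 - 16)%Z.
  by apply: squarefree_dvd_sqr => //; rewrite E16 dvdz_mulr.
have E4 : D * (r - 1) ^+ 2 = 16 * (m ^+ 2 + 4).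
  apply: (mulfI D0).
  have -> : D * (D * (r - 1) ^+ 2) = (r * D) ^+ 2 - 2 * D * (r * D) + D ^+ 2 by ring.
  by rewrite -rE E16; ring.
have /dvdzP[p pE] : (4 %| r - 1)%Z.
  have : (4 ^+ 2 %| D * (r - 1) ^+ 2)%Z by rewrite E4 dvdz_mulr.
  rewrite Gauss_dvdzr ?dvdz_pexp2r // coprimez_pexpl //.
  by apply: coprimez4; move: D8; clear; lia.
have h1 : D * p ^+ 2 = m ^+ 2 + 4.
  by apply: (@mulfI _ 16) => //; rewrite -E4 pE; ring.
have h2 : A ^+ 2 = 16 + D * (1 + 4 * p).
  by rewrite -[LHS](subrK 16) rE -[r](subrK 1) pE; ring.
have m2 : ~~ (2 %| m)%Z.
  have : ~~ (2 %| m ^+ 2 * D)%Z.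
    rewrite -W12 W12E; have [b bE] : exists b, B = 2 * b + 1.
      by exists (B %/ 2)%Z; move: B2; clear; lia.
    have -> : (B + 2) ^+ 2 - 4 * A ^+ 2 = 2 * (2 * (b ^+ 2 + 3 * b - A ^+ 2) + 4) + 1 by rewrite bE; ring.
    by move: (_ + 4) => z; clear; lia.
  by apply: contra => h; rewrite expr2 -mulrA dvdz_mulr.
have m0 : m != 0 by apply: contra m2 => /eqP ->.
have m1 : (m %| W1 A B)%Z by apply: (squarefree_sqr_dvd_mul sq2 _ m0); rewrite W12 dvdz_mulr.
have m2' : (m %| W2 A B)%Z.
  by apply: (squarefree_sqr_dvd_mul sq1 _ m0); rewrite mulrC W12 dvdz_mulr.
have /dvdzP[t tE] : (m %| A)%Z.
  have : (m %| 4 * A)%Z.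
    have -> : 4 * A = W2 A B - W1 A B by rewrite /W1 /W2; ring.
    by rewrite rpredB.
  by rewrite Gauss_dvdzr // coprimez_sym coprimez4.
have t2 : ~~ (2 %| t)%Z by apply: contra A2 => h; rewrite tE dvdz_mulr.
have p2 : ~~ (2 %| p)%Z.
  (* D p^2 = m^2 + 4 is odd. *)
  apply/negP => /dvdzP[q qE]; have [a aE] := odd_sqr_mod8 m2.
  move: h1; rewrite qE aE => h.
  have : 2 * (D * q ^+ 2 * 2 - 4 * a) = 5.
    by apply: (@addrI _ (8 * a)); have -> : 8 * a + 5 = 8 * a + 1 + 4 by [ring]; rewrite -h; ring.
  by move: (_ - _) => z; clear; lia.
have AE : A = m * t by rewrite tE mulrC.
have := cyclic_bound h1 _ D8 p2 t2; rewrite -AE => /(_ h2).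
have BE : 4 * B = A ^+ 2 + 8 - D by rewrite DE; ring.
have sq (a b : int) : a ^+ 2 = b ^+ 2 -> a = b \/ a = - b.
  by move/eqP; rewrite eqf_sqr => /orP[] /eqP; [left | right].
case=> -[A2E DE']; [apply: Or31|apply: Or32|apply: Or33]; split.
- exact: (sq A 1).
- by move: BE; rewrite A2E DE'; clear; lia.
- exact: (sq A 9).
- by move: BE; rewrite A2E DE'; clear; lia.
- exact: (sq A 11).
- by move: BE; rewrite A2E DE'; clear; lia.
Qed.

(** * Galois groups of monogenic quartics, and the case B = 0 *)

Lemma splitting_quart_roots (L : splittingFieldType rat) A B :
  splittingFieldFor 1 (polyQ L (quart A B)) {:L} ->
  exists x y : L, [/\ root (polyQ L (quart A B)) x, y != 0,
    x + x^-1 + (y + y^-1) = - A%:~R & (x + x^-1) * (y + y^-1) = B%:~R - 2].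
Proof.
case=> rs frs _.
have [x rx] : exists x, root (polyQ L (quart A B)) x.
  have := eqp_size frs; rewrite (size_polyQ _ (quart_monic _ _)) size_quart size_prod_XsubC.
  case: rs frs => [|x rs] frs // _; exists x.
  by rewrite (eqp_root frs) root_prod_XsubC mem_head.
by have [y [y0 h1 h2]] := quart_split frs rx; exists x, y.
Qed.

Section MonogenicGalois.

Variables (A B : int).
Hypothesis mono : monogenic (quart A B).
Hypothesis A0 : A != 0.

Let sq1 := monogenic_squarefree_W1 mono.
Let sq2 := monogenic_squarefree_W2 mono.
Let nsq3 := irreducible_W3_not_square mono.1.
Let nsq12 := W12_not_square A0 sq1 sq2.

Lemma monogenic_Gal_D8 : ~ is_square (W A B) -> Gal_isog (quart A B) 'D_(8%N)%type.
Proof.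
move=> nsq L split_f; have [x [y [rx y0 uDv uMv]]] := splitting_quart_roots split_f.
have w1 := squarefree_neq0 sq1; have w2 := squarefree_neq0 sq2; have w3 := W3_neq0 nsq3.
case: (boolP (y \in <<1; x>>%VS)) => yx.
  by case: nsq; apply: (gal_cyclic_square mono.1 split_f rx y0 uDv uMv w1 w2 w3 yx nsq12).
exact: (gal_dihedral mono.1 split_f rx y0 uDv uMv w1 w2 w3 yx).
Qed.

Lemma monogenic_Gal_Z4 : is_square (W A B) -> Gal_isog (quart A B) 'Z_4.
Proof.
move=> sq L split_f; have [x [y [rx y0 uDv uMv]]] := splitting_quart_roots split_f.
have w1 := squarefree_neq0 sq1; have w2 := squarefree_neq0 sq2; have w3 := W3_neq0 nsq3.
case: (boolP (y \in <<1; x>>%VS)) => yx.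
  exact: (gal_cyclic mono.1 split_f rx y0 uDv uMv w1 w2 w3 yx nsq12).
by case: (gal_not_square split_f rx y0 uDv uMv w1 w2 w3 yx).
Qed.

Lemma monogenic_even_not_square : (2 %| A)%Z \/ (2 %| B)%Z -> ~ is_square (W A B).
Proof. exact: (W_not_square sq1 (monogenic_max_quad_order mono)). Qed.

End MonogenicGalois.

Lemma equivalent_opp A B : irreducible_poly (polyQ rat (quart A B)) ->
  equivalent (quart A B) (quart (- A) B).
Proof.
move=> irr; have [L _ [x rx _]] := irredp_FAdjoin irr.
rewrite map_in_alg_polyQ in rx.
exists L, x, (- x); split=> //.
  by move: rx; rewrite !rootE !horner_quart => /eqP h; apply/eqP; rewrite -[RHS]h mulrNz; ring.
apply/eqP; rewrite eqEsubv.
have xN : - x \in <<1; x>>%VS by rewrite rpredN memv_adjoin.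
have xN' : x \in <<1; - x>>%VS by rewrite -rpredN memv_adjoin.
by apply/andP; split; apply/FadjoinP; split=> //; apply: sub1v.
Qed.

Lemma squarefree_compute (D : int) (n : nat) : D != 0 -> (`|D| < n.+1 ^ 2)%N ->
  all (fun p => ~~ (p ^ 2 %| `|D|)%N) (iota 2 n) -> squarefree D.
Proof.
move=> D0 Dn /allP h; apply: (squarefree_small D0 Dn) => p pp pn.
by apply: h; rewrite mem_iota prime_gt1 //= ltnW // addSn add1n !ltnS.
Qed.

Lemma squarefreeM x y : coprimez x y -> squarefree x -> squarefree y -> squarefree (x * y).
Proof.
move=> cop sx sy p pp; apply/negP => h.
have px (a b : int) : squarefree b -> (p%:Z ^+ 2 %| a * b)%Z -> (p %| `|a|)%N.
  move=> sb; apply: contraLR => c; rewrite Gauss_dvdzr; first exact: sb.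
  by rewrite coprimez_pexpl // coprimezE absz_nat prime_coprime.
have hx := px _ _ sy h; rewrite mulrC in h; have hy := px _ _ sx h.
have : (p %| gcdn `|x| `|y|)%N by rewrite dvdn_gcd hx hy.
move: cop; rewrite coprimezE => /eqP ->.
by rewrite dvdn1 => /eqP p1; rewrite p1 in pp.
Qed.

Lemma squarefree_double x : ~~ (2 %| x)%Z -> squarefree x -> squarefree (2 * x).
Proof.
move=> x2 sx; apply: squarefreeM => //; last by apply: (@squarefree_compute 2 1).
by rewrite coprimezE (prime_coprime _ (isT : prime 2)).
Qed.

Lemma squarefree_not_square n : squarefree n -> `|n|%N != 1%N -> ~ is_square n.
Proof.
move=> sn n1 [k kE]; move: n1; rewrite kE.
have -> : `|k ^+ 2|%N = 1%N by rewrite abszX (squarefree_sqr_dvd sn) // kE.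
by [].
Qed.

(** The only squares that differ by 8 are 1 and 9, which is why A = 1 and A = -1 are set apart. *)
Lemma sqr_add8_not_square (A : int) : A \notin [:: 0; 1; -1] -> ~ is_square (W3 A 0).
Proof.
move=> hA [k]; rewrite /W3 mulr0 subr0 => h.
have {hA} : 2 <= `|A| by move: hA; rewrite !inE; clear; lia.
have : `|A| ^+ 2 + 8 = `|k| ^+ 2 by rewrite !real_normK ?num_real.
have : 0 <= `|k| by []. move: (`|A|) (`|k|); clear => a b b0 h a2.
have ab : a + 1 <= b by nia.
have : b = a + 1 \/ b = a + 2 \/ a + 3 <= b by move: ab; clear; lia.
by case=> [E|[E|E]]; [move: h a2; rewrite E; clear => h a2 .. | nia];
  [have : 2 * a + 1 = 8 by apply: (@addrI _ (a ^+ 2)); rewrite h; ring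
  |have : 4 * a + 4 = 8 by apply: (@addrI _ (a ^+ 2)); rewrite h; ring]; lia.
Qed.

(** W1 = - 2 (A - 1) and W2 = 2 (A + 1), so squarefreeness forces A even; with a = A/2, D = a^2 + 2
    is 2 or 3 modulo 4 by itself. *)
Lemma monogenic_B0 (A : int) : A \notin [:: 0; 1; -1] ->
  (monogenic (quart A 0) <->
   [/\ (2 %| A)%Z, squarefree (A - 1), squarefree (A + 1)
     & squarefree ((A %/ 2)%Z ^+ 2 + 2)]).
Proof.
move=> hA; have A0 : A != 0 by apply: contra hA => /eqP ->.
rewrite (monogenicP A0 (sqr_add8_not_square hA)).
have E1 : W1 A 0 = - (2 * (A - 1)) by rewrite /W1; ring.
have E2 : W2 A 0 = 2 * (A + 1) by rewrite /W2; ring.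
split=> [[s1 s2 mx]|[A2 s1 s2 s3]].
  have A2 : (2 %| A)%Z by move: (squarefree_mod4 s2); rewrite E2; clear; lia.
  move: mx; rewrite /max_quad_order A2 => -[sD _]; split=> //.
  - by apply: (squarefree_dvd s1); rewrite E1 -mulrN dvdzE !abszM abszN dvdn_mull.
  - by apply: (squarefree_dvd s2); rewrite E2 dvdz_mull.
  have [a Ea] : exists a, A = 2 * a by exists (A %/ 2)%Z; move: A2; clear; lia.
  by move: sD; rewrite Ea W3_div4 mulKz // subr0.
have [a Ea] : exists a, A = 2 * a by exists (A %/ 2)%Z; move: A2; clear; lia.
split.
- by rewrite E1; apply/squarefreeN/squarefree_double => //; move: A2; clear; lia.
- by rewrite E2; apply/squarefree_double => //; move: A2; clear; lia.
rewrite /max_quad_order A2 Ea W3_div4 subr0; move: s3; rewrite Ea mulKz // => s3; split=> //.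
by have [m [->|->]] := sqr_mod4 a; clear; lia.
Qed.

Lemma monogenic_criterion A B : A * B != 0 -> ~ is_square (W3 A B) ->
  (monogenic (quart A B) <->
   squarefree (W1 A B) /\ squarefree (W2 A B) /\ residue_conditions A B).
Proof.
rewrite mulf_eq0 negb_or => /andP[A0 _] nsq; rewrite (monogenicP A0 nsq).
split=> [[h1 h2 h3]|[h1 [h2 h3]]]; split=> //.
  by split=> //; apply/(residue_conditionsP h1).
by apply/(residue_conditionsP h1).
Qed.

(** * Infinite families *)

Lemma monogenic_of_conditions A B : A != 0 -> squarefree (W1 A B) -> squarefree (W2 A B) ->
  max_quad_order A B -> ~ is_square (W3 A B) -> monogenic (quart A B).
Proof. by move=> A0 s1 s2 mx nsq; apply/monogenicP. Qed.

Lemma max_quad_order_even (a B : int) : squarefree (a ^+ 2 - B + 2) ->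
  ((a ^+ 2 - B + 2) %% 4)%Z = 3 -> max_quad_order (2 * a) B /\ ~ is_square (W3 (2 * a) B).
Proof.
move=> sD D3; split; first by rewrite /max_quad_order dvdz_mulr // W3_div4 D3.
rewrite W3_even (_ : 4 = 2 ^+ 2) //; apply: not_square_mul_sqr => //.
by apply: not_square_mod4; right.
Qed.

Lemma coprimez_add (x y : int) (d : nat) : (y = x + d%:Z) -> coprimez x d%:Z -> coprimez x y.
Proof.
move=> ->; move/coprimezP=> [[a b] /= ab]; apply/coprimezP; exists (a - b, b) => /=.
by rewrite -ab; ring.
Qed.

(* (W1, W2, W3), with the odd factors in play squarefree by the sieve:
   fam1: -2 (18 t + 13), 2 (6 t + 7), 4 (6 t + 5) (6 t + 7);
   fam2: 1, 48 t + 65, 4 (6 t + 5) (6 t + 7);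
   fam3: -2 (6 t + 5), 2 (6 t + 13), (6 t + 5) (6 t + 13);
   fam4: -(6 t + 1), 18 t + 19, (6 t + 1) (6 t + 5). *)
Definition fam1 (t : nat) : int * int := (2 * (6 * t%:Z + 5), - (12 * t%:Z + 8)).
Definition fam2 (t : nat) : int * int := (12 * t%:Z + 16, 24 * t%:Z + 31).
Definition fam3 (t : nat) : int * int := (6 * t%:Z + 9, 6).
Definition fam4 (t : nat) : int * int := (6 * t%:Z + 5, 6 * t%:Z + 7).

Lemma Posz_form (a b t : nat) : (a * t + b)%N%:Z = a%:Z * t%:Z + b%:Z.
Proof. by rewrite PoszD PoszM. Qed.

(** In each family B is tied to A so that W3 splits. With A = 2 a, B = 2 - 2 a gives D = a (a + 2)
    here, and B = 4 a - 1 gives W1 = 1 and D = (a - 1) (a - 3) in the second. In the third B = 6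
    gives W3 = A^2 - 16; in the fourth B = A + 2 gives W3 = A (A - 4). The two odd factors differ by
    a power of 2, hence are coprime. *)
Lemma fam1_monogenic T : exists2 t, (T <= t)%N & monogenic (quart (fam1 t).1 (fam1 t).2).
Proof.
have [t Tt [s1 s2 s3]] :=
  @linear_squarefree3 6 5 6 7 18 13 T (erefl _) (erefl _) (erefl _).
exists t => //=; rewrite !Posz_form in s1 s2 s3.
have cop : coprimez (6%:Z * t%:Z + 5%:Z) (6%:Z * t%:Z + 7%:Z).
  apply: (@coprimez_add _ _ 2); first by ring.
  by rewrite coprimez_sym coprimezE (prime_coprime _ (isT : prime 2)); lia.
have DE : (6 * t%:Z + 5) ^+ 2 - (- (12 * t%:Z + 8)) + 2 = (6%:Z * t%:Z + 5%:Z) * (6%:Z * t%:Z + 7%:Z) by ring.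
have [] := @max_quad_order_even (6 * t%:Z + 5) (- (12 * t%:Z + 8)).
- by rewrite DE; apply: squarefreeM.
- have -> : (6 * t%:Z + 5) ^+ 2 - (- (12 * t%:Z + 8)) + 2 = 4 * (9 * t%:Z ^+ 2 + 18 * t%:Z + 8) + 3 by ring.
  by move: (_ + 8) => z; clear; lia.
move=> mx nsq; apply: monogenic_of_conditions => //.
- by apply/eqP; lia.
- rewrite (_ : W1 _ _ = - (2 * (18%:Z * t%:Z + 13%:Z))); last by rewrite /W1; ring.
  by apply/squarefreeN/squarefree_double => //; lia.
- rewrite (_ : W2 _ _ = 2 * (6%:Z * t%:Z + 7%:Z)); last by rewrite /W2; ring.
  by apply/squarefree_double => //; lia.
Qed.

Lemma fam2_monogenic T : exists2 t, (T <= t)%N & monogenic (quart (fam2 t).1 (fam2 t).2).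
Proof.
have [t Tt [s1 s2 s3]] :=
  @linear_squarefree3 6 5 6 7 48 65 T (erefl _) (erefl _) (erefl _).
exists t => //=; rewrite !Posz_form in s1 s2 s3.
have cop : coprimez (6%:Z * t%:Z + 5%:Z) (6%:Z * t%:Z + 7%:Z).
  apply: (@coprimez_add _ _ 2); first by ring.
  by rewrite coprimez_sym coprimezE (prime_coprime _ (isT : prime 2)); lia.
have DE : (6 * t%:Z + 8) ^+ 2 - (24 * t%:Z + 31) + 2 = (6%:Z * t%:Z + 5%:Z) * (6%:Z * t%:Z + 7%:Z) by ring.
have AE : 12 * t%:Z + 16 = 2 * (6 * t%:Z + 8) by ring.
have [] := @max_quad_order_even (6 * t%:Z + 8) (24 * t%:Z + 31).
- by rewrite DE; apply: squarefreeM.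
- have -> : (6 * t%:Z + 8) ^+ 2 - (24 * t%:Z + 31) + 2 = 4 * (9 * t%:Z ^+ 2 + 18 * t%:Z + 8) + 3 by ring.
  by move: (_ + 8) => z; clear; lia.
rewrite -AE => mx nsq; apply: monogenic_of_conditions => //.
- by apply/eqP; lia.
- rewrite (_ : W1 _ _ = 1); last by rewrite /W1; ring.
  exact: (@squarefree_compute 1 1).
- by rewrite (_ : W2 _ _ = 48%:Z * t%:Z + 65%:Z) // /W2; ring.
Qed.

Lemma fam3_monogenic T : exists2 t, (T <= t)%N & monogenic (quart (fam3 t).1 (fam3 t).2).
Proof.
have [t Tt [s1 s2 _]] :=
  @linear_squarefree3 6 5 6 13 6 13 T (erefl _) (erefl _) (erefl _).
exists t => //=; rewrite !Posz_form in s1 s2.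
have cop : coprimez (6%:Z * t%:Z + 5%:Z) (6%:Z * t%:Z + 13%:Z).
  apply: (@coprimez_add _ _ 8); first by ring.
  rewrite (_ : 8%:Z = 2 ^+ 3) // coprimez_pexpr // coprimez_sym coprimezE (prime_coprime _ (isT : prime 2)); lia.
have W3E : W3 (6 * t%:Z + 9) 6 = (6%:Z * t%:Z + 5%:Z) * (6%:Z * t%:Z + 13%:Z) by rewrite /W3; ring.
have sW3 : squarefree (W3 (6 * t%:Z + 9) 6) by rewrite W3E; apply: squarefreeM.
apply: monogenic_of_conditions => //.
- by apply/eqP; lia.
- rewrite (_ : W1 _ _ = - (2 * (6%:Z * t%:Z + 5%:Z))); last by rewrite /W1; ring.
  by apply/squarefreeN/squarefree_double => //; lia.
- rewrite (_ : W2 _ _ = 2 * (6%:Z * t%:Z + 13%:Z)); last by rewrite /W2; ring.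
  by apply/squarefree_double => //; lia.
- by rewrite /max_quad_order; case: ifP => // A2; lia.
by apply: squarefree_not_square => //; rewrite W3E abszM muln_eq1; lia.
Qed.

Lemma fam4_monogenic T : exists2 t, (T <= t)%N & monogenic (quart (fam4 t).1 (fam4 t).2).
Proof.
have [t Tt [s1 s2 s3]] :=
  @linear_squarefree3 6 1 6 5 18 19 T (erefl _) (erefl _) (erefl _).
exists t => //=; rewrite !Posz_form in s1 s2 s3.
have cop : coprimez (6%:Z * t%:Z + 1%:Z) (6%:Z * t%:Z + 5%:Z).
  apply: (@coprimez_add _ _ 4); first by ring.
  rewrite (_ : 4%:Z = 2 ^+ 2) // coprimez_pexpr // coprimez_sym coprimezE (prime_coprime _ (isT : prime 2)); lia.
have W3E : W3 (6 * t%:Z + 5) (6 * t%:Z + 7) = (6%:Z * t%:Z + 1%:Z) * (6%:Z * t%:Z + 5%:Z) by rewrite /W3; ring.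
have sW3 : squarefree (W3 (6 * t%:Z + 5) (6 * t%:Z + 7)) by rewrite W3E; apply: squarefreeM.
apply: monogenic_of_conditions => //.
- by apply/eqP; lia.
- rewrite (_ : W1 _ _ = - (6%:Z * t%:Z + 1%:Z)); last by rewrite /W1; ring.
  by apply/squarefreeN.
- by rewrite (_ : W2 _ _ = 18%:Z * t%:Z + 19%:Z) // /W2; ring.
- by rewrite /max_quad_order; case: ifP => // A2; lia.
by apply: squarefree_not_square => //; rewrite W3E abszM muln_eq1; lia.
Qed.

Lemma calF_monogenic T : exists2 t, (T <= t)%N & monogenic (quart (6 * t%:Z + 6) 0).
Proof.
have [t Tt [s1 s2 s3]] := quadratic_squarefree T.
exists t => //; apply/monogenic_B0; first by rewrite !inE; lia.
rewrite !Posz_form in s1 s2; split.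
- by lia.
- by rewrite (_ : _ - 1 = 6%:Z * t%:Z + 5%:Z) //; ring.
- by rewrite (_ : _ + 1 = 6%:Z * t%:Z + 7%:Z) //; ring.
have -> : ((6 * t%:Z + 6) %/ 2)%Z = 3 * t%:Z + 3 by lia.
by move: s3; rewrite -mulnn PoszD PoszM Posz_form expr2.
Qed.

Lemma homo_ltn_inj (f : nat -> nat) : {homo f : x y / (x < y)%N} -> injective f.
Proof.
move=> fh x y e; case: (ltngtP x y) => // /fh; by rewrite e ltnn.
Qed.

(** On a finite set the coefficient of X is bounded, whereas [a t] is at least t in absolute
    value. *)
Lemma infinite_quart_family (S : set {poly int}) (a b : nat -> int) :
  (forall t, (t <= `|a t|)%N) ->
  (forall T, exists2 t, (T <= t)%N & S (quart (a t) (b t))) -> infinite_set S.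
Proof.
move=> ha hS /finite_seqP[s Ss].
pose c (p : {poly int}) := absz p`_1.
pose T := (\sum_(p <- s) c p).+1.
have [t Tt St] := hS T.
have ts : quart (a t) (b t) \in s by move: St; rewrite Ss.
have : (`|a t| < T)%N.
  have <- : c (quart (a t) (b t)) = `|a t|%N by rewrite /c quart_coefs coef_poly.
  by rewrite ltnS (big_rem _ ts) leq_addr.
by rewrite ltnNge (leq_trans Tt (ha t)).
Qed.

Lemma distinct_family (fam : nat -> int * int) :
  injective (fun t => quart_disc (fam t).1 (fam t).2) ->
  pairwise_distinct [set f | exists2 t, f = quart (fam t).1 (fam t).2 & monogenic f]%classic.
Proof.
move=> inj f g [t -> mt] [s -> ms] ne /(equivalent_disc mt ms) /inj ts.
by rewrite ts in ne.
Qed.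

Lemma fam1_disc : injective (fun t => quart_disc (fam1 t).1 (fam1 t).2).
Proof.
move=> t s; pose F t := ((18 * t + 13) * (6 * t + 7) * ((6 * t + 5) * (6 * t + 7)) ^ 2)%N.
have E u : quart_disc (fam1 u).1 (fam1 u).2 = - 64 * (F u)%:Z.
  by rewrite /F /quart_disc /W1 /W2 /W3 -mulnn !(PoszD, PoszM) /=; ring.
rewrite !E => /mulfI - /(_ isT) [] ; apply: homo_ltn_inj => {t s E} t s ts.
by rewrite /F !ltn_mul // ?ltn_add2r ?ltn_mul2l ?ltn_exp2r // !ltn_mul // ?ltn_add2r ?ltn_mul2l.
Qed.

Lemma fam2_disc : injective (fun t => quart_disc (fam2 t).1 (fam2 t).2).
Proof.
move=> t s; pose F t := ((48 * t + 65) * ((6 * t + 5) * (6 * t + 7)) ^ 2)%N.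
have E u : quart_disc (fam2 u).1 (fam2 u).2 = 16 * (F u)%:Z.
  by rewrite /F /quart_disc /W1 /W2 /W3 -mulnn !(PoszD, PoszM) /=; ring.
rewrite !E => /mulfI - /(_ isT) [] ; apply: homo_ltn_inj => {t s E} t s ts.
by rewrite /F !ltn_mul // ?ltn_add2r ?ltn_mul2l ?ltn_exp2r // !ltn_mul // ?ltn_add2r ?ltn_mul2l.
Qed.

Lemma fam3_disc : injective (fun t => quart_disc (fam3 t).1 (fam3 t).2).
Proof.
move=> t s; pose F t := ((6 * t + 5) * (6 * t + 13) * ((6 * t + 5) * (6 * t + 13)) ^ 2)%N.
have E u : quart_disc (fam3 u).1 (fam3 u).2 = - 4 * (F u)%:Z.
  by rewrite /F /quart_disc /W1 /W2 /W3 -mulnn !(PoszD, PoszM) /=; ring.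
rewrite !E => /mulfI - /(_ isT) [] ; apply: homo_ltn_inj => {t s E} t s ts.
by rewrite /F !ltn_mul // ?ltn_add2r ?ltn_mul2l ?ltn_exp2r // !ltn_mul // ?ltn_add2r ?ltn_mul2l.
Qed.

Lemma fam4_disc : injective (fun t => quart_disc (fam4 t).1 (fam4 t).2).
Proof.
move=> t s; pose F t := ((6 * t + 1) * (18 * t + 19) * ((6 * t + 1) * (6 * t + 5)) ^ 2)%N.
have E u : quart_disc (fam4 u).1 (fam4 u).2 = - 1 * (F u)%:Z.
  by rewrite /F /quart_disc /W1 /W2 /W3 -mulnn !(PoszD, PoszM) /=; ring.
rewrite !E => /mulfI - /(_ isT) [] ; apply: homo_ltn_inj => {t s E} t s ts.
by rewrite /F !ltn_mul // ?ltn_add2r ?ltn_mul2l ?ltn_exp2r // !ltn_mul // ?ltn_add2r ?ltn_mul2l.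
Qed.

(** * The five families *)

Lemma calF_Gal f : calF f -> Gal_isog f 'D_(8%N)%type.
Proof.
move=> [A [hA -> mono]]; have A0 : A != 0 by apply: contra hA => /eqP ->.
apply: (monogenic_Gal_D8 mono A0); apply: (monogenic_even_not_square mono).
by right.
Qed.

(** The discriminant - 4 (A^2 - 1) (A^2 + 8)^2 is strictly decreasing for A >= 2. *)
Lemma calFplus_distinct : pairwise_distinct calFplus.
Proof.
move=> f g [A [hA -> mA A2]] [C [hC -> mC C2]] ne /(equivalent_disc mA mC) e.
apply: ne; suff -> : A = C by [].
have E x : quart_disc x 0 = - (4 * ((x ^+ 2 - 1) * (x ^+ 2 + 8) ^+ 2)).
  by rewrite /quart_disc /W1 /W2 /W3; ring.
have key (a b : int) : 2 <= a -> a < b -> quart_disc b 0 < quart_disc a 0.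
  move=> a2 ab; rewrite !E ltrN2 ltr_pM2l //.
  have a0 : 0 <= a by move: a2; clear; lia.
  have b0 : 0 <= b by move: a2 ab; clear; lia.
  have ab2 : a ^+ 2 < b ^+ 2 by rewrite ltr_pXn2r // nnegrE.
  have a4 : 4 <= a ^+ 2 by move: a2; clear; nia.
  by apply: ltr_pM; rewrite ?sqr_ge0 ?ltr_pXn2r ?nnegrE //;
     move: ab2 a4; move: (a ^+ 2) (b ^+ 2) => x y; clear; lia.
case: (ltgtP A C) => // h; first by have := key _ _ A2 h; rewrite e ltxx.
by have := key _ _ C2 h; rewrite e ltxx.
Qed.

Lemma calF_equivalent_plus f : calF f -> exists2 g, calFplus g & equivalent f g.
Proof.
move=> [A [hA -> mono]].
have irr := mono.1.
case: (leP 2 A) => A2.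
  exists (quart A 0); first by exists A.
  have [L _ [x rx _]] := irredp_FAdjoin irr; rewrite map_in_alg_polyQ in rx.
  by exists L, x, x.
exists (quart (- A) 0); last exact: equivalent_opp.
have hA' : - A \notin [:: 0; 1; -1] by move: hA; rewrite !inE; clear; lia.
exists (- A); split=> //; last by move: hA A2; rewrite !inE; clear; lia.
move/(monogenic_B0 hA): mono => [A2' s1 s2 s3]; apply/(monogenic_B0 hA').
have [a Ea] : exists a, A = 2 * a by exists (A %/ 2)%Z; move: A2'; clear; lia.
split.
- by move: A2'; clear; lia.
- by rewrite (_ : - A - 1 = - (A + 1)); [apply/squarefreeN | ring].
- by rewrite (_ : - A + 1 = - (A - 1)); [apply/squarefreeN | ring].
move: s3; rewrite Ea mulKz // -mulrN mulKz // sqrrN; exact.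
Qed.

Lemma calF_infinite : infinite_set calF.
Proof.
apply: (@infinite_quart_family _ (fun t => 6 * t%:Z + 6) (fun=> 0)) => [t|T]; first by lia.
have [t Tt mt] := calF_monogenic T; exists t => //.
by exists (6 * t%:Z + 6); split=> //; rewrite !inE; lia.
Qed.

Definition famP (i : nat) (A B : int) : Prop :=
  match i with
  | 0 => (2 %| A)%Z /\ (2 %| B)%Z
  | 1 => (2 %| A)%Z /\ ~~ (2 %| B)%Z
  | 2 => ~~ (2 %| A)%Z /\ (2 %| B)%Z
  | 3 => ~~ (2 %| A * B)%Z /\ ~ is_square (W A B)
  | _ => ~~ (2 %| A * B)%Z /\ is_square (W A B)
  end.

Lemma calFamE (i : 'I_5) : calFam i = monogenic_with (famP i).
Proof. by case: i => [[|[|[|[|[|i]]]]] hi]. Qed.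

Lemma famP_total A B : exists2 i : 'I_5, True & famP i A B.
Proof.
case: (boolP (2 %| A)%Z) => hA; case: (boolP (2 %| B)%Z) => hB.
- by exists (Ordinal (isT : 0 < 5)%N).
- by exists (Ordinal (isT : 1 < 5)%N).
- by exists (Ordinal (isT : 2 < 5)%N).
have hAB : ~~ (2 %| A * B)%Z by rewrite odd_mul hA.
have [sq|nsq] := pselect (is_square (W A B)).
  by exists (Ordinal (isT : 4 < 5)%N).
by exists (Ordinal (isT : 3 < 5)%N).
Qed.

Lemma famP_uniq A B (i j : 'I_5) : famP i A B -> famP j A B -> i = j.
Proof.
move=> hi hj; apply: val_inj; move: hi hj.
case: i => [[|[|[|[|[|i]]]]] hi] //=; case: j => [[|[|[|[|[|j]]]]] hj] //=;
  rewrite ?odd_mul => -[h1 h2] [h3 h4] //; exfalso;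
  move: h1 h2 h3 h4; do ?case: (2 %| _)%Z => //=.
Qed.

Lemma family_in (P : int -> int -> Prop) (fam : nat -> int * int) :
  (forall t, (fam t).1 * (fam t).2 != 0) -> (forall t, P (fam t).1 (fam t).2) ->
  (forall t, (t <= `|(fam t).1|)%N) ->
  (forall T, exists2 t, (T <= t)%N & monogenic (quart (fam t).1 (fam t).2)) ->
  injective (fun t => quart_disc (fam t).1 (fam t).2) ->
  exists S : set {poly int},
    [/\ (S `<=` monogenic_with P)%classic, infinite_set S & pairwise_distinct S].
Proof.
move=> nz hP ha hm hd.
exists [set f | exists2 t, f = quart (fam t).1 (fam t).2 & monogenic f]%classic; split.
- move=> f [t -> mt]; exists (fam t).1, (fam t).2; split=> //.
  exact: irreducible_W3_not_square mt.1.
- apply: (@infinite_quart_family _ (fun t => (fam t).1) (fun t => (fam t).2)) => // T.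
  by have [t Tt mt] := hm T; exists t => //; exists t.
exact: distinct_family.
Qed.

(** W is negative along this family. *)
Lemma fam4_not_square t : ~ is_square (W (fam4 t).1 (fam4 t).2).
Proof.
move=> [k kE]; have : 0 <= W (fam4 t).1 (fam4 t).2 by rewrite kE sqr_ge0.
rewrite (_ : W _ _ = - ((6 * t%:Z + 1) * (18 * t%:Z + 19) * ((6 * t%:Z + 1) * (6 * t%:Z + 5)))); last first.
  by rewrite /W /W1 /W2 /W3 /=; ring.
by rewrite oppr_ge0 leNgt !mulr_gt0 //; lia.
Qed.

Lemma calFam_families (i : 'I_5) : (i < 4)%N ->
  exists S : set {poly int},
    [/\ (S `<=` calFam i)%classic, infinite_set S & pairwise_distinct S].
Proof.
rewrite calFamE; case: i => [[|[|[|[|i]]]] hi] //= _.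
- apply: (@family_in _ fam1) fam1_monogenic fam1_disc => t.
  + by rewrite /= mulf_neq0 //; apply/eqP; lia.
  + by rewrite /=; split; lia.
  + by rewrite /=; lia.
- apply: (@family_in _ fam2) fam2_monogenic fam2_disc => t.
  + by rewrite /= mulf_neq0 //; apply/eqP; lia.
  + by rewrite /=; split; lia.
  + by rewrite /=; lia.
- apply: (@family_in _ fam3) fam3_monogenic fam3_disc => t.
  + by rewrite /= mulf_neq0 //; apply/eqP; lia.
  + by rewrite /=; split=> //; lia.
  + by rewrite /=; lia.
apply: (@family_in _ fam4) fam4_monogenic fam4_disc => t.
+ by rewrite /= mulf_neq0 //; apply/eqP; lia.
+ split; last exact: fam4_not_square.
  by rewrite /= odd_mul; lia.
+ by rewrite /=; lia.
Qed.

Lemma calFam_Gal (i : 'I_5) f : (i < 4)%N -> calFam i f -> Gal_isog f 'D_(8%N)%type.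
Proof.
move=> i4; rewrite calFamE => -[A [B [AB _ hP -> mono]]].
move: AB; rewrite mulf_eq0 negb_or => /andP[A0 _].
apply: (monogenic_Gal_D8 mono A0).
case: i i4 hP => [[|[|[|[|i]]]] hi] //= _ [h1 h2] //; apply: (monogenic_even_not_square mono).
- by left.
- by left.
- by right.
Qed.

(** * The cyclic family and the partition *)

Definition cyclic_data : seq (int * int) := [:: (1, 1); (9, 19); (11, 31)].

Lemma cyclic_monogenic (e A B : int) : e = 1 \/ e = -1 -> (A, B) \in cyclic_data ->
  calF5 (quart (e * A) B).
Proof.
move=> he hAB.
have e2 : e ^+ 2 = 1 by case: he => ->.
have E3 : W3 (e * A) B = W3 A B by rewrite /W3 exprMn e2 mul1r.
have E12 : W1 (e * A) B = W1 A B /\ W2 (e * A) B = W2 A B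
    \/ W1 (e * A) B = W2 A B /\ W2 (e * A) B = W1 A B.
  by case: he => ->; rewrite /W1 /W2; [left | right]; split; ring.
have EW : W (e * A) B = W A B by rewrite /W E3; case: E12 => -[-> ->] //; ring.
have [s1 s2 s3] : [/\ squarefree (W1 A B), squarefree (W2 A B) & squarefree (W3 A B)].
  (* The largest of the nine values is 55 < 8^2, so divisors up to 7 suffice. *)
  by move: hAB; rewrite !inE => /or3P[] /eqP[-> ->]; split; exact: (@squarefree_compute _ 7).
have sqW : is_square (W A B).
  by move: hAB; rewrite !inE => /or3P[] /eqP[-> ->]; [exists 5 | exists 39 | exists 55].
have n3 : `|W3 A B|%N != 1%N by move: hAB; rewrite !inE => /or3P[] /eqP[-> ->].
have AB0 : e * A * B != 0.
  by move: hAB; rewrite !inE => /or3P[] /eqP[-> ->]; case: he => ->.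
have odd2 : ~~ (2 %| e * A * B)%Z.
  by move: hAB; rewrite !inE => /or3P[] /eqP[-> ->]; case: he => ->.
have nsq : ~ is_square (W3 (e * A) B) by rewrite E3; apply: squarefree_not_square.
exists (e * A), B; split=> //; first by rewrite EW.
apply: monogenic_of_conditions => //.
- by move: AB0; rewrite mulf_eq0 negb_or => /andP[].
- by case: E12 => -[-> _].
- by case: E12 => -[_ ->].
move: odd2; rewrite odd_mul /max_quad_order => /andP[/negPf -> _].
by rewrite E3.
Qed.

Lemma cyclic_repsE (e : int) f : cyclic_reps e f <->
  exists A B, (A, B) \in cyclic_data /\ f = quart (e * A) B.
Proof.
split.
- rewrite /cyclic_reps /= => -[[->|->]|->].
  + by exists 1, 1; rewrite mulr1.
  + by exists 9, 19; rewrite mulrC.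
  + by exists 11, 31; rewrite mulrC.
- move=> [A [B [hAB ->]]]; move: hAB; rewrite !inE /cyclic_reps /= => /or3P[] /eqP[-> ->].
  + by left; left; rewrite mulr1.
  + by left; right; rewrite mulrC.
  + by right; rewrite mulrC.
Qed.

Lemma calF5E : calF5 = (cyclic_reps 1 `|` cyclic_reps (-1))%classic.
Proof.
apply/seteqP; split=> f.
- move=> [A [B [AB _ [h2 sq] -> mono]]].
  move: h2; rewrite odd_mul => /andP[A2 B2].
  move: AB; rewrite mulf_eq0 negb_or => /andP[A0 _].
  have sq3 : squarefree (W3 A B).
    by have := monogenic_max_quad_order mono; rewrite /max_quad_order (negPf A2).
  case: (cyclic_finite A0 A2 B2 (monogenic_squarefree_W1 mono) (monogenic_squarefree_W2 mono) sq3 sq)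
    => -[[->|->] ->].
  + by left; apply/cyclic_repsE; exists 1, 1; rewrite mul1r.
  + by right; apply/cyclic_repsE; exists 1, 1; rewrite mulN1r.
  + by left; apply/cyclic_repsE; exists 9, 19; rewrite mul1r.
  + by right; apply/cyclic_repsE; exists 9, 19; rewrite mulN1r.
  + by left; apply/cyclic_repsE; exists 11, 31; rewrite mul1r.
  + by right; apply/cyclic_repsE; exists 11, 31; rewrite mulN1r.
move=> [] /cyclic_repsE [A [B [hAB ->]]]; apply: cyclic_monogenic => //.
- by left.
- by right.
Qed.

Lemma card_set_seq (T : choiceType) (s : seq T) (S : set T) : uniq s ->
  (forall x, S x <-> x \in s) -> (S #= `I_(size s))%card.
Proof.
move=> us hS; apply/card_set_bijP; exists (index^~ s); split.
- by move=> x /hS xs; rewrite /= index_mem.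
- by move=> x y; rewrite !inE => /hS xs /hS ys e; rewrite -(nth_index x xs) e nth_index.
- move=> i /= hi; case: s us hS hi => // x0 s us hS hi.
  by exists (nth x0 (x0 :: s) i); [apply/hS/mem_nth | rewrite index_uniq].
Qed.

Lemma quart_seq_uniq (s : seq (int * int)) : uniq s -> uniq [seq quart p.1 p.2 | p <- s].
Proof. by rewrite map_inj_uniq // => -[a b] [c d] /quart_inj /= [-> ->]. Qed.

Lemma cyclic_reps_mem (e : int) f :
  cyclic_reps e f <-> f \in [seq quart p.1 p.2 | p <- [:: (e, 1); (9 * e, 19); (11 * e, 31)]].
Proof.
rewrite /= !inE; split; first by case=> [[->|->]|->]; rewrite eqxx ?orbT.
by case/or3P => /eqP ->; [left; left | left; right | right].
Qed.

Lemma calF5_card : (calF5 #= `I_6)%card.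
Proof.
pose s : seq (int * int) := [:: (1, 1); (9, 19); (11, 31); (-1, 1); (-9, 19); (-11, 31)].
apply: (@card_set_seq _ [seq quart p.1 p.2 | p <- s]); first exact: quart_seq_uniq.
move=> f; rewrite (_ : s = [:: (1, 1); (9 * 1, 19); (11 * 1, 31)] ++ [:: (-1, 1); (9 * -1, 19); (11 * -1, 31)]) //.
rewrite calF5E map_cat mem_cat; split; first by case=> /cyclic_reps_mem ->; rewrite ?orbT.
by case/orP => /cyclic_reps_mem; [left | right].
Qed.

Lemma cyclic_reps_card : (cyclic_reps 1 #= `I_3)%card.
Proof.
apply: (@card_set_seq _ [seq quart p.1 p.2 | p <- [:: (1, 1); (9 * 1, 19); (11 * 1, 31)]]).
  exact: quart_seq_uniq.
by move=> f; apply: cyclic_reps_mem.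
Qed.

Lemma calF5_monogenic f : calF5 f -> monogenic f.
Proof. by case=> A [B [_ _ _ _]]. Qed.

Lemma calF5_Gal f : calF5 f -> Gal_isog f 'Z_4.
Proof.
move=> [A [B [AB _ [_ sq] -> mono]]]; apply: (monogenic_Gal_Z4 mono) => //.
by move: AB; rewrite mulf_eq0 negb_or => /andP[].
Qed.

Lemma cyclic_reps_sub : (cyclic_reps 1 `<=` calF5)%classic.
Proof. by rewrite calF5E => f; left. Qed.

(** The three discriminants are 125, 19773 and 15125. *)
Lemma cyclic_reps_distinct : pairwise_distinct (cyclic_reps 1).
Proof.
move=> f g hf hg ne; move: (calF5_monogenic (cyclic_reps_sub hf)) (calF5_monogenic (cyclic_reps_sub hg)).
move/cyclic_repsE: hf ne => [A [B [hA ->]]]; move/cyclic_repsE: hg => [C [D [hC ->]]].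
rewrite !mul1r => ne mf mg /(equivalent_disc mf mg) e; apply: ne.
by move: hA hC e; rewrite /quart_disc /W1 /W2 /W3 !inE => /or3P[] /eqP[-> ->] /or3P[] /eqP[-> ->] e;
  first [by exfalso; lia | reflexivity].
Qed.

(** Any further member has sign -1 and is equivalent, through theta -> - theta, to its counterpart
    of sign 1, which T already contains. *)
Lemma cyclic_reps_maximal (T : set {poly int}) :
  (cyclic_reps 1 `<=` T)%classic -> (T `<=` calF5)%classic ->
  pairwise_distinct T -> T = cyclic_reps 1.
Proof.
move=> h1 h2 dT; apply/seteqP; split=> // f Tf.
have := h2 f Tf; rewrite calF5E => -[//|].
move/cyclic_repsE => [A [B [hA fE]]]; exfalso.
have hg : cyclic_reps 1 (quart A B) by apply/cyclic_repsE; exists A, B; rewrite mul1r.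
apply: (dT _ _ (h1 _ hg) Tf).
  rewrite fE => /quart_inj[+ _]; move: hA; rewrite !inE => /or3P[] /eqP[-> _]; done.
rewrite fE mulN1r; apply: equivalent_opp.
exact: (calF5_monogenic (cyclic_reps_sub hg)).1.
Qed.

Lemma calFam_partition : partition [set: 'I_5]%classic calFam
  [set f | exists A B : int, [/\ A * B != 0, f = quart A B & monogenic f]]%classic.
Proof.
split.
- apply/seteqP; split=> f.
    by move=> [i _]; rewrite calFamE => -[A [B [AB _ _ fE mono]]]; exists A, B.
  move=> [A [B [AB fE mono]]]; have [i _ hi] := famP_total A B.
  exists i => //; rewrite calFamE; exists A, B; split=> //.
  by apply: irreducible_W3_not_square; have [irr _] := mono; rewrite fE in irr.
- move=> i j _ _ [f []]; rewrite !calFamE => -[A [B [_ _ hi -> _]]] [C [D [_ _ hj /quart_inj[AC BD] _]]].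
  by apply: (famP_uniq hi); rewrite AC BD.
(* A partition also requires nonempty parts: A = B = 1 lies in the fifth, and the other four are
   infinite. *)
move=> i _; case: (ltnP i 4) => i4; last first.
  exists (quart 1 1); rewrite (_ : i = ord_max); last by apply: val_inj => /=; have := ltn_ord i; lia.
  by rewrite -[calFam _]/calF5 calF5E; left; apply/cyclic_repsE; exists 1, 1; rewrite mulr1.
have [S [SF Sinf _]] := calFam_families i4.
have /infinite_setN0[f Sf] := Sinf.
by exists f; apply: SF.
Qed.

Theorem theorem1p1 :
  [/\ (forall A : int, A \notin [:: 0; 1; -1] ->
         (monogenic (quart A 0) <->
            [/\ (2 %| A)%Z, squarefree (A - 1), squarefree (A + 1)
              & squarefree ((A %/ 2)%Z ^+ 2 + 2)])),
      infinite_set calF,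
      (forall f, calF f -> Gal_isog f 'D_(8%N)%type)
    & pairwise_distinct calFplus /\
      (forall f, calF f -> exists2 g, calFplus g & equivalent f g)] /\
  (forall A B : int, A * B != 0 -> ~ is_square (W3 A B) ->
     (monogenic (quart A B) <->
        squarefree (W1 A B) /\
        squarefree (W2 A B) /\
        ((2 %| A)%Z -> (2 %| B)%Z ->
           squarefree (W3 A B %/ 4)%Z /\
           ((A %% 4)%Z, (B %% 4)%Z) \in [:: (0, 0); (2, 0)]) /\
        ((2 %| A)%Z -> ~~ (2 %| B)%Z ->
           squarefree (W3 A B %/ 4)%Z /\
           ((A %% 4)%Z, (B %% 4)%Z) \in [:: (0, 3); (2, 1)]) /\
        (~~ (2 %| A)%Z -> (2 %| B)%Z ->
           squarefree (W3 A B) /\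
           ((A %% 4)%Z, (B %% 4)%Z) \in [:: (1, 2); (3, 2)]) /\
        (~~ (2 %| A * B)%Z ->
           squarefree (W3 A B) /\
           ((A %% 4)%Z, (B %% 4)%Z) \in
             [:: (1, 1); (1, 3); (3, 1); (3, 3)]))) /\
  [/\ partition [set: 'I_5]%classic calFam
        [set f | exists A B : int,
           [/\ A * B != 0, f = quart A B & monogenic f]]%classic,
      (forall i : 'I_5, (i < 4)%N ->
         (forall f, calFam i f -> Gal_isog f 'D_(8%N)%type) /\
         (exists S : set {poly int},
            [/\ (S `<=` calFam i)%classic, infinite_set S
              & pairwise_distinct S])),
      calF5 = (cyclic_reps 1 `|` cyclic_reps (-1))%classic /\ (calF5 #= `I_6)%card,
      (forall f, calF5 f -> Gal_isog f 'Z_4)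
    & [/\ (cyclic_reps 1 #= `I_3)%card,
          (cyclic_reps 1 `<=` calF5)%classic,
          pairwise_distinct (cyclic_reps 1)
        & forall T : set {poly int},
            (cyclic_reps 1 `<=` T)%classic -> (T `<=` calF5)%classic ->
            pairwise_distinct T -> T = cyclic_reps 1]].
Proof.
split; first split.
- exact: monogenic_B0.
- exact: calF_infinite.
- exact: calF_Gal.
- by split; [exact: calFplus_distinct | exact: calF_equivalent_plus].
split; first exact: monogenic_criterion.
split.
- exact: calFam_partition.
- by move=> i i4; split; [move=> f; apply: calFam_Gal | apply: calFam_families].
- by split; [exact: calF5E | exact: calF5_card].
- exact: calF5_Gal.
split; [exact: cyclic_reps_card | exact: cyclic_reps_sub | exact: cyclic_reps_distinct |].
exact: cyclic_reps_maximal.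
Qed.
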